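(* Let $n > 2$ and $f_{\alpha\beta}(x, t)$, $2 \leq \alpha, \beta \leq n$, be real-analytic, real-valued functions in a connected open subset $U \times V \subset \mathbb{R}^n \times (\mathbb{R} \setminus \{0\})$. Then the following two conditions are equivalent: (i) For any $x_0 = (x_0^1, \dots, x_0^n) \in U$ and any real-valued, real-analytic functions $a(x^1)$, $a_2(x^1), \dots, a_n(x^1)$ in a neighborhood of $x_0^1$ in $\mathbb{R}$ such that $a''(x_0^1) \in V$, there exists a unique real-valued, real-analytic solution $u(x)$ in a neighborhood of $x_0$ to the Cauchy problem $$\begin{cases} \Delta_{\alpha\beta}(u) = f_{\alpha\beta}(x, u_{11}), \\ u(x^1, x_0^2, \dots, x_0^n) = a(x^1), \quad u_\alpha(x^1, x_0^2, \dots, x_0^n) = a_\alpha(x^1), \end{cases} \quad \alpha, \beta = 2, \dots, n.$$ (ii) The functions $f_{\alpha\beta}$ are of the form $f_{\alpha\beta}(x, t) = g_{\alpha\beta}(x)t$ with $g_{\alpha\beta}$ satisfying the compatibility conditions $$g_{\alpha\beta} = g_{\beta\alpha}, \quad \partial_{x^1} g_{\alpha\beta} = 0, \quad \partial_{x^\gamma} g_{\alpha\beta} = \partial_{x^\beta} g_{\alpha\gamma}, \quad \alpha, \beta, \gamma = 2, \dots, n.$$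
   Context: Coordinates $x=(x^1,\dots,x^n)$ on $\mathbb{R}^n$. For a function $u(x)$, $u_i = \partial u/\partial x^i$, $u_{ij} = \partial^2 u/\partial x^i \partial x^j$. For $2 \leq \alpha,\beta \leq n$, $\Delta_{\alpha\beta}(u) := \det \begin{pmatrix} u_{11} & u_{1\beta} \\ u_{\alpha 1} & u_{\alpha\beta} \end{pmatrix}$. *)

(* Defs.v *)
From HB Require Import structures.
From mathcomp Require Import all_boot all_order all_algebra.
From mathcomp Require Import all_classical all_reals all_analysis.
Set Implicit Arguments. Unset Strict Implicit. Unset Printing Implicit Defensive.
Import Order.TTheory GRing.Theory Num.Theory.
Import numFieldNormedType.Exports.
Local Open Scope classical_set_scope.
Local Open Scope ring_scope.

Section Defs.
Variable R : realType.

Definition monom (m : nat) (k : {ffun 'I_m -> nat}) (x0 x : 'rV[R]_m) : R :=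
  \prod_(i < m) (x ord0 i - x0 ord0 i) ^+ (k i).

Definition mi (m N : nat) (k : {ffun 'I_m -> 'I_N}) : {ffun 'I_m -> nat} :=
  [ffun i => nat_of_ord (k i)].

(* real-analyticity at x0: f is represented, on a ball around x0, by an
   absolutely convergent multiple power series centered at x0
   (its sum taken as the limit of the square partial sums). *)
Definition analytic_at (m : nat) (f : 'rV[R]_m -> R) (x0 : 'rV[R]_m) : Prop :=
  exists (c : {ffun 'I_m -> nat} -> R) (r : R), 0 < r /\
    forall x : 'rV[R]_m, `|x - x0| < r ->
      (exists M : R, forall N : nat,
          \sum_(k : {ffun 'I_m -> 'I_N}) `|c (mi k) * monom (mi k) x0 x| <= M) /\
      ((fun N : nat => \sum_(k : {ffun 'I_m -> 'I_N}) c (mi k) * monom (mi k) x0 x)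
         @ \oo --> f x).

Definition analytic_on (m : nat) (f : 'rV[R]_m -> R) (W : set 'rV[R]_m) : Prop :=
  forall x, W x -> analytic_at f x.

Definition analytic_on1 (a : R -> R) (I : set R) : Prop :=
  analytic_on (fun y : 'rV[R]_1 => a (y ord0 ord0)) [set y | I (y ord0 ord0)].

Definition analytic_on2 (n : nat) (f : 'rV[R]_n -> R -> R)
    (U : set 'rV[R]_n) (V : set R) : Prop :=
  analytic_on (fun y : 'rV[R]_(n + 1) => f (lsubmx y) (rsubmx y ord0 ord0))
    [set y | U (lsubmx y) /\ V (rsubmx y ord0 ord0)].

Definition evec (n : nat) (i : 'I_n) : 'rV[R]_n := \row_j (j == i)%:R.

Definition pd (n : nat) (i : 'I_n) (u : 'rV[R]_n -> R) : 'rV[R]_n -> R :=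
  fun x => derive u x (evec i).

(* Delta_{alpha beta}(u) = u_11 u_{alpha beta} - u_{1 beta} u_{alpha 1},
   where i1 is the index of the first coordinate x^1 *)
Definition Delta (n : nat) (i1 al be : 'I_n) (u : 'rV[R]_n -> R) (x : 'rV[R]_n) : R :=
  pd i1 (pd i1 u) x * pd al (pd be u) x - pd i1 (pd be u) x * pd al (pd i1 u) x.

Definition pt (n : nat) (i1 : 'I_n) (x0 : 'rV[R]_n) (s : R) : 'rV[R]_n :=
  \row_j (if j == i1 then s else x0 ord0 j).

Definition solves (n : nat) (i1 : 'I_n) (U : set 'rV[R]_n) (V : set R)
    (f : 'I_n -> 'I_n -> 'rV[R]_n -> R -> R) (x0 : 'rV[R]_n)
    (a : R -> R) (aa : 'I_n -> R -> R) (I : set R)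
    (W : set 'rV[R]_n) (u : 'rV[R]_n -> R) : Prop :=
  [/\ open W /\ W x0, W `<=` U, analytic_on u W,
      (forall x, W x -> V (pd i1 (pd i1 u) x) /\
         forall al be : 'I_n, al != i1 -> be != i1 ->
           Delta i1 al be u x = f al be x (pd i1 (pd i1 u) x))
    & (forall s, I s -> W (pt i1 x0 s) ->
         u (pt i1 x0 s) = a s /\
         forall al : 'I_n, al != i1 -> pd al u (pt i1 x0 s) = aa al s)].

End Defs.

Definition ord_first (n : nat) (h : (0 < n)%N) : 'I_n := Ordinal h.

(* Main.v *)
Require Import Defs.
From HB Require Import structures.
From mathcomp Require Import all_boot all_order all_algebra.
From mathcomp Require Import all_classical all_reals all_analysis.
From mathcomp Require Import ring lra zify.
Import Order.TTheory GRing.Theory Num.Theory.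
Import numFieldNormedType.Exports.
Local Open Scope classical_set_scope.
Local Open Scope ring_scope.

(** Sufficiency.  When [f = g t], the equation says that the partial Legendre
    transform [v] of [u] in [x^1] satisfies [v_{al be} = - g_{al be}].  The
    compatibility conditions give a potential [G] of [g], independent of [x^1],
    and [u - G] must be the envelope of a one-parameter family of affine
    functions read off the Cauchy data.  The parameter [s] is determined by
    [s - s0 = \sum_i phi_i(s) (x^i - x0^i)] with [phi_i] rational in the
    derivatives of the data, so existence is an analytic implicit function
    theorem.  Uniqueness: the difference [w] of two solutions satisfies a linear
    equation expressing [w_{al be}] through [w_{11}], [w_{1 al}], [w_{1 be}], so
    its order of vanishing in [x^2, ..., x^n] at the initial line is infinite.

    Necessity.  Differentiating the equations once and eliminating
    [u_{al be ga}] by symmetry gives, at any point, an identity polynomial in the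
    free second and third derivatives of the Cauchy data.  Its coefficients are
    [d_t (f/t) = 0], [d_1 f = 0] and [d_ga f_{al be} = d_be f_{al ga}]; two
    distinct indices [be], [ga] are needed, whence [n > 2].

    Analyticity is handled through the bounds [|D_w f| <= K^(l+1) l!] on iterated
    partial derivatives along words [w] of length [l].  Composition and the
    implicit function theorem both reduce to functions [v] solving a system
    [d_i v = Phi_i(v)]: then [D_w (f o v) = (L_w f) o v] for the vector fields
    [L_i = \sum_b Phi_{ib} d_b], and iterated vector fields obey explicit
    factorial bounds. *)

Set Implicit Arguments. Unset Strict Implicit. Unset Printing Implicit Defensive.

(** * First-order expansions *)

(** Since [G] does not depend on [x^1], substituting [u = w + G] turns
    [Delta_{al be}(u) = g_{al be} u_11] into [Delta_{al be}(w) = 0]. As [w_11] is nonzero, the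
    Hessian of [w] has rank one, so the gradient of [w] depends on a single parameter; this is why
    [w] is an envelope of affine functions and why the Cauchy data determine it. The system is
    overdetermined, and a direct power series construction would have to check compatibility in
    every degree; the envelope formula replaces this by one scalar implicit equation.

    [analytic_at] fixes one centre and sums over squares of exponents, which behaves badly under
    change of centre and composition. It is converted into derivative bounds when a hypothesis is
    used and recovered when a solution is delivered. Symmetry of mixed derivatives and the
    integration of closed forms go back to power series, where both are identities between
    coefficients. *)

Section Norms.
Variable R : realType.

Lemma coord_le_norm m (x : 'rV[R]_m) i : `|x ord0 i| <= `|x|.
Proof.
rewrite [leRHS]/Num.Def.normr/= mx_normrE; apply/bigmax_geP; right => /=.
by exists (ord0, i).
Qed.

Lemma norm_rV_le m (x : 'rV[R]_m) (e : R) :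
  0 <= e -> (forall i, `|x ord0 i| <= e) -> `|x| <= e.
Proof.
move=> e0 xe; rewrite [leLHS]/Num.Def.normr/= mx_normrE.
by apply: bigmax_le => // -[i j] _ /=; rewrite ord1.
Qed.

(** Balls are measured by an inverse radius [K]: shrinking a ball means enlarging [K], so the same
    constant can later bound the growth of derivatives. *)
Lemma nearKP (V : normedModType R) (x0 : V) (P : set V) :
  (\forall x \near x0, P x) <->
  exists2 K : R, 0 < K & forall x, `|x - x0| * K < 1 -> P x.
Proof.
split.
  move=> /nbhs_normP[e /= e0 eP]; exists e^-1; rewrite ?invr_gt0// => x xe.
  by apply: eP => /=; rewrite distrC -[e]mul1r -ltr_pdivrMr.
move=> [K K0 KP]; apply/nbhs_normP; exists K^-1 => /=; first by rewrite invr_gt0.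
by move=> x /=; rewrite distrC => xK; apply: KP; rewrite -ltr_pdivlMr// div1r.
Qed.

Lemma near_normK (V : normedModType R) (x0 : V) (K : R) : 0 < K ->
  \forall x \near x0, `|x - x0| * K < 1.
Proof. by move=> K0; apply/nearKP; exists K. Qed.

Lemma near_nearK (V : normedModType R) (x0 x : V) (K : R) : 0 < K ->
  `|x - x0| * K < 1 -> \forall y \near x, `|y - x0| * K < 1.
Proof.
move=> K0 xK; have d0 : 0 < 1 - `|x - x0| * K by rewrite subr_gt0.
apply/nearKP; exists (K / (1 - `|x - x0| * K)); first by rewrite divr_gt0.
move=> y; rewrite mulrA ltr_pdivrMr// mul1r => yx.
rewrite -(subrK x y) -addrA (le_lt_trans (ler_wpM2r (ltW K0) (ler_normD _ _)))//.
by rewrite mulrDl -ltrBrDr.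
Qed.

Lemma quad_is_derive (V : normedModType R) (f : V -> R) (x v : V) (c : R) :
  (exists K : R, \forall h \near (0 : R),
     `|f (h *: v + x) - f x - c * h| <= K * `|h| ^+ 2) ->
  is_derive x v f c.
Proof.
move=> [K fK].
have cv : (fun h : R => h^-1 *: ((f \o shift x) (h *: v) - f x)) @ 0^' --> c.
  apply/cvgrPdist_le => e e0; near=> h.
  have h0 : h != 0 by near: h; exact: nbhs_dnbhs_neq.
  have hK : `|f (h *: v + x) - f x - c * h| <= K * `|h| ^+ 2.
    by near: h; exact: (nbhs_dnbhs fK).
  have he : `|h| * (`|K| + 1) < e.
    near: h; apply: nbhs_dnbhs.
    have Ke : 0 < (`|K| + 1) / e by rewrite divr_gt0// ltr_pwDr.
    have := near_normK (0 : R) Ke; apply: filterS => h.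
    by rewrite subr0 mulrA ltr_pdivrMr// mul1r.
  rewrite distrC -(@ler_pM2r _ `|h|) ?normr_gt0// -normrM mulrBl /= /GRing.scale/=.
  rewrite mulrAC mulVf// mul1r; apply: (le_trans hK).
  rewrite expr2 mulrA ler_pM2r ?normr_gt0//; apply: ltW; apply: le_lt_trans he.
  rewrite mulrC ler_wpM2l//; apply: (le_trans (ler_norm K)); lra.
by split; [apply/cvg_ex; exists c | exact: cvg_lim cv].
Unshelve. all: by end_near.
Qed.

Lemma near_line (V : normedModType R) (x v : V) (P : V -> Prop) :
  (\forall y \near x, P y) -> \forall h \near (0 : R), P (h *: v + x).
Proof.
have cv : (fun h : R => h *: v + x) @ nbhs (0 : R) --> x.
  rewrite -{2}[x]add0r -[0 in X in _ --> X](scale0r v).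
  by apply: cvgD; [apply: cvgZr_tmp; exact: cvg_id | exact: cvg_cst].
by move=> h; exact: cv _ h.
Qed.

End Norms.

Section Grad.
Variable R : realType.

Lemma nearI m (x : 'rV[R]_m) (P Q : 'rV[R]_m -> Prop) :
  (\forall y \near x, P y) -> (\forall y \near x, Q y) ->
  \forall y \near x, P y /\ Q y.
Proof. by move=> h1 h2; exact: filterI. Qed.

Lemma nearA m (x : 'rV[R]_m) (P : 'rV[R]_m -> Prop) :
  (forall y, P y) -> \forall y \near x, P y.
Proof. by move=> h; apply/nearKP; exists 1. Qed.

Lemma nearS m (x : 'rV[R]_m) (P Q : 'rV[R]_m -> Prop) :
  (forall y, P y -> Q y) -> (\forall y \near x, P y) -> \forall y \near x, Q y.
Proof. by move=> h1 h2; exact: filterS h2. Qed.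

Lemma near_forall m (I : finType) (x : 'rV[R]_m) (P : I -> 'rV[R]_m -> Prop) :
  (forall i, \forall y \near x, P i y) -> \forall y \near x, forall i, P i y.
Proof. by move=> h; exact: (@filter_forall _ _ P (nbhs x)). Qed.

(* First-order expansion with a quadratic remainder; all functions met below
   are twice differentiable, so nothing is lost over little-o. *)
Definition grad m (f : 'rV[R]_m -> R) (x : 'rV[R]_m) (g : 'I_m -> R) : Prop :=
  exists K : R, \forall y \near x,
    `|f y - f x - \sum_i g i * (y ord0 i - x ord0 i)| <= K * `|y - x| ^+ 2.

Lemma lin_le m (g : 'I_m -> R) (x y : 'rV[R]_m) :
  `|\sum_i g i * (y ord0 i - x ord0 i)| <= (\sum_i `|g i|) * `|y - x|.
Proof.
apply: (le_trans (ler_norm_sum _ _ _)); rewrite mulr_suml; apply: ler_sum => i _.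
by rewrite normrM ler_wpM2l// -[_ - _](_ : (y - x) ord0 i = _) ?coord_le_norm// !mxE.
Qed.

Lemma grad_lip m (f : 'rV[R]_m -> R) x g : grad f x g ->
  exists2 L : R, 0 < L & \forall y \near x, `|f y - f x| <= L * `|y - x|.
Proof.
move=> [K fK]; exists (`|K| + \sum_i `|g i| + 1).
  by rewrite ltr_pwDr// addr_ge0// sumr_ge0.
near=> y.
have y1 : `|y - x| * 1 < 1 by near: y; exact: (near_normK x ltr01).
have yK : `|f y - f x - \sum_i g i * (y ord0 i - x ord0 i)| <= K * `|y - x| ^+ 2.
  by near: y.
rewrite mulr1 in y1.
have := lin_le g x y; set s := \sum_i _; set S := \sum_i _ => sS.
have -> : f y - f x = (f y - f x - s) + s by ring.
apply: (le_trans (ler_normD _ _)); apply: (le_trans (lerD yK sS)).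
rewrite !mulrDl.
have : K * `|y - x| ^+ 2 <= `|K| * `|y - x|.
  apply: le_trans (_ : `|K| * `|y - x| ^+ 2 <= _).
    by rewrite ler_wpM2r ?exprn_ge0// ler_norm.
  by rewrite ler_wpM2l// expr2 ler_piMl// ltW.
have := normr_ge0 (y - x); lra.
Unshelve. all: by end_near.
Qed.

Lemma grad_is_derive m (f : 'rV[R]_m -> R) x g (v : 'rV[R]_m) : grad f x g ->
  is_derive x v f (\sum_i g i * v ord0 i).
Proof.
move=> [K fK]; apply: quad_is_derive; exists (K * `|v| ^+ 2).
have : \forall h \near (0 : R), `|f (h *: v + x) - f x -
    \sum_i g i * ((h *: v + x) ord0 i - x ord0 i)| <= K * `|h *: v + x - x| ^+ 2.
  exact: (near_line v fK).
apply: filterS => h /=.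
rewrite addrK normrZ exprMn -mulrA [`|h| ^+ 2 * _]mulrC; congr (`|_ - _| <= _).
by rewrite mulr_suml; apply: eq_bigr => i _; rewrite !mxE addrK; ring.
Qed.

Lemma grad_pd m (f : 'rV[R]_m -> R) x g i : grad f x g -> pd i f x = g i.
Proof.
move=> fg; rewrite /pd; have [_ ->] := grad_is_derive (evec R i) fg.
rewrite (bigD1 i)//= big1 => [|j ji]; rewrite !mxE ?eqxx ?mulr1 ?addr0//.
by rewrite (negPf ji) mulr0.
Qed.

Lemma grad_near m (f f' : 'rV[R]_m -> R) x g :
  (\forall y \near x, f y = f' y) -> grad f x g -> grad f' x g.
Proof.
move=> ff' [K fK]; exists K; have := nearI ff' fK.
by apply: nearS => y [<-]; rewrite -(nbhs_singleton ff').
Qed.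

Lemma eq_grad m (f : 'rV[R]_m -> R) x g g' : g =1 g' -> grad f x g -> grad f x g'.
Proof. by move=> gg'; rewrite (funext gg'). Qed.

Lemma grad_cst m (c : R) (x : 'rV[R]_m) : grad (fun=> c) x (fun=> 0).
Proof.
exists 0; apply: nearA => y; rewrite big1 => [|i _]; last by rewrite mul0r.
by rewrite !subrr normr0 mul0r.
Qed.

Lemma grad_coord m (b : 'I_m) (x : 'rV[R]_m) :
  grad (fun y => y ord0 b) x (fun i => (i == b)%:R).
Proof.
exists 0; apply: nearA => y; rewrite (bigD1 b)//= big1 => [|i /negPf->].
  by rewrite eqxx mul1r addr0 subrr normr0 mul0r.
by rewrite mul0r.
Qed.

Lemma gradD m (f1 f2 : 'rV[R]_m -> R) x g1 g2 : grad f1 x g1 -> grad f2 x g2 ->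
  grad (fun y => f1 y + f2 y) x (fun i => g1 i + g2 i).
Proof.
move=> [K1 h1] [K2 h2]; exists (K1 + K2); have := nearI h1 h2.
apply: nearS => y [y1 y2]; rewrite mulrDl.
apply: le_trans (lerD y1 y2); apply: le_trans (ler_normD _ _).
rewrite le_eqVlt; apply/orP; left; apply/eqP; congr `|_|.
by rewrite (eq_bigr (fun i => g1 i * (y ord0 i - x ord0 i) +
  g2 i * (y ord0 i - x ord0 i))) ?big_split/=; [ring | move=> i _; rewrite mulrDl].
Qed.

Lemma gradM m (f1 f2 : 'rV[R]_m -> R) x g1 g2 : grad f1 x g1 -> grad f2 x g2 ->
  grad (fun y => f1 y * f2 y) x (fun i => g1 i * f2 x + f1 x * g2 i).
Proof.
move=> G1 G2; have [L1 L10 l1] := grad_lip G1; have [L2 L20 l2] := grad_lip G2.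
move: G1 G2 => [K1 h1] [K2 h2].
exists (`|f2 x| * K1 + `|f1 x| * K2 + L1 * L2).
have := nearI (nearI h1 h2) (nearI l1 l2).
apply: nearS => y [[y1 y2] [z1 z2]].
set S1 := \sum_i _ in y1; set S2 := \sum_i _ in y2.
have -> : \sum_i (g1 i * f2 x + f1 x * g2 i) * (y ord0 i - x ord0 i) =
    S1 * f2 x + f1 x * S2.
  rewrite mulr_suml mulr_sumr -big_split/=; apply: eq_bigr => i _; ring.
(* Two first-order remainders plus the product of the increments; the latter is quadratic because
   both factors are Lipschitz, whence the constant [L1 * L2]. *)
have -> : f1 y * f2 y - f1 x * f2 x - (S1 * f2 x + f1 x * S2) =
  f2 x * (f1 y - f1 x - S1) + f1 x * (f2 y - f2 x - S2)
  + (f1 y - f1 x) * (f2 y - f2 x) by ring.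
rewrite [leRHS]mulrDl [X in _ <= X + _]mulrDl.
apply: (le_trans (ler_normD _ _)); apply: lerD.
  apply: (le_trans (ler_normD _ _)).
  by apply: lerD; rewrite normrM -mulrA ler_wpM2l.
have -> : L1 * L2 * `|y - x| ^+ 2 = (L1 * `|y - x|) * (L2 * `|y - x|) by ring.
by rewrite normrM ler_pM.
Qed.

Lemma grad_sum m (I : Type) (r : seq I) (F : I -> 'rV[R]_m -> R) x
    (G : I -> 'I_m -> R) :
  (forall j, grad (F j) x (G j)) ->
  grad (fun y => \sum_(j <- r) F j y) x (fun i => \sum_(j <- r) G j i).
Proof.
move=> FG; elim: r => [|j r IH].
  apply: eq_grad (grad_near _ (grad_cst 0 x)); first by move=> i; rewrite big_nil.
  by apply: nearA => y; rewrite big_nil.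
apply: eq_grad (grad_near _ (gradD (FG j) IH)); first by move=> i; rewrite big_cons.
by apply: nearA => y; rewrite big_cons.
Qed.

Lemma gradZ m (f : 'rV[R]_m -> R) x g (c : R) : grad f x g ->
  grad (fun y => c * f y) x (fun i => c * g i).
Proof.
move=> fg; apply: eq_grad (gradM (grad_cst c x) fg) => i.
by rewrite mul0r add0r.
Qed.

Lemma gradB m (f1 f2 : 'rV[R]_m -> R) x g1 g2 : grad f1 x g1 -> grad f2 x g2 ->
  grad (fun y => f1 y - f2 y) x (fun i => g1 i - g2 i).
Proof.
move=> G1 G2; apply: eq_grad (grad_near _ (gradD G1 (gradZ (-1) G2))).
  by move=> i; rewrite mulN1r.
by apply: nearA => y; rewrite mulN1r.
Qed.

Lemma lip_row m p (v : 'rV[R]_m -> 'rV[R]_p) x :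
  (forall b, exists2 L : R, 0 < L &
     \forall y \near x, `|v y ord0 b - v x ord0 b| <= L * `|y - x|) ->
  exists2 L : R, 0 < L & \forall y \near x, `|v y - v x| <= L * `|y - x|.
Proof.
move=> vL0; have /choice[L vL] : forall b, exists L : R, 0 < L /\
    \forall y \near x, `|v y ord0 b - v x ord0 b| <= L * `|y - x|.
  by move=> b; have [l] := vL0 b; exists l.
have L0 b : 0 < L b by have [] := vL b.
exists (1 + \sum_b L b).
  by rewrite ltr_pwDl// sumr_ge0// => b _; exact: ltW.
have : \forall y \near x, forall b, `|v y ord0 b - v x ord0 b| <= L b * `|y - x|.
  by apply: near_forall => b; have [] := vL b.
apply: nearS => y yL; apply: norm_rV_le => [|b].
  by rewrite mulr_ge0// addr_ge0// sumr_ge0// => b _; exact: ltW.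
rewrite !mxE (le_trans (yL b))// ler_wpM2r// (bigD1 b)//=.
have : 0 <= \sum_(i < p | i != b) L i by apply: sumr_ge0 => i _; exact: ltW.
lra.
Qed.

Lemma row_cont m p (v : 'rV[R]_m -> 'rV[R]_p) x :
  (exists2 L : R, 0 < L & \forall y \near x, `|v y - v x| <= L * `|y - x|) ->
  {for x, continuous v}.
Proof.
move=> [L L0 vL]; apply/(@cvgrPdist_lt _ _ _ (nbhs x)) => e e0.
have := nearI vL (near_normK x (divr_gt0 L0 e0)); apply: nearS => y [yL].
rewrite mulrA ltr_pdivrMr// mul1r mulrC => yLe.
by rewrite distrC; exact: le_lt_trans yL yLe.
Qed.

Lemma grad_comp m p (v : 'rV[R]_m -> 'rV[R]_p) (f : 'rV[R]_p -> R) x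
    (dv : 'I_m -> 'I_p -> R) (df : 'I_p -> R) :
  (forall b, grad (fun y => v y ord0 b) x (dv^~ b)) -> grad f (v x) df ->
  grad (fun y => f (v y)) x (fun i => \sum_b dv i b * df b).
Proof.
move=> gv [K fK].
have lv : exists2 L : R, 0 < L & \forall y \near x, `|v y - v x| <= L * `|y - x|.
  by apply: lip_row => b; exact: grad_lip (gv b).
have vc := row_cont lv.
have [L L0 vL] := lv.
have [k vk] := choice gv.
have vk' : \forall y \near x, forall b,
  `|v y ord0 b - v x ord0 b - \sum_i dv i b * (y ord0 i - x ord0 i)| <= k b * `|y - x| ^+ 2.
  exact: near_forall.
exists (`|K| * L ^+ 2 + \sum_b `|df b| * k b).
have fK' : \forall y \near x, `|f (v y) - f (v x) -
    \sum_b df b * (v y ord0 b - v x ord0 b)| <= K * `|v y - v x| ^+ 2.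
  exact: vc _ fK.
have := nearI (nearI fK' vL) vk'.
apply: nearS => y [[/= y1 y2] y3].
(* The remainder of [f] at the moved point, plus the remainders of the components of [v] weighted by
   [df]. *)
have -> : f (v y) - f (v x) - \sum_i (\sum_b dv i b * df b) * (y ord0 i - x ord0 i) =
   (f (v y) - f (v x) - \sum_b df b * (v y ord0 b - v x ord0 b)) +
   \sum_b df b * (v y ord0 b - v x ord0 b - \sum_i dv i b * (y ord0 i - x ord0 i)).
  have -> : \sum_b df b * (v y ord0 b - v x ord0 b -
      \sum_i dv i b * (y ord0 i - x ord0 i)) =
      \sum_b df b * (v y ord0 b - v x ord0 b) -
      \sum_b df b * \sum_i dv i b * (y ord0 i - x ord0 i).
    by rewrite -sumrB; apply: eq_bigr => b _; rewrite mulrBr.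
  suff -> : \sum_i (\sum_b dv i b * df b) * (y ord0 i - x ord0 i) =
    \sum_b df b * \sum_i dv i b * (y ord0 i - x ord0 i) by ring.
  under eq_bigr => i _ do rewrite mulr_suml.
  rewrite exchange_big; apply: eq_bigr => b _; rewrite mulr_sumr.
  by apply: eq_bigr => i _; ring.
apply: (le_trans (ler_normD _ _)); rewrite mulrDl; apply: lerD.
  apply: (le_trans y1); rewrite -mulrA -exprMn.
  apply: (@le_trans _ _ (`|K| * `|v y - v x| ^+ 2)).
    by rewrite ler_wpM2r ?exprn_ge0// ler_norm.
  by rewrite ler_wpM2l// lerXn2r// nnegrE// mulr_ge0// ltW.
apply: (le_trans (ler_norm_sum _ _ _)); rewrite mulr_suml; apply: ler_sum => b _.
by rewrite normrM -mulrA ler_wpM2l.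
Qed.

End Grad.

(** * Factorial bounds on iterated partial derivatives *)

Section Words.

(** Index set of the Leibniz rule: each letter differentiates one of two factors. *)
Fixpoint splits (T : Type) (w : seq T) : seq (seq T * seq T) :=
  if w is i :: w' then
    [seq (i :: p.1, p.2) | p <- splits w'] ++ [seq (p.1, i :: p.2) | p <- splits w']
  else [:: ([::], [::])].

Lemma splits_size (T : eqType) (w : seq T) p :
  p \in splits w -> (size p.1 + size p.2)%N = size w.
Proof.
elim: w p => [|i w IH] p /=; first by rewrite inE => /eqP->.
by rewrite mem_cat => /orP[] /mapP[q /IH qw ->] /=; rewrite ?addSn ?addnS qw.
Qed.

Lemma splits_count (T : eqType) (P : pred T) (w : seq T) p :
  p \in splits w -> (count P p.1 + count P p.2)%N = count P w.
Proof.
elim: w p => [|i w IH] p /=; first by rewrite inE => /eqP->.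
by rewrite mem_cat => /orP[] /mapP[q /IH qw ->] /=; rewrite -qw -?addnA// addnCA.
Qed.

(** The Leibniz rule at [0] for the product of [a! / (1 - z)^(a+1)] and [b! / (1 - z)^(b+1)], whose
    derivatives of order [k] there are [(k + a)!] and [(k + b)!]. In the induction the first letter
    raises either [a] or [b]. *)
Lemma splits_fact (T : eqType) (w : seq T) (a b : nat) :
  ((\sum_(p <- splits w) (size p.1 + a)`! * (size p.2 + b)`!) * (a + b).+1`! =
   a`! * b`! * (size w + a + b).+1`!)%N.
Proof.
elim: w a b => [|i w IH] a b; first by rewrite big_seq1 !add0n.
rewrite /= big_cat !big_map /=.
have h1 := IH a.+1 b; have h2 := IH a b.+1.
set S1 := (\sum_(p <- _) _)%N in h1; set S2 := (\sum_(p <- _) _)%N in h2.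
rewrite (_ : (\sum_(j <- splits w) _)%N = S1); last first.
  by apply: eq_bigr => p _; rewrite addnS addSn.
rewrite (_ : (\sum_(j <- splits w) _)%N = S2); last first.
  by apply: eq_bigr => p _; rewrite addnS addSn.
apply/eqP; rewrite -(@eqn_pmul2l (a + b).+2)//; apply/eqP.
move: h1 h2; rewrite !(addnS, addSn) (factS (a + b).+1) (factS a) (factS b).
move: (a`!) (b`!) ((a + b).+1`!) ((size w + a + b).+2`!) => A B C D h1 h2.
rewrite mulnDl mulnDr ![((a + b).+2 * (_ * _))%N]mulnCA h1 h2.
by rewrite !mulSn; nia.
Qed.

End Words.

Section AN.
Variable R : realType.

Definition Dw m (w : seq 'I_m) (f : 'rV[R]_m -> R) : 'rV[R]_m -> R :=
  foldr (fun i g => pd i g) f w.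

(** One [K] serves as inverse radius, prefactor and growth rate. The notion is then monotone in [K],
    so finitely many germs share a constant. *)
Definition ANK m (K : R) (f : 'rV[R]_m -> R) (x0 : 'rV[R]_m) : Prop :=
  forall x, `|x - x0| * K < 1 -> forall w : seq 'I_m,
    grad (Dw w f) x (fun i => Dw (i :: w) f x) /\
    `|Dw w f x| <= K ^+ (size w).+1 * (size w)`!%:R.

(* Real-analyticity expressed by factorial bounds on the iterated partial
   derivatives; equivalent to [analytic_at], but visibly stable under
   differentiation and change of base point. *)
Definition AN m (f : 'rV[R]_m -> R) (x0 : 'rV[R]_m) : Prop :=
  exists2 K : R, 0 < K & ANK K f x0.

Lemma ANK_le m (K K' : R) (f : 'rV[R]_m -> R) x0 : 0 < K -> K <= K' ->
  ANK K f x0 -> ANK K' f x0.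
Proof.
move=> K0 KK' fK x xK w; have [|g b] := fK x _ w.
  by apply: le_lt_trans xK; rewrite ler_wpM2l.
split=> //; apply: (le_trans b); rewrite ler_wpM2r//.
by rewrite lerXn2r// nnegrE ?ltW// (lt_le_trans K0).
Qed.

Lemma AN_common m (I : finType) (f : I -> 'rV[R]_m -> R) x0 :
  (forall j, AN (f j) x0) -> exists2 K : R, 1 < K & forall j, ANK K (f j) x0.
Proof.
move=> fA; have /choice[K fK] : forall j, exists K : R, 0 < K /\ ANK K (f j) x0.
  by move=> j; have [K] := fA j; exists K.
have S0 j : 0 <= K j by have [/ltW] := fK j.
exists (2 + \sum_j K j); first by rewrite ltr_wpDr ?sumr_ge0// ltr1n.
move=> j; have [K0 KA] := fK j; apply: ANK_le KA => //.
have h : 0 <= \sum_(i | i != j) K i by apply: sumr_ge0.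
by rewrite (bigD1 j)//=; lra.
Qed.

(** The usual way to prove [AN]: propose a formula [F w] for every iterated derivative. The gradient
    relation identifies [F w] with [Dw w f] by induction on [w], because [pd] depends only on the
    germ. *)
Lemma AN_family m (f : 'rV[R]_m -> R) x0 (F : seq 'I_m -> 'rV[R]_m -> R) (C A : R) :
  (\forall x \near x0, F [::] x = f x /\ forall w,
     grad (F w) x (fun i => F (i :: w) x) /\
     `|F w x| <= C * A ^+ size w * (size w)`!%:R) ->
  AN f x0 /\ \forall x \near x0, forall w, Dw w f x = F w x.
Proof.
move=> /nearKP[K0 K00 FK].
have DF w : forall x, `|x - x0| * K0 < 1 -> Dw w f x = F w x.
  elim: w => [|i w IH] x xK /=; first by have [->] := FK _ xK.
  apply: (grad_pd (g := fun i => F (i :: w) x)).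
  have [_ /(_ w)[gF _]] := FK _ xK; apply: grad_near gF.
  by apply: nearS (near_nearK K00 xK) => y yK; rewrite IH.
split; last by apply/nearKP; exists K0 => // x xK w; exact: DF.
(* The prefactor [C] is absorbed by the one extra power of [K] in the definition of [ANK]. *)
pose K := K0 + `|C| + `|A| + 1.
have K0' : 0 < K by rewrite /K; have := normr_ge0 C; have := normr_ge0 A; lra.
exists K => // x xK w.
have xK0 : `|x - x0| * K0 < 1.
  apply: le_lt_trans xK; rewrite ler_wpM2l// /K.
  by have := normr_ge0 C; have := normr_ge0 A; lra.
have [_ /(_ w)[gF bF]] := FK _ xK0; split.
  have : grad (Dw w f) x (fun i => F (i :: w) x).
    by apply: grad_near gF; apply: nearS (near_nearK K00 xK0) => y yK; rewrite DF.
  by apply: eq_grad => i; rewrite DF.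
rewrite DF//; apply: (le_trans bF); rewrite ler_wpM2r// exprS.
apply: (le_trans (ler_norm _)); rewrite normrM normrX; apply: ler_pM => //.
- by rewrite /K; have := normr_ge0 A; lra.
- rewrite lerXn2r// ?nnegrE ?(ltW K0')// /K.
  by have := normr_ge0 C; lra.
Qed.

Lemma AN_fam m (f : 'rV[R]_m -> R) x0 (F : seq 'I_m -> 'rV[R]_m -> R) (C A : R) :
  (\forall x \near x0, F [::] x = f x /\ forall w,
     grad (F w) x (fun i => F (i :: w) x) /\
     `|F w x| <= C * A ^+ size w * (size w)`!%:R) -> AN f x0.
Proof. by move=> /AN_family[]. Qed.

Lemma AN_nearD m (f : 'rV[R]_m -> R) x0 : AN f x0 ->
  \forall x \near x0, forall w, grad (Dw w f) x (fun i => Dw (i :: w) f x).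
Proof.
move=> [K K0 fK]; apply: nearS (near_normK x0 K0) => x xK w.
by have [] := fK x xK w.
Qed.

Lemma AN_grad m (f : 'rV[R]_m -> R) x0 : AN f x0 -> grad f x0 (fun i => pd i f x0).
Proof. by move=> /AN_nearD /nbhs_singleton /(_ [::]). Qed.

Lemma ANK_AN m (K : R) (f : 'rV[R]_m -> R) x0 x : 0 < K -> ANK K f x0 ->
  `|x - x0| * K < 1 -> AN f x.
Proof.
move=> K0 fK xK; apply: (@AN_fam m f x (fun w => Dw w f) K K).
apply: nearS (near_nearK K0 xK) => y yK; split=> // w.
by have [] := fK y yK w; rewrite exprS.
Qed.

Lemma AN_near m (f : 'rV[R]_m -> R) x0 : AN f x0 -> \forall x \near x0, AN f x.
Proof.
move=> [K K0 fK]; apply: nearS (near_normK x0 K0) => x xK; exact: ANK_AN fK xK.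
Qed.

Lemma AN_eq m (f f' : 'rV[R]_m -> R) x0 : (\forall x \near x0, f x = f' x) ->
  AN f x0 -> AN f' x0.
Proof.
move=> ff' [K K0 fK].
apply: (@AN_fam m f' x0 (fun w => Dw w f) K K).
apply: nearS (nearI ff' (near_normK x0 K0)) => x [fx xK]; split=> // w.
by have [] := fK x xK w; rewrite exprS.
Qed.

Lemma AN_ext m (f f' : 'rV[R]_m -> R) x0 : f =1 f' -> AN f x0 -> AN f' x0.
Proof. by move=> ff'; apply: AN_eq; apply: nearA. Qed.

Lemma Dw_near m (f f' : 'rV[R]_m -> R) x0 w : AN f x0 ->
  (\forall x \near x0, f x = f' x) -> \forall x \near x0, Dw w f x = Dw w f' x.
Proof.
move=> [K K0 fK] ff'.
have [|_ h] := @AN_family m f' x0 (fun w => Dw w f) K K.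
  apply: nearS (nearI ff' (near_normK x0 K0)) => x [fx xK]; split=> // u.
  by have [] := fK x xK u; rewrite exprS.
by apply: nearS h => x ->.
Qed.

Lemma S_le_exp2 l : (l.+1%:R : R) <= 2 ^+ l.
Proof. by rewrite -natrX ler_nat ltn_expl. Qed.

Lemma AN_pd m (f : 'rV[R]_m -> R) x0 i : AN f x0 -> AN (pd i f) x0.
Proof.
move=> [K K0 fK].
have Dr w : Dw (rcons w i) f = Dw w (pd i f) by rewrite /Dw foldr_rcons.
(* Doubling the growth rate pays for the factor [l + 1] in [(l + 1)!], since [l + 1 <= 2 ^ l]. *)
apply: (@AN_fam m (pd i f) x0 (fun w => Dw (rcons w i) f) (K ^+ 2) (2 * K)).
apply: nearS (near_normK x0 K0) => x xK; split=> // w.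
have [g b] := fK x xK (rcons w i); split=> //; apply: (le_trans b).
rewrite size_rcons factS natrM !exprS expr0 mulr1 exprMn.
have -> : K * (K * K ^+ size w) * ((size w).+1%:R * (size w)`!%:R) =
  (size w).+1%:R * (K * K * K ^+ size w * (size w)`!%:R) by ring.
have -> : K * K * (2 ^+ size w * K ^+ size w) * (size w)`!%:R =
  2 ^+ size w * (K * K * K ^+ size w * (size w)`!%:R) by ring.
by rewrite ler_wpM2r ?S_le_exp2// !mulr_ge0 ?exprn_ge0 ?ltW.
Qed.

Lemma AN_cst m (c : R) (x0 : 'rV[R]_m) : AN (fun=> c) x0.
Proof.
apply: (@AN_fam m (fun=> c) x0 (fun w _ => if w is [::] then c else 0) `|c| 1).
apply: nearA => x; split=> // -[|i w]; split; rewrite ?expr1n ?mulr1.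
- exact: grad_cst.
- by rewrite ?ler_peMr//.
- exact: grad_cst.
- by rewrite normr0 mulr_ge0.
Qed.

Lemma AN_coord m (b : 'I_m) (x0 : 'rV[R]_m) : AN (fun x => x ord0 b) x0.
Proof.
pose F (w : seq 'I_m) (x : 'rV[R]_m) : R := match w with
  | [::] => x ord0 b | [:: i] => (i == b)%:R | _ => 0 end.
apply: (@AN_fam m (fun x => x ord0 b) x0 F (`|x0| + 1) 1).
apply: nearS (near_normK x0 ltr01) => x; rewrite mulr1 => xx; split=> // w.
rewrite expr1n mulr1; split.
  case: w => [|i [|j w]] /=; [exact: grad_coord | exact: grad_cst| exact: grad_cst].
have F1 : `|F w x| <= `|x0| + 1.
  case: w => [|i [|j w]] /=; last by rewrite normr0 addr_ge0.
    apply: (le_trans (coord_le_norm _ _)); rewrite -(subrK x0 x) addrC.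
    by apply: (le_trans (ler_normD _ _)); rewrite lerD2l ltW.
  by case: eqP => _; rewrite ?normr0 ?normr1 ?addr_ge0// lerDr.
by apply: (le_trans F1); rewrite ler_peMr ?addr_ge0// ler1n fact_gt0.
Qed.

Lemma grad_splits m (F G : seq 'I_m -> 'rV[R]_m -> R) x w :
  (forall u, grad (F u) x (fun i => F (i :: u) x)) ->
  (forall u, grad (G u) x (fun i => G (i :: u) x)) ->
  grad (fun y => \sum_(p <- splits w) F p.1 y * G p.2 y) x
       (fun i => \sum_(p <- splits (i :: w)) F p.1 x * G p.2 x).
Proof.
move=> gF gG.
apply: eq_grad (grad_sum (splits w) (fun p => gradM (gF p.1) (gG p.2))) => i.
by rewrite /= big_cat !big_map /= big_split.
Qed.

Lemma AN_mul_Leibniz m (f g : 'rV[R]_m -> R) x0 : AN f x0 -> AN g x0 ->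
  AN (fun x => f x * g x) x0 /\ \forall x \near x0, forall w,
    Dw w (fun x => f x * g x) x = \sum_(p <- splits w) Dw p.1 f x * Dw p.2 g x.
Proof.
move=> fA gA; have [|K K1 fK] := @AN_common m bool (fun b => if b then f else g) x0.
  by case.
have K0 : 0 < K by lra.
apply: (@AN_family m _ x0 _ (K * K) (2 * K)).
apply: nearS (near_normK x0 K0) => x xK.
split=> [|w]; first by rewrite big_seq1.
have fx := fK true x xK; have gx := fK false x xK; split.
  by apply: grad_splits => u; [have [] := fx u | have [] := gx u].
apply: (le_trans (ler_norm_sum _ _ _)).
apply: (@le_trans _ _ (\sum_(p <- splits w)
    (K * K * K ^+ size w) * ((size p.1)`! * (size p.2)`!)%:R)).
  rewrite big_seq [leRHS]big_seq; apply: ler_sum => p /splits_size pw.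
  have [_ b1] := fx p.1; have [_ b2] := gx p.2.
  rewrite normrM; apply: (le_trans (ler_pM _ _ b1 b2)) => //.
  rewrite -pw natrM !exprS exprD le_eqVlt; apply/orP; left; apply/eqP; ring.
rewrite -mulr_sumr -natr_sum.
(* With both offsets [0] the sum of the products of factorials is exactly [(l + 1)!], and
   [l + 1 <= 2 ^ l] again gives the rate [2 * K]. *)
have := splits_fact w 0 0; rewrite !muln1 !mul1n !addn0 => S.
under eq_bigr do rewrite -[size _.1]addn0 -[size _.2]addn0.
rewrite S factS natrM exprMn.
have -> : K * K * (2 ^+ size w * K ^+ size w) * (size w)`!%:R =
  K * K * K ^+ size w * (2 ^+ size w * (size w)`!%:R) by ring.
rewrite ler_wpM2l ?mulr_ge0 ?exprn_ge0 ?(ltW K0)//.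
by rewrite ler_wpM2r// S_le_exp2.
Qed.

Lemma AN_mul m (f g : 'rV[R]_m -> R) x0 : AN f x0 -> AN g x0 ->
  AN (fun x => f x * g x) x0.
Proof. by move=> fA gA; have [] := AN_mul_Leibniz fA gA. Qed.

Lemma AN_add m (f g : 'rV[R]_m -> R) x0 : AN f x0 -> AN g x0 ->
  AN (fun x => f x + g x) x0.
Proof.
move=> fA gA; have [|K K1 fK] := @AN_common m bool (fun b => if b then f else g) x0.
  by case.
have K0 : 0 < K by lra.
apply: (@AN_fam m _ x0 (fun w x => Dw w f x + Dw w g x) (2 * K) K).
apply: nearS (near_normK x0 K0) => x xK; split=> // w.
have [f1 f2] := fK true x xK w; have [g1 g2] := fK false x xK w; split.
  exact: gradD.
apply: (le_trans (ler_normD _ _)); apply: (le_trans (lerD f2 g2)).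
by rewrite exprS le_eqVlt; apply/orP; left; apply/eqP; ring.
Qed.

Lemma AN_opp m (f : 'rV[R]_m -> R) x0 : AN f x0 -> AN (fun x => - f x) x0.
Proof.
by move=> fA; apply: AN_ext (AN_mul (AN_cst (-1) x0) fA) => x; rewrite mulN1r.
Qed.

Lemma AN_sub m (f g : 'rV[R]_m -> R) x0 : AN f x0 -> AN g x0 ->
  AN (fun x => f x - g x) x0.
Proof. by move=> fA gA; apply: AN_add fA (AN_opp gA). Qed.

Lemma AN_sub_Dw m (f g : 'rV[R]_m -> R) x0 : AN f x0 -> AN g x0 ->
  \forall x \near x0, forall w, Dw w (fun x => f x - g x) x = Dw w f x - Dw w g x.
Proof.
move=> fA gA; have [|K K1 fK] := @AN_common m bool (fun b => if b then f else g) x0.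
  by case.
have K0 : 0 < K by lra.
apply: (proj2 (@AN_family m _ x0 (fun w x => Dw w f x - Dw w g x) (2 * K) K _)).
apply: nearS (near_normK x0 K0) => x xK; split=> // w.
have [f1 f2] := fK true x xK w; have [g1 g2] := fK false x xK w; split.
  exact: gradB.
apply: (le_trans (ler_normB _ _)); apply: (le_trans (lerD f2 g2)).
by rewrite exprS le_eqVlt; apply/orP; left; apply/eqP; ring.
Qed.

Lemma AN_sum m (I : Type) (r : seq I) (F : I -> 'rV[R]_m -> R) x0 :
  (forall j, AN (F j) x0) -> AN (fun x => \sum_(j <- r) F j x) x0.
Proof.
move=> FA; elim: r => [|j r IH].
  by apply: AN_ext (AN_cst 0 x0) => x; rewrite big_nil.
by apply: AN_ext (AN_add (FA j) IH) => x; rewrite big_cons.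
Qed.

End AN.

(** * Composition along first-order systems *)

Section Flow.
Variable R : realType.

(** A bound on the central binomial coefficient, used to replace [(2 Q)! / (2 ^ Q Q!)] by [2 ^ Q Q!]
    in the flow estimate. *)
Lemma fact_double_le q : ((q.*2)`! <= 4 ^ q * (q`! * q`!))%N.
Proof.
elim: q => // q IH; rewrite doubleS !factS expnS.
have : (q.*2.+2 * q.*2.+1 <= 4 * (q.+1 * q.+1))%N by rewrite -!muln2; nia.
move: IH; move: (q.*2`!) (q`!) (4 ^ q)%N => a b c.
move=> h1 h2; have := leq_mul h2 h1; rewrite -mulnA => h; apply: (leq_trans h).
by rewrite leq_eqVlt; apply/orP; left; apply/eqP; ring.
Qed.

(* [flowD Phi f w u] is the derivative along the word [u] of [L_w f], where
   [L_i = \sum_b Phi i b \partial_b]. *)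
Fixpoint flowD n M (Phi : 'I_n -> 'I_M -> 'rV[R]_M -> R) (f : 'rV[R]_M -> R)
    (w : seq 'I_n) (u : seq 'I_M) : 'rV[R]_M -> R :=
  if w is i :: w' then fun z => \sum_b \sum_(p <- splits u)
    Dw p.1 (Phi i b) z * flowD Phi f w' (rcons p.2 b) z
  else Dw u f.

(* The exact recursion [B_(Q+1)(l) = \sum_p |p.1|! B_Q(|p.2|+1)] is solved by
   [B_Q(l) = (l+2Q)! / (2^Q Q!)], and [B_Q(0) <= 2^Q Q!]. *)
Lemma flowD_bound n M (Phi : 'I_n -> 'I_M -> 'rV[R]_M -> R) f (K : R) (z : 'rV[R]_M) :
  0 < K ->
  (forall i b p, `|Dw p (Phi i b) z| <= K ^+ (size p).+1 * (size p)`!%:R) ->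
  (forall p, `|Dw p f z| <= K ^+ (size p).+1 * (size p)`!%:R) ->
  forall w u, `|flowD Phi f w u z| * (2 ^ size w * (size w)`!)%:R <=
    K * (M%:R * K ^+ 2) ^+ size w * K ^+ size u * (size u + (size w).*2)`!%:R.
Proof.
move=> K0 hP hf; elim=> [|i w IH] u.
  by rewrite /= !mulr1 addn0; have := hf u; rewrite exprS.
set Q := size w; rewrite /= -/Q; set l := size u.
set E := K * (M%:R * K ^+ 2) ^+ Q * K ^+ l * K ^+ 2.
(* By induction the factor with word [rcons p.2 b] contributes [(size p.2 + 1 + 2 Q)!], hence the
   second offset [2 Q + 1]. *)
have := splits_fact u 0 (Q.*2.+1).
rewrite !add0n !addn0 mul1n -/l; set S := (\sum_(p <- _) _)%N => hS.
have {}hS : (S * (Q.*2.+2) = (l + Q.*2.+1).+1`!)%N.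
  apply/eqP; rewrite -(@eqn_pmul2r (Q.*2.+1)`!) ?fact_gt0//; apply/eqP.
  by rewrite -mulnA -factS hS mulnC.
have step : `|\sum_b \sum_(p <- splits u)
     Dw p.1 (Phi i b) z * flowD Phi f w (rcons p.2 b) z| * (2 ^ Q * Q`!)%:R
   <= M%:R * (E * S%:R).
  have cE (T : R) : M%:R * T = \sum_(b < M) T by rewrite sumr_const card_ord mulr_natl.
  rewrite cE; apply: (le_trans (ler_wpM2r (ler0n _ _) (ler_norm_sum _ _ _))).
  rewrite mulr_suml; apply: ler_sum => b _.
  apply: (le_trans (ler_wpM2r (ler0n _ _) (ler_norm_sum _ _ _))).
  rewrite mulr_suml /S natr_sum mulr_sumr big_seq [leRHS]big_seq.
  apply: ler_sum => p /splits_size pu.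
  rewrite normrM -mulrA.
  apply: (le_trans (ler_pM _ _ (hP i b p.1) (IH (rcons p.2 b)))) => //.
  rewrite size_rcons -/Q natrM addn0 addnS -addSn /E /l -pu.
  rewrite le_eqVlt; apply/orP; left; apply/eqP; rewrite exprD !exprS; ring.
have -> : (2 ^ Q.+1 * Q.+1`!)%:R = (2 ^ Q * Q`!)%:R * (Q.*2.+2)%:R :> R.
  by rewrite -natrM; congr _%:R; rewrite expnS factS -muln2; lia.
rewrite mulrA; apply: (le_trans (ler_wpM2r (ler0n _ _) step)).
have -> : (l + Q.+1.*2)%N = (l + Q.*2.+1).+1 by rewrite doubleS !addnS.
rewrite -hS natrM /E (exprS _ Q).
by rewrite le_eqVlt; apply/orP; left; apply/eqP; ring.
Qed.

(* Composition with the solution of a first-order system: along [v], the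
   derivative [\partial_i] acts on functions of the target as [L_i]. *)
Lemma AN_flow n M (v : 'rV[R]_n -> 'rV[R]_M) (Phi : 'I_n -> 'I_M -> 'rV[R]_M -> R)
    (f : 'rV[R]_M -> R) x0 :
  (\forall x \near x0, forall b, grad (fun y => v y ord0 b) x (fun i => Phi i b (v x))) ->
  (forall i b, AN (Phi i b) (v x0)) -> AN f (v x0) -> AN (fun x => f (v x)) x0.
Proof.
move=> gv PA fA.
have [|K K1 hK] := @AN_common R M (option ('I_n * 'I_M))
   (fun o => if o is Some ib then Phi ib.1 ib.2 else f) (v x0).
  by case=> [[i b]|] /=.
have K0 : 0 < K by lra.
have hP i b := hK (Some (i, b)); have hf := hK None.
have lv : exists2 L : R, 0 < L & \forall y \near x0, `|v y - v x0| <= L * `|y - x0|.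
  by apply: lip_row => b; apply: grad_lip (nbhs_singleton gv b).
have [L L0 vL] := lv.
have gH w u z : `|z - v x0| * K < 1 ->
    grad (flowD Phi f w u) z (fun c => flowD Phi f w (c :: u) z).
  move=> zK; elim: w u => [|i w IH] u; first by have [] := hf z zK u.
  apply: grad_sum => b; apply: (@grad_splits R M (fun p => Dw p (Phi i b))
    (fun p => flowD Phi f w (rcons p b))) => p; last exact: IH.
  by have [] := hP i b z zK p.
(* Only the empty word [u] is needed on the target side; the other words entered to make the
   recursion close. The last factor [2] in the rate comes from [fact_double_le]. *)
apply: (@AN_fam R n _ x0 (fun w x => flowD Phi f w [::] (v x)) K (M%:R * K ^+ 2 * 2)).
have := nearI (nearI gv vL) (near_normK x0 (mulr_gt0 L0 K0)).
apply: nearS => x [[gx xL] xLK]; split=> // w.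
have zK : `|v x - v x0| * K < 1.
  by apply: le_lt_trans xLK; rewrite mulrA [`|x - x0| * L]mulrC ler_wpM2r// ltW.
split.
  apply: eq_grad (grad_comp gx (gH w [::] _ zK)) => i /=.
  by apply: eq_bigr => b _; rewrite big_seq1.
have := @flowD_bound n M Phi f K (v x) K0 _ _ w [::].
move=> /(_ (fun i b p => proj2 (hP i b _ zK p)) (fun p => proj2 (hf _ zK p))).
rewrite expr0 mulr1 add0n; set Q := size w => h.
have Q0 : 0 < (2 ^ Q * Q`!)%:R :> R by rewrite ltr0n muln_gt0 expn_gt0 fact_gt0.
rewrite -(ler_pM2r Q0); apply: (le_trans h).
set A := M%:R * K ^+ 2; have A0 : 0 <= A ^+ Q.
  by rewrite exprn_ge0// mulr_ge0// exprn_ge0// ltW.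
rewrite (exprMn Q A 2) -!mulrA ler_pM2l// ler_wpM2l//.
rewrite -natrX -!natrM ler_nat; apply: (leq_trans (fact_double_le Q)).
rewrite (expnMn 2 2) leq_eqVlt; apply/orP; left; apply/eqP; ring.
Qed.

Lemma AN_affine n M (v : 'rV[R]_n -> 'rV[R]_M) (dv : 'I_n -> 'I_M -> R)
    (f : 'rV[R]_M -> R) x0 :
  (forall x b, grad (fun y => v y ord0 b) x (dv^~ b)) -> AN f (v x0) ->
  AN (fun x => f (v x)) x0.
Proof.
move=> gv fA; apply: (@AN_flow _ _ v (fun i b _ => dv i b)) => //.
- by apply: nearA => x b; exact: gv.
- by move=> i b; exact: AN_cst.
Qed.

Lemma grad_lsubmx n M (z : 'rV[R]_(n + M)) j :
  grad (fun y : 'rV[R]_(n + M) => lsubmx y ord0 j) z (fun i => (i == lshift M j)%:R).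
Proof. by apply: grad_near (grad_coord _ z); apply: nearA => y; rewrite mxE. Qed.

Lemma grad_rsubmx n M (z : 'rV[R]_(n + M)) j :
  grad (fun y : 'rV[R]_(n + M) => rsubmx y ord0 j) z (fun i => (i == rshift n j)%:R).
Proof. by apply: grad_near (grad_coord _ z); apply: nearA => y; rewrite mxE. Qed.

Lemma AN_lsubmx n M (f : 'rV[R]_n -> R) (z : 'rV[R]_(n + M)) :
  AN f (lsubmx z) -> AN (fun y => f (lsubmx y)) z.
Proof. by apply: AN_affine => x b; exact: grad_lsubmx. Qed.

Lemma AN_rsubmx n M (f : 'rV[R]_M -> R) (z : 'rV[R]_(n + M)) :
  AN f (rsubmx z) -> AN (fun y => f (rsubmx y)) z.
Proof. by apply: AN_affine => x b; exact: grad_rsubmx. Qed.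

(** The graph [x |-> (x, v x)] solves a first-order system even though [v] alone need not: the
    derivatives of [v] are functions of [x], which is now part of the unknown. *)
Lemma AN_comp n M (v : 'rV[R]_n -> 'rV[R]_M) (f : 'rV[R]_M -> R) x0 :
  (forall b, AN (fun x => v x ord0 b) x0) -> AN f (v x0) -> AN (fun x => f (v x)) x0.
Proof.
move=> vA fA; pose V x := row_mx x (v x).
pose Phi (i : 'I_n) (b : 'I_(n + M)) : 'rV[R]_(n + M) -> R :=
  match fintype.split b with
  | inl j => fun=> (i == j)%:R
  | inr b => fun z => pd i (fun x => v x ord0 b) (lsubmx z) end.
apply: (@AN_ext _ _ (fun x => (f \o rsubmx) (V x))); first by move=> x /=; rewrite row_mxKr.
apply: (@AN_flow _ _ V Phi).
- have : \forall x \near x0, forall b w, grad (Dw w (fun x => v x ord0 b)) x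
      (fun i => Dw (i :: w) (fun x => v x ord0 b) x).
    by apply: near_forall => b; exact: AN_nearD.
  apply: nearS => x h b; rewrite /Phi; case: (split_ordP b) => j ->.
    by apply: grad_near (grad_coord j x); apply: nearA => y; rewrite row_mxEl.
  rewrite row_mxKl; apply: grad_near (h j [::]).
  by apply: nearA => y; rewrite row_mxEr.
- move=> i b; rewrite /Phi; case: (split_ordP b) => j _; first exact: AN_cst.
  apply: (@AN_lsubmx _ _ (pd i (fun x => v x ord0 j))); rewrite row_mxKl.
  by apply: AN_pd; exact: vA.
- by apply: AN_rsubmx; rewrite row_mxKr.
Qed.

(** The inverse solves the Riccati equation [v' = - v^2], whose right-hand side is polynomial, so
    [AN_flow] applies. *)
Lemma AN_inv1 (t : R) : t != 0 -> AN (fun y : 'rV[R]_1 => (y ord0 ord0)^-1) (const_mx t).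
Proof.
move=> t0.
pose v (y : 'rV[R]_1) : 'rV[R]_1 := const_mx (y ord0 ord0)^-1.
apply: (@AN_ext _ _ (fun y => (fun z : 'rV[R]_1 => z ord0 ord0) (v y))).
  by move=> y; rewrite mxE.
apply: (@AN_flow _ _ v (fun _ _ z => - (z ord0 ord0 * z ord0 ord0))
  (fun z => z ord0 ord0)).
- have near2 (s : R) (x : 'rV[R]_1) : 0 < s -> s = `|x ord0 ord0| ->
      \forall y \near x, s / 2 < `|(y : 'rV[R]_1) ord0 ord0|.
    move=> s0 sx; have s2 : 0 < 2 / s by rewrite divr_gt0.
    apply: nearS (near_normK x s2) => y; rewrite mulrA ltr_pdivrMr// mul1r => h.
    have := coord_le_norm (y - x) ord0; rewrite !mxE => h1.
    have := lerB_dist (x ord0 ord0) (y ord0 ord0); rewrite distrC -sx; lra.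
  have := near2 `|t| (const_mx t) ; rewrite normr_gt0 mxE => /(_ t0 erefl).
  apply: nearS => x xt b.
  have x0 : 0 < `|x ord0 ord0| by apply: le_lt_trans xt; rewrite divr_ge0.
  have x0' : x ord0 ord0 != 0 by rewrite -normr_gt0.
  exists (2 / (`|x ord0 ord0| ^+ 3)).
  apply: nearS (near2 _ _ x0 erefl) => y yx.
  have y0 : 0 < `|y ord0 ord0| by apply: le_lt_trans yx; rewrite divr_ge0 ?ltW.
  have y0' : y ord0 ord0 != 0 by rewrite -normr_gt0.
  rewrite big_ord1 !mxE.
  have -> : (y ord0 ord0)^-1 - (x ord0 ord0)^-1 -
      - ((x ord0 ord0)^-1 * (x ord0 ord0)^-1) * (y ord0 ord0 - x ord0 ord0) =
    (y ord0 ord0 - x ord0 ord0) ^+ 2 / (y ord0 ord0 * x ord0 ord0 ^+ 2).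
    by field; rewrite x0' y0'.
  rewrite normrM normfV [`|y ord0 ord0 * _|]normrM !normrX mulrC.
  have h1 : (`|y ord0 ord0| * `|x ord0 ord0| ^+ 2)^-1 <= 2 / `|x ord0 ord0| ^+ 3.
    rewrite -[leRHS]invrK lef_pV2 ?posrE ?invr_gt0 ?divr_gt0 ?mulr_gt0 ?exprn_gt0//.
    rewrite invf_div exprS mulrAC; apply: ler_wpM2r; last exact: ltW.
    by rewrite exprn_ge0.
  have h2 : `|y ord0 ord0 - x ord0 ord0| ^+ 2 <= `|y - x| ^+ 2.
    rewrite lerXn2r ?nnegrE//; have := coord_le_norm (y - x) ord0.
    by rewrite !mxE.
  by apply: ler_pM => //; rewrite ?invr_ge0 ?mulr_ge0 ?exprn_ge0.
- by move=> i b; apply: AN_opp; apply: AN_mul; exact: AN_coord.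
- exact: AN_coord.
Qed.

Lemma AN_comp1 n (h : R -> R) (f : 'rV[R]_n -> R) x0 : AN f x0 ->
  AN (fun y : 'rV[R]_1 => h (y ord0 ord0)) (const_mx (f x0)) ->
  AN (fun x => h (f x)) x0.
Proof.
move=> fA hA.
apply: (@AN_ext _ _ (fun x => (fun y : 'rV[R]_1 => h (y ord0 ord0)) (const_mx (f x)))).
  by move=> x; rewrite mxE.
apply: (@AN_comp n 1 (fun x => const_mx (f x)) (fun y => h (y ord0 ord0))) => // b.
by apply: AN_ext fA => x; rewrite mxE.
Qed.

Lemma AN_inv n (f : 'rV[R]_n -> R) x0 : AN f x0 -> f x0 != 0 ->
  AN (fun x => (f x)^-1) x0.
Proof. by move=> fA f0; apply: (AN_comp1 (h := GRing.inv)) fA (AN_inv1 f0). Qed.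

End Flow.

(** * Taylor expansion *)

Section Taylor.
Variable R : realType.

Fixpoint words m (l : nat) : seq (seq 'I_m) :=
  if l is l'.+1 then [seq i :: w | i <- enum 'I_m, w <- words m l'] else [:: [::]].

Lemma size_in_words m l (w : seq 'I_m) : w \in words m l -> size w = l.
Proof.
elim: l w => [|l IH] w /=; first by rewrite inE => /eqP->.
by move=> /allpairsP[[i u] /= [_ /IH <- ->]].
Qed.

Lemma big_wordsS m l (T : seq 'I_m -> R) :
  \sum_(w <- words m l.+1) T w = \sum_i \sum_(w <- words m l) T (i :: w).
Proof. by rewrite /= big_allpairs_dep big_enum. Qed.

Lemma big_words0 m (T : seq 'I_m -> R) : \sum_(w <- words m 0) T w = T [::].
Proof. by rewrite big_seq1. Qed.

Lemma size_words m l : size (words m l) = (m ^ l)%N.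
Proof. by elim: l => //= l IH; rewrite size_allpairs IH size_enum_ord expnS. Qed.

Definition wmon m (h : 'rV[R]_m) (w : seq 'I_m) : R := \prod_(i <- w) h ord0 i.

Lemma wmon_le m (h : 'rV[R]_m) w : `|wmon h w| <= `|h| ^+ size w.
Proof.
rewrite /wmon; elim: w => [|i w IH]; first by rewrite big_nil normr1 expr0.
by rewrite big_cons normrM exprS ler_pM// coord_le_norm.
Qed.

(** The [l]-th differential in direction [h]. Summing over ordered words builds in the multinomial
    coefficients, so that [jet / l!] is the Taylor term. *)
Definition jet m (F : seq 'I_m -> 'rV[R]_m -> R) (h : 'rV[R]_m) l (y : 'rV[R]_m) : R :=
  \sum_(w <- words m l) wmon h w * F w y.

Lemma jet0 m (F : seq 'I_m -> 'rV[R]_m -> R) h y : jet F h 0 y = F [::] y.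
Proof. by rewrite /jet big_words0 /wmon big_nil mul1r. Qed.

Lemma jet1 m (F : seq 'I_m -> 'rV[R]_m -> R) h y :
  jet F h 1 y = \sum_i h ord0 i * F [:: i] y.
Proof.
by rewrite /jet big_wordsS; apply: eq_bigr => i _; rewrite big_words0 /wmon big_seq1.
Qed.

Lemma jet_abs_le m (F : seq 'I_m -> 'rV[R]_m -> R) h l y (C : R) :
  (forall w, size w = l -> `|F w y| <= C) ->
  \sum_(w <- words m l) `|wmon h w * F w y| <= (m%:R * `|h|) ^+ l * C.
Proof.
move=> FC; apply: (@le_trans _ _ (\sum_(w <- words m l) `|h| ^+ l * C)).
  rewrite big_seq [leRHS]big_seq; apply: ler_sum => w /size_in_words wl.
  by rewrite normrM ler_pM// ?FC// -wl wmon_le.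
by rewrite big_const_seq count_predT size_words iter_addr_0 exprMn -natrX -mulrA mulr_natl.
Qed.

Lemma jet_le m (F : seq 'I_m -> 'rV[R]_m -> R) h l y (C : R) :
  (forall w, size w = l -> `|F w y| <= C) -> `|jet F h l y| <= (m%:R * `|h|) ^+ l * C.
Proof. by move=> FC; apply: le_trans (jet_abs_le h FC); exact: ler_norm_sum. Qed.

Lemma is_derive_mul (f g : R -> R) (x df dg : R) :
  is_derive x 1 f df -> is_derive x 1 g dg ->
  is_derive x 1 (fun t => f t * g t) (df * g x + f x * dg).
Proof.
move=> hf hg; apply: is_derive_eq (is_deriveM hf hg) _.
by rewrite /GRing.scale /=; ring.
Qed.

Lemma is_derive_add (f g : R -> R) (x df dg : R) :
  is_derive x 1 f df -> is_derive x 1 g dg ->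
  is_derive x 1 (fun t => f t + g t) (df + dg).
Proof. by move=> hf hg; exact: is_deriveD. Qed.

Lemma is_derive_onem_exp (x : R) N :
  is_derive x 1 (fun t : R => (1 - t) ^+ N.+1) (- (N.+1%:R * (1 - x) ^+ N)).
Proof.
have h1 : is_derive x 1 (fun t : R => 1 - t) (-1).
  apply: quad_is_derive; exists 0; apply/nearKP; exists 1 => // h _.
  by rewrite [h *: 1]mulr1 (_ : _ - _ = 0) ?normr0 ?mul0r//; ring.
elim: N => [|N IH].
  have -> : (fun t : R => (1 - t) ^+ 1) = (fun t => 1 - t) by apply/funext => t.
  by apply: is_derive_eq h1 _; rewrite expr0 mulr1.
have -> : (fun t : R => (1 - t) ^+ N.+2) = (fun t => (1 - t) * (1 - t) ^+ N.+1).
  by apply/funext => t; rewrite exprS.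
apply: is_derive_eq (is_derive_mul h1 IH) _.
by rewrite -(natr1 N.+1) exprS; ring.
Qed.

Lemma is_derive_seg m (F : seq 'I_m -> 'rV[R]_m -> R) (x0 h : 'rV[R]_m) l (t : R) :
  (forall w, grad (F w) (t *: h + x0) (fun i => F (i :: w) (t *: h + x0))) ->
  is_derive t 1 (fun t => jet F h l (t *: h + x0)) (jet F h l.+1 (t *: h + x0)).
Proof.
move=> gF.
have gJ : grad (jet F h l) (t *: h + x0)
    (fun i => \sum_(w <- words m l) wmon h w * F (i :: w) (t *: h + x0)).
  by apply: grad_sum => w; apply: gradZ; exact: gF.
have [K hK] := gJ; apply: quad_is_derive; exists (K * `|h| ^+ 2).
have : \forall e \near (0 : R), `|jet F h l (e *: h + (t *: h + x0)) -
   jet F h l (t *: h + x0) - \sum_i (\sum_(w <- words m l) wmon h w * F (i :: w) (t *: h + x0))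
    * ((e *: h + (t *: h + x0)) ord0 i - (t *: h + x0) ord0 i)|
   <= K * `|e *: h + (t *: h + x0) - (t *: h + x0)| ^+ 2.
  exact: (near_line h hK).
apply: filterS => e; rewrite addrK normrZ exprMn => he.
have -> : (e *: 1 + t) *: h + x0 = e *: h + (t *: h + x0).
  by rewrite [e *: 1]mulr1 scalerDl addrA.
rewrite -mulrA [`|h| ^+ 2 * _]mulrC; move: he; congr (is_true (`|_ - _| <= _)).
rewrite /jet big_wordsS mulr_suml; apply: eq_bigr => i _.
by rewrite !mulr_suml; apply: eq_bigr => w _; rewrite !mxE addrK /wmon big_cons; ring.
Qed.

Lemma taylor_seg m (F : seq 'I_m -> 'rV[R]_m -> R) (x0 h : 'rV[R]_m) N (B : R) :
  (forall t : R, 0 <= t <= 1 -> forall w,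
     grad (F w) (t *: h + x0) (fun i => F (i :: w) (t *: h + x0))) ->
  (forall t : R, 0 <= t <= 1 -> `|jet F h N.+1 (t *: h + x0)| <= B) ->
  `|F [::] (h + x0) - \sum_(l < N.+1) jet F h l x0 / l`!%:R| <= B / N`!%:R.
Proof.
move=> gF bF.
(* The Taylor polynomial centred at the moving point [t *: h + x0] and evaluated at [h + x0]. Its
   derivative in [t] telescopes to the single term [dPsi], and the mean value theorem gives Cauchy's
   form of the remainder. *)
pose Psi N (t : R) := \sum_(l < N.+1) jet F h l (t *: h + x0) * ((1 - t) ^+ l / l`!%:R).
pose dPsi N (t : R) := jet F h N.+1 (t *: h + x0) * ((1 - t) ^+ N / N`!%:R).
have dP k (t : R) : 0 <= t <= 1 -> is_derive t 1 (Psi k) (dPsi k t).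
  move=> t01; elim: k => [|k IH].
    have -> : Psi 0 = fun t => jet F h 0 (t *: h + x0).
      by apply/funext => s; rewrite /Psi big_ord1 expr0 fact0 divr1 mulr1.
    rewrite /dPsi expr0 fact0 divr1 mulr1; apply: is_derive_seg; exact: gF.
  have -> : Psi k.+1 = fun t => Psi k t +
      jet F h k.+1 (t *: h + x0) * ((k.+1`!%:R)^-1 * (1 - t) ^+ k.+1).
    by apply/funext => s; rewrite /Psi big_ord_recr/= [_ / (k.+1)`!%:R]mulrC.
  have d1 := is_derive_seg k.+1 (gF _ t01).
  have dc : is_derive t 1 (fun=> (k.+1`!%:R)^-1 : R) 0 by exact: is_derive_cst.
  have d2 := is_derive_mul dc (is_derive_onem_exp t k).
  apply: is_derive_eq (is_derive_add IH (is_derive_mul d1 d2)) _.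
  rewrite /dPsi factS natrM.
  have f0 : (k`!%:R : R) != 0 by rewrite pnatr_eq0 -lt0n fact_gt0.
  have k0 : (k.+1%:R : R) != 0 by rewrite pnatr_eq0.
  by move: (k.+1%:R) (k`!%:R) k0 f0 => a b a0 b0; field; rewrite a0 b0.
have [c c01 hc] : exists2 c : R, c \in `[0, 1]%R & Psi N 1 - Psi N 0 = dPsi N c * (1 - 0).
  apply: MVT_segment => // [t|]; first by rewrite in_itv/= => /andP[/ltW a /ltW b]; exact/dP/andP.
  apply: derivable_within_continuous => t; rewrite in_itv/= => t01.
  by have [] := dP N t t01.
have P1 : Psi N 1 = F [::] (h + x0).
  rewrite /Psi big_ord_recl big1 => [|i _]; last by rewrite subrr expr0n mul0r mulr0.
  by rewrite expr0 fact0 divr1 mulr1 addr0 /jet big_seq1 /wmon big_nil mul1r scale1r.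
have P0 : Psi N 0 = \sum_(l < N.+1) jet F h l x0 / l`!%:R.
  by apply: eq_bigr => l _; rewrite scale0r add0r subr0 expr1n mul1r.
rewrite -P1 -P0 hc subr0 mulr1 /dPsi normrM; move: c01; rewrite in_itv /= => c01.
have f0 : 0 < (N`!%:R : R) by rewrite ltr0n fact_gt0.
apply: ler_pM => //; first exact: bF.
rewrite normrM normfV (ger0_norm (ltW f0)) -[leRHS]mul1r ler_wpM2r ?invr_ge0 ?(ltW f0)//.
by rewrite normrX exprn_ile1// ler_norml; move/andP: c01 => [? ?]; apply/andP; split; lra.
Qed.

(** Chosen so that [m * |h| * K <= 1/4]: Taylor terms decay like [4^-l], and the factor [N + 1] lost
    in Cauchy's remainder still leaves [2^-N]. Using [m + 1] also ensures [|h| * K < 1] and keeps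
    the radius meaningful for [m = 0]. *)
Definition tay_rad m (K : R) : R := (4 * m.+1%:R * K)^-1.

Lemma tay_rad_gt0 m (K : R) : 0 < K -> 0 < tay_rad m K.
Proof. by move=> K0; rewrite invr_gt0 !mulr_gt0. Qed.

Lemma tay_radK m (K t : R) : 0 < K -> 0 <= t < tay_rad m K ->
  t * K < 1 /\ m%:R * t * K <= 4^-1.
Proof.
move=> K0 /andP[t0]; rewrite /tay_rad => h.
have P0 : 0 < 4 * m.+1%:R * K by rewrite !mulr_gt0.
have {}h : t * (4 * m.+1%:R * K) < 1 by rewrite -ltr_pdivlMr// div1r.
have tK : 0 <= t * K by rewrite mulr_ge0// ltW.
have mtK : 0 <= m%:R * (t * K) by rewrite mulr_ge0.
have e : t * (4 * m.+1%:R * K) = 4 * (m%:R * (t * K)) + 4 * (t * K).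
  by rewrite -natr1; ring.
rewrite e in h; split; first by lra.
by rewrite -mulrA; lra.
Qed.

Lemma jet_terms_le m (f : 'rV[R]_m -> R) x0 (K : R) (h : 'rV[R]_m) : 0 < K ->
  ANK K f x0 -> `|h| < tay_rad m K -> forall l,
  \sum_(w <- words m l) `|wmon h w * Dw w f x0 / (size w)`!%:R| <= K * 4^-1 ^+ l.
Proof.
move=> K0 fK hr l.
have [hK mK] := tay_radK K0 (introT andP (conj (normr_ge0 h) hr)).
have f0 : 0 < (l`!%:R : R) by rewrite ltr0n fact_gt0.
have -> : \sum_(w <- words m l) `|wmon h w * Dw w f x0 / (size w)`!%:R| =
   (\sum_(w <- words m l) `|wmon h w * Dw w f x0|) / l`!%:R.
  rewrite mulr_suml big_seq [RHS]big_seq; apply: eq_bigr => w /size_in_words->.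
  by rewrite normrM normfV (ger0_norm (ltW f0)).
rewrite ler_pdivrMr//.
apply: (le_trans (jet_abs_le h (C := K ^+ l.+1 * l`!%:R) _)).
  move=> w <-; have [|_ b] := fK x0 _ w; last exact: b.
  by rewrite subrr normr0 mul0r.
rewrite mulrA ler_wpM2r// exprS.
have -> : (m%:R * `|h|) ^+ l * (K * K ^+ l) = K * (m%:R * `|h| * K) ^+ l.
  by rewrite [in RHS]exprMn; ring.
rewrite ler_pM2l// lerXn2r// nnegrE ?invr_ge0//.
by rewrite !mulr_ge0// ltW.
Qed.

Lemma AN_taylor m (f : 'rV[R]_m -> R) x0 (K : R) (h : 'rV[R]_m) : 0 < K ->
  ANK K f x0 -> `|h| < tay_rad m K -> forall N,
  `|f (h + x0) - \sum_(l < N.+1) \sum_(w <- words m l)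
      wmon h w * Dw w f x0 / (size w)`!%:R| <= K * 2^-1 ^+ N.+1.
Proof.
move=> K0 fK hr N.
have [hK mK] := tay_radK K0 (introT andP (conj (normr_ge0 h) hr)).
have tK (t : R) : 0 <= t <= 1 -> `|t *: h + x0 - x0| * K < 1.
  move=> /andP[t0 t1]; rewrite addrK normrZ ger0_norm//; apply: le_lt_trans hK.
  by rewrite ler_wpM2r ?(ltW K0)// ler_piMl.
have g1 (t : R) : 0 <= t <= 1 -> forall w, grad (Dw w f) (t *: h + x0)
    (fun i => Dw (i :: w) f (t *: h + x0)).
  by move=> t01 w; have [] := fK _ (tK t t01) w.
have b1 (t : R) : 0 <= t <= 1 -> `|jet (fun w => Dw w f) h N.+1 (t *: h + x0)| <=
    (m%:R * `|h|) ^+ N.+1 * (K ^+ N.+2 * N.+1`!%:R).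
  by move=> t01; apply: jet_le => w wN; have [_] := fK _ (tK t t01) w; rewrite wN.
have := taylor_seg g1 b1.
have -> : \sum_(l < N.+1) jet (fun w => Dw w f) h l x0 / l`!%:R =
  \sum_(l < N.+1) \sum_(w <- words m l) wmon h w * Dw w f x0 / (size w)`!%:R.
  apply: eq_bigr => l _; rewrite /jet mulr_suml big_seq [RHS]big_seq.
  by apply: eq_bigr => w /size_in_words->.
move=> b; apply: (le_trans b).
have f0 : 0 < (N`!%:R : R) by rewrite ltr0n fact_gt0.
rewrite ler_pdivrMr// factS natrM [K ^+ N.+2]exprS.
have -> : (m%:R * `|h|) ^+ N.+1 * (K * K ^+ N.+1 * (N.+1%:R * N`!%:R)) =
   K * ((m%:R * `|h| * K) ^+ N.+1 * N.+1%:R) * N`!%:R.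
  by rewrite [in RHS]exprMn; ring.
rewrite ler_pM2r// ler_pM2l//.
have th0 : 0 <= m%:R * `|h| * K by rewrite !mulr_ge0// ltW.
apply: (@le_trans _ _ (4^-1 ^+ N.+1 * 2 ^+ N.+1)).
  apply: ler_pM => //; first by rewrite exprn_ge0.
    by rewrite lerXn2r// nnegrE ?invr_ge0.
  apply: (le_trans (S_le_exp2 R N)); rewrite ler_eXn2l// ?ltr1n//.
by rewrite -exprMn lerXn2r// ?nnegrE; lra.
Qed.

Lemma half_exp_small (e : R) : 0 < e -> exists N, (2^-1 : R) ^+ N < e.
Proof.
move=> e0; have h2 : `|2^-1 : R| < 1 by rewrite ger0_norm ?invr_ge0// invf_lt1// ltr1n.
have := cvg_expr h2 => /cvgrPdist_lt/(_ _ e0)[N _ /(_ N (leqnn N))].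
by rewrite sub0r normrN ger0_norm ?exprn_ge0 ?invr_ge0//; exists N.
Qed.

Lemma AN_zero m (f : 'rV[R]_m -> R) x0 : AN f x0 ->
  (forall w, Dw w f x0 = 0) -> \forall x \near x0, f x = 0.
Proof.
move=> [K K0 fK] f0; have r0 := tay_rad_gt0 m K0.
have r0' : 0 < (tay_rad m K)^-1 by rewrite invr_gt0.
apply: nearS (near_normK x0 r0') => x; rewrite ltr_pdivrMr// mul1r => xr.
apply/eqP; rewrite -normr_le0 leNgt; apply/negP => fx.
have [N hN] := half_exp_small (divr_gt0 fx K0).
have := AN_taylor K0 fK xr N; rewrite subrK big1 => [|l _]; last first.
  by apply: big1 => w _; rewrite f0 mulr0 mul0r.
rewrite subr0 leNgt => /negP; apply; rewrite mulrC -ltr_pdivlMr//; apply: le_lt_trans hN.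
rewrite exprS ler_piMl// ?exprn_ge0 ?invr_ge0//.
by rewrite invf_le1// ler1n.
Qed.

Definition cnt m (w : seq 'I_m) : {ffun 'I_m -> nat} := [ffun i => count_mem i w].

Lemma wmon_cnt m (x x0 : 'rV[R]_m) (w : seq 'I_m) :
  wmon (x - x0) w = monom (cnt w) x0 x.
Proof.
rewrite /monom /wmon; elim: w => [|i w IH].
  by rewrite big_nil big1// => i _; rewrite ffunE.
rewrite big_cons IH (bigD1 i)//= [in RHS](bigD1 i)//= !ffunE /= eqxx add1n exprS !mxE.
rewrite -mulrA; congr (_ * (_ * _)); apply: eq_bigr => j ji.
by rewrite !ffunE /= eq_sym (negPf ji).
Qed.

Lemma sum_cnt m (w : seq 'I_m) : (\sum_i cnt w i = size w)%N.
Proof.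
elim: w => [|i w IH]; first by rewrite big1// => i _; rewrite ffunE.
rewrite /= -IH (bigD1 i)//= [in RHS](bigD1 i)//= !ffunE /= eqxx -addSn add1n.
by congr (_ + _)%N; apply: eq_bigr => j ji; rewrite !ffunE /= eq_sym (negPf ji).
Qed.

(** Grouping all words with letter counts [k] yields the coefficient of the monomial [k] before
    mixed derivatives are known to commute; their symmetry is deduced afterwards from the series. *)
Definition wcoef m (f : 'rV[R]_m -> R) (x0 : 'rV[R]_m) (k : {ffun 'I_m -> nat}) : R :=
  \sum_(w <- words m (\sum_i k i) | cnt w == k) Dw w f x0 / (size w)`!%:R.

(** Bridges the two ways of summing: a square of exponents of side [N] holds precisely the words in
    which each letter occurs fewer than [N] times, and these have length at most [m * N]. *)
Lemma square_words m N (T : seq 'I_m -> R) :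
  \sum_(k : {ffun 'I_m -> 'I_N}) \sum_(w <- words m (\sum_i mi k i) | cnt w == mi k) T w =
  \sum_(l < (m * N).+1) \sum_(w <- words m l | [forall i, count_mem i w < N]%N) T w.
Proof.
have kL (k : {ffun 'I_m -> 'I_N}) : (\sum_i mi k i < (m * N).+1)%N.
  have : (\sum_i mi k i <= \sum_(i < m) N)%N.
    by apply: leq_sum => i _; rewrite ffunE ltnW.
  by rewrite sum_nat_const card_ord ltnS.
have -> : \sum_(k : {ffun 'I_m -> 'I_N})
    \sum_(w <- words m (\sum_i mi k i) | cnt w == mi k) T w =
  \sum_(k : {ffun 'I_m -> 'I_N}) \sum_(l < (m * N).+1)
    \sum_(w <- words m l | cnt w == mi k) T w.
  apply: eq_bigr => k _; rewrite (bigD1 (Ordinal (kL k)))//= [X in _ + X]big1 ?addr0// => l lk.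
  rewrite big_seq_cond big1// => w /andP[/size_in_words wl /eqP wk].
  by case/eqP: lk; apply/val_inj; rewrite /= -wk sum_cnt.
rewrite exchange_big; apply: eq_bigr => l _.
under eq_bigr => k _ do rewrite big_mkcond.
rewrite exchange_big [RHS]big_mkcond; apply: eq_bigr => w _.
case: ifPn => [/forallP wN|/forallPn[i wi]].
  pose k0 : {ffun 'I_m -> 'I_N} := [ffun i => Ordinal (wN i)].
  have k0w : cnt w == mi k0 by apply/eqP/ffunP => i; rewrite !ffunE.
  rewrite (bigD1 k0)//= k0w big1 ?addr0// => k kk0; case: eqP => // wk.
  case/eqP: kk0; apply/ffunP => i; apply/val_inj; move/ffunP/(_ i): wk.
  by rewrite !ffunE => /= ->.
apply: big1 => k _; case: eqP => // /ffunP/(_ i); rewrite !ffunE => ki.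
by move: wi; rewrite ki ltn_ord.
Qed.

Lemma geo4_le N M : \sum_(N <= l < M) (4^-1 : R) ^+ l <= 2 * 2^-1 ^+ N.
Proof.
apply: (@le_trans _ _ (\sum_(N <= l < M) (2^-1 : R) ^+ l)).
  by apply: ler_sum => l _; rewrite lerXn2r ?nnegrE ?invr_ge0// lef_pV2 ?posrE// ler_nat.
have [MN|NM] := leqP M N.
  by rewrite big_geq// mulr_ge0// exprn_ge0// invr_ge0.
have -> : \sum_(N <= l < M) (2^-1 : R) ^+ l = 2 * 2^-1 ^+ N - 2 * 2^-1 ^+ M.
  rewrite (eq_bigr (fun l => (- (2 * 2^-1 ^+ l.+1)) - (- (2 * 2^-1 ^+ l)))).
    by rewrite telescope_sumr ?(ltnW NM)//; ring.
  by move=> l _; rewrite exprS; field.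
by rewrite gerBl mulr_ge0// exprn_ge0// invr_ge0.
Qed.

Lemma AN_analytic m (f : 'rV[R]_m -> R) x0 : AN f x0 -> analytic_at f x0.
Proof.
move=> [K K0 fK]; exists (wcoef f x0), (tay_rad m K).
split=> [|x xr]; first exact: tay_rad_gt0.
pose t w : R := wmon (x - x0) w * Dw w f x0 / (size w)`!%:R.
have ct (k : {ffun 'I_m -> nat}) : wcoef f x0 k * monom k x0 x =
    \sum_(w <- words m (\sum_i k i) | cnt w == k) t w.
  rewrite /wcoef mulr_suml; apply: eq_bigr => w /eqP <-.
  by rewrite -wmon_cnt /t; ring.
have tl := jet_terms_le K0 fK xr.
have tl' l (P : pred (seq 'I_m)) : \sum_(w <- words m l | P w) `|t w| <= K * 4^-1 ^+ l.
  apply: le_trans (tl l); rewrite big_mkcond; apply: ler_sum => w _.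
  by case: ifP.
split.
  exists (K * 2) => N; apply: (@le_trans _ _ (\sum_(k : {ffun 'I_m -> 'I_N})
      \sum_(w <- words m (\sum_i mi k i) | cnt w == mi k) `|t w|)).
    by apply: ler_sum => k _; rewrite ct; exact: ler_norm_sum.
  rewrite (square_words N (fun w => `|t w|)).
  apply: (@le_trans _ _ (\sum_(l < (m * N).+1) K * 4^-1 ^+ l)).
    by apply: ler_sum => l _; exact: tl'.
  rewrite -mulr_sumr ler_pM2l// -(big_mkord xpredT (fun l => 4^-1 ^+ l)).
  by apply: (le_trans (geo4_le _ _)); rewrite expr0 mulr1.
apply/cvgrPdist_le => e e0.
(* The [3] adds the Taylor remainder, at most [K * 2^-(N+1)], to the tail of the square sum, at most
   [2 * K * 2^-(N+1)]. *)
have [N0 hN0] := half_exp_small (divr_gt0 e0 (mulr_gt0 (ltr0n R 3) K0)).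
exists (N0.+1)%N => // -[//|N] /= NN0.
have -> : \sum_(k : {ffun 'I_m -> 'I_N.+1}) wcoef f x0 (mi k) * monom (mi k) x0 x =
    \sum_(l < (m * N.+1).+1) \sum_(w <- words m l | [forall i, count_mem i w < N.+1]%N) t w.
  by rewrite -square_words; apply: eq_bigr => k _; rewrite ct.
(* For [m = 0] the square sum stops at length [0]; the missing lengths carry no words. *)
have mN : (m == 0)%N || (N.+1 <= (m * N.+1).+1)%N by case: (m) => // m'; nia.
(* The square of side [N + 1] contains every word of length at most [N]; the longer words in it form
   a geometric tail. *)
have -> : \sum_(l < (m * N.+1).+1) \sum_(w <- words m l | [forall i, count_mem i w < N.+1]%N) t w
  = \sum_(l < N.+1) \sum_(w <- words m l) t w + \sum_(N.+1 <= l < (m * N.+1).+1)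
    \sum_(w <- words m l | [forall i, count_mem i w < N.+1]%N) t w.
  have good l : (l < N.+1)%N -> \sum_(w <- words m l | [forall i, count_mem i w < N.+1]%N) t w =
      \sum_(w <- words m l) t w.
    move=> lN; rewrite big_seq_cond [RHS]big_seq; apply: eq_bigl => w.
    rewrite andb_idr// => /size_in_words wl; apply/forallP => i.
    by rewrite (leq_ltn_trans (count_size _ _))// wl.
  rewrite -(big_mkord xpredT
    (fun l => \sum_(w <- words m l | [forall i, count_mem i w < N.+1]%N) t w)).
  rewrite -(big_mkord xpredT (fun l => \sum_(w <- words m l) t w)).
  move: mN => /orP[/eqP m0|mN].
    have -> : (m * N.+1 = 0)%N by rewrite m0.
    rewrite big_nat1 [X in _ + X]big_geq// addr0 good//.
    rewrite [RHS](@big_cat_nat _ _ _ 1)//= [X in _ = X + _]big_nat1.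
    rewrite [X in _ = _ + X]big_nat [X in _ = _ + X]big1 ?addr0// => l /andP[l0 _].
    case: l l0 => // l _; rewrite big_wordsS big1// => i.
    by have := ltn_ord i; rewrite {2}m0.
  rewrite (@big_cat_nat _ _ _ N.+1)//=; congr (_ + _).
  by rewrite big_nat [RHS]big_nat; apply: eq_bigr => l lN; exact: good.
have h1 : `|f x - \sum_(l < N.+1) \sum_(w <- words m l) t w| <= K * 2^-1 ^+ N.+1.
  by have := AN_taylor K0 fK xr N; rewrite subrK.
set A := \sum_(l < N.+1) _ in h1 *; set B := \sum_(N.+1 <= l < _) _.
have h2 : `|B| <= K * (2 * 2^-1 ^+ N.+1).
  apply: (le_trans (ler_norm_sum _ _ _)).
  apply: (@le_trans _ _ (\sum_(N.+1 <= l < (m * N.+1).+1) K * 4^-1 ^+ l)).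
    by apply: ler_sum => l _; apply: le_trans (tl' l _); exact: ler_norm_sum.
  by rewrite -mulr_sumr ler_pM2l// geo4_le.
rewrite opprD addrA; apply: (le_trans (ler_normB _ _)); apply: (le_trans (lerD h1 h2)).
have h3 : (2^-1 : R) ^+ N.+1 <= 2^-1 ^+ N0.
  by apply: ler_wiXn2l; rewrite ?invr_ge0// ?invf_le1// ?ler1n// ltnW.
have h4 : 2^-1 ^+ N.+1 <= e / (3 * K) by apply: le_trans h3 (ltW hN0).
rewrite ler_pdivlMr ?mulr_gt0// in h4.
by apply: le_trans h4; rewrite le_eqVlt; apply/orP; left; apply/eqP; ring.
Qed.

End Taylor.

(** * Power series *)

Section Series.
Variable R : realType.

Lemma grad_pow m (j : 'I_m) (c : R) p (x : 'rV[R]_m) :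
  grad (fun y : 'rV[R]_m => (y ord0 j - c) ^+ p) x
       (fun i => (i == j)%:R * (p%:R * (x ord0 j - c) ^+ p.-1)).
Proof.
elim: p => [|p IH].
  apply: eq_grad (grad_near _ (grad_cst 1 x)) => [i|]; first by rewrite mul0r mulr0.
  by apply: nearA => y; rewrite expr0.
have h1 := gradB (grad_coord j x) (grad_cst c x).
apply: eq_grad (grad_near _ (gradM h1 IH)) => [i|]; last first.
  by apply: nearA => y; rewrite exprS.
rewrite subr0 /= -(natr1 p); case: p {IH} => [|p]; first by rewrite expr0; ring.
by rewrite /= [in RHS]exprS [in LHS]exprS; ring.
Qed.

Lemma grad_prod_coord m (r : seq 'I_m) (F dF : 'I_m -> 'rV[R]_m -> R) (x : 'rV[R]_m) :
  uniq r -> (forall j, grad (F j) x (fun i => (i == j)%:R * dF j x)) ->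
  grad (fun y => \prod_(j <- r) F j y) x
    (fun i => (i \in r)%:R * (dF i x * \prod_(j <- r | j != i) F j x)).
Proof.
move=> + gF; elim: r => [|j r IH] /=.
  move=> _; apply: eq_grad (grad_near _ (grad_cst 1 x)) => [i|]; first by rewrite mul0r.
  by apply: nearA => y; rewrite big_nil.
move=> /andP[jr /IH{}IH]; apply: eq_grad (grad_near _ (gradM (gF j) IH)) => [i|].
  rewrite inE big_cons; have [->|ij] := eqVneq i j.
    rewrite (negPf jr) /= !mul1r mul0r mulr0 addr0; congr (_ * _).
    rewrite big_seq [RHS]big_seq_cond; apply: eq_bigl => k.
    by case: eqVneq => [->|]; rewrite ?andbT// (negPf jr).
  by rewrite /= !mul0r add0r; ring.
by apply: nearA => y; rewrite big_cons.
Qed.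

(** The derivative along [w] of the monomial with exponents [k]. The falling factorial vanishes as
    soon as a letter occurs too often, so the truncated subtraction does no harm. *)
Definition dmon m (k : {ffun 'I_m -> nat}) (x0 : 'rV[R]_m) (w : seq 'I_m) (x : 'rV[R]_m) : R :=
  \prod_i ((k i ^_ count_mem i w)%:R * (x ord0 i - x0 ord0 i) ^+ (k i - count_mem i w)).

Lemma dmon_nil m k (x0 x : 'rV[R]_m) : dmon k x0 [::] x = monom k x0 x.
Proof. by apply: eq_bigr => i _; rewrite ffactn0 subn0 mul1r. Qed.

Lemma dmon_perm m k (x0 : 'rV[R]_m) w w' : perm_eq w w' -> dmon k x0 w = dmon k x0 w'.
Proof.
by move=> /permP ww'; apply/funext => x; apply: eq_bigr => i _; rewrite ww'.
Qed.

Lemma grad_dmon m k (x0 x : 'rV[R]_m) w :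
  grad (dmon k x0 w) x (fun i => dmon k x0 (i :: w) x).
Proof.
pose F j (y : 'rV[R]_m) : R := (k j ^_ count_mem j w)%:R *
  (y ord0 j - x0 ord0 j) ^+ (k j - count_mem j w).
pose dF j (y : 'rV[R]_m) : R := (k j ^_ (count_mem j w).+1)%:R *
  (y ord0 j - x0 ord0 j) ^+ (k j - (count_mem j w).+1).
have gF j : grad (F j) x (fun i => (i == j)%:R * dF j x).
  apply: eq_grad (gradZ _ (grad_pow j (x0 ord0 j) (k j - count_mem j w) x)) => i.
  by rewrite /dF ffactnSr natrM subnS; ring.
have := @grad_prod_coord m (index_enum _) F dF x (index_enum_uniq _) gF.
apply: eq_grad => i; rewrite mem_index_enum mul1r /dmon [RHS](bigD1 i)//= eqxx add1n.
congr (_ * _); apply: eq_bigr => j ji; rewrite eq_sym (negPf ji) add0n //.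
Qed.

Lemma bin_le_exp2 n p : ('C(n, p) <= 2 ^ n)%N.
Proof.
elim: n p => [|n IH] [|p]//; first by rewrite bin0 expn_gt0.
by rewrite binS expnS mul2n -addnn leq_add.
Qed.

Lemma prod_cnt_fact_le m (w : seq 'I_m) : (\prod_i (count_mem i w)`! <= (size w)`!)%N.
Proof.
elim: w => [|i w IH]; first by rewrite big1.
rewrite (bigD1 i)//= eqxx add1n factS factS -mulnA leq_mul//.
  by rewrite ltnS count_size.
apply: leq_trans IH; rewrite [leqRHS](bigD1 i)//= leq_mul// leq_eqVlt; apply/orP; left.
by apply/eqP; apply: eq_bigr => j ji; rewrite eq_sym (negPf ji) add0n.
Qed.

Definition mdeg m (k : {ffun 'I_m -> nat}) : nat := (\sum_i k i)%N.

Lemma sum_count m (w : seq 'I_m) : (\sum_i count_mem i w = size w)%N.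
Proof. by rewrite -sum_cnt; apply: eq_bigr => i _; rewrite ffunE. Qed.

(** Write [k ^_ c] as a binomial coefficient times [c!] and bound the binomial by [2 ^ k]:
    differentiating costs a doubling of the radius, uniformly in the word. *)
Lemma dmon_bound m k (x0 x : 'rV[R]_m) w (eta : R) : 0 < eta -> `|x - x0| <= eta ->
  `|dmon k x0 w x| <= (2 * eta) ^+ mdeg k * (eta^-1 ^+ size w * (size w)`!%:R).
Proof.
move=> e0 xe.
have h : `|dmon k x0 w x| * eta ^+ size w <= (2 * eta) ^+ mdeg k * (size w)`!%:R.
  apply: (@le_trans _ _ (\prod_i ((2 * eta) ^+ k i * (count_mem i w)`!%:R))).
    rewrite /dmon normr_prod -sum_count expr_sum -big_split/=; apply: ler_prod => i _.
    rewrite mulr_ge0 ?exprn_ge0 ?(ltW e0)//=.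
    rewrite normrM normrX ger0_norm//; set c := count_mem i w; set z := x _ _ - _.
    have ze : `|z| <= eta.
      by apply: le_trans xe; have := coord_le_norm (x - x0) i; rewrite !mxE.
    have [ck|kc] := leqP c (k i); last first.
      by rewrite ffact_small// !mul0r mulr_ge0// exprn_ge0// mulr_ge0// ltW.
    have fc : ((k i ^_ c)%:R : R) <= 2 ^+ k i * c`!%:R.
      by rewrite -bin_ffact natrM ler_wpM2r// -natrX ler_nat bin_le_exp2.
    rewrite exprMn -{4}(subnK ck) exprD -mulrA.
    have -> : 2 ^+ k i * (eta ^+ (k i - c) * eta ^+ c) * c`!%:R =
      (2 ^+ k i * c`!%:R) * (eta ^+ (k i - c) * eta ^+ c) by ring.
    apply: ler_pM => //; first by rewrite mulr_ge0 ?exprn_ge0// ltW.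
    by rewrite ler_wpM2r ?exprn_ge0 ?(ltW e0)// lerXn2r// nnegrE ltW.
  rewrite big_split/= -expr_sum -/(mdeg k) ler_wpM2l ?exprn_ge0 ?mulr_ge0 ?(ltW e0)//.
  by rewrite -natr_prod ler_nat prod_cnt_fact_le.
rewrite exprVn mulrCA [X in _ <= X]mulrC.
by rewrite ler_pdivlMr ?exprn_gt0.
Qed.

Definition sqs m (a : {ffun 'I_m -> nat} -> R) (N : nat) : R :=
  \sum_(k : {ffun 'I_m -> 'I_N}) a (mi k).

Lemma sqs_mono m (a : {ffun 'I_m -> nat} -> R) : (forall k, 0 <= a k) ->
  nondecreasing_seq (sqs a).
Proof.
move=> a0 N N' NN'.
pose emb (k : {ffun 'I_m -> 'I_N}) : {ffun 'I_m -> 'I_N'} := [ffun i => widen_ord NN' (k i)].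
have embi : injective emb.
  move=> k k' /ffunP kk'; apply/ffunP => i; have := kk' i; rewrite !ffunE.
  by move=> /(congr1 val) /= /val_inj.
have -> : sqs a N = \sum_(k in emb @: setT) a (mi k).
  rewrite big_imset /=; last by move=> ? ? _ _; exact: embi.
  apply: eq_big => [k|k _]; first by rewrite in_setT.
  by congr a; apply/ffunP => i; rewrite !ffunE.
rewrite /sqs big_mkcond /=; apply: ler_sum => k _; case: ifP => // _.
Qed.

(** A fixed summable weight, a product of geometric series of total mass at most [2 ^ m], against
    which every series below is compared. *)
Definition hq m (k : {ffun 'I_m -> nat}) : R := 2^-1 ^+ mdeg k.

Lemma hq_ge0 m (k : {ffun 'I_m -> nat}) : 0 <= hq k.
Proof. by rewrite exprn_ge0 ?invr_ge0. Qed.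

Lemma sqs_hq m N : sqs (@hq m) N <= 2 ^+ m.
Proof.
have -> : sqs (@hq m) N = \prod_(i < m) \sum_(j < N) (2^-1 : R) ^+ j.
  rewrite bigA_distr_bigA; apply: eq_bigr => k _; rewrite /hq /mdeg expr_sum.
  by apply: eq_bigr => i _; rewrite ffunE.
rewrite prodr_const card_ord lerXn2r ?nnegrE//.
  by apply: sumr_ge0 => i _; rewrite exprn_ge0 ?invr_ge0.
have -> : \sum_(j < N) (2^-1 : R) ^+ j = 2 - 2 * 2^-1 ^+ N.
  elim: N => [|N IH]; first by rewrite big_ord0 expr0; ring.
  by rewrite big_ord_recr /= IH exprS; field.
by rewrite gerBl mulr_ge0// exprn_ge0// invr_ge0.
Qed.

Lemma sqs_le m (a b : {ffun 'I_m -> nat} -> R) N : (forall k, a k <= b k) ->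
  sqs a N <= sqs b N.
Proof. by move=> ab; apply: ler_sum => k _. Qed.

Lemma sqs_cvg m (a : {ffun 'I_m -> nat} -> R) C : (forall k, `|a k| <= C * hq k) ->
  cvgn (sqs a).
Proof.
move=> aC.
have C0 : 0 <= C.
  have := le_trans (normr_ge0 _) (aC [ffun=> 0%N]); rewrite /hq /mdeg.
  by rewrite big1 => [|i _]; rewrite ?ffunE// expr0 mulr1.
have mc (b : {ffun 'I_m -> nat} -> R) D :
    (forall k, 0 <= b k <= D * hq k) -> 0 <= D -> cvgn (sqs b).
  move=> bD D0; apply: nondecreasing_is_cvgn.
    by apply: sqs_mono => k; have /andP[] := bD k.
  exists (D * 2 ^+ m) => _ [N _ <-]; apply: (@le_trans _ _ (sqs (fun k => D * hq k) N)).
    by apply: sqs_le => k; have /andP[] := bD k.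
  by rewrite /sqs -mulr_sumr ler_wpM2l// sqs_hq.
(* Adding [C * hq] makes all terms nonnegative, so both pieces converge by monotonicity. *)
have -> : sqs a = (fun N => sqs (fun k => a k + C * hq k) N -
    sqs (fun k : {ffun 'I_m -> nat} => C * hq k) N).
  by apply/funext => N; rewrite -sumrB; apply: eq_bigr => k _; rewrite addrK.
apply: is_cvgB.
  apply: (mc _ (2 * C)); last by rewrite mulr_ge0.
  by move=> k; have := aC k; rewrite ler_norml => /andP[h1 h2]; apply/andP; split; lra.
by apply: (mc _ C) => // k; rewrite lexx andbT mulr_ge0// hq_ge0.
Qed.

Lemma sqs_lim_le m (a : {ffun 'I_m -> nat} -> R) C : (forall k, `|a k| <= C * hq k) ->
  `|limn (sqs a)| <= C * 2 ^+ m.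
Proof.
move=> aC; have ca := sqs_cvg aC.
have C0 : 0 <= C.
  have := le_trans (normr_ge0 _) (aC [ffun=> 0%N]); rewrite /hq /mdeg.
  by rewrite big1 => [|i _]; rewrite ?ffunE// expr0 mulr1.
have bN N : `|sqs a N| <= C * 2 ^+ m.
  apply: (le_trans (ler_norm_sum _ _ _)).
  apply: (@le_trans _ _ (sqs (fun k => C * hq k) N)); first by apply: ler_sum.
  by rewrite /sqs -mulr_sumr ler_wpM2l// sqs_hq.
rewrite ler_norml; apply/andP; split.
  by apply: limr_ge => //; apply: nearW => N; have := bN N; rewrite ler_norml => /andP[].
by apply: limr_le => //; apply: nearW => N; have := bN N; rewrite ler_norml => /andP[].
Qed.

Lemma sqs_lim_lin m n (a b : {ffun 'I_m -> nat} -> R) (g : 'I_n -> {ffun 'I_m -> nat} -> R)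
    (t : 'I_n -> R) : cvgn (sqs a) -> cvgn (sqs b) -> (forall i, cvgn (sqs (g i))) ->
  limn (sqs (fun k => a k - b k - \sum_i g i k * t i)) =
  limn (sqs a) - limn (sqs b) - \sum_i limn (sqs (g i)) * t i.
Proof.
move=> ca cb cg; apply/cvg_lim => //.
have -> : sqs (fun k => a k - b k - \sum_i g i k * t i) =
    (fun N => sqs a N - sqs b N - \sum_i sqs (g i) N * t i).
  apply/funext => N; rewrite /sqs sumrB sumrB; congr (_ - _).
  rewrite exchange_big; apply: eq_bigr => i _; by rewrite mulr_suml.
apply: cvgB; first exact: cvgB.
have : forall r : seq 'I_n, (fun N => \sum_(i <- r) sqs (g i) N * t i) @ \oo -->
    \sum_(i <- r) limn (sqs (g i)) * t i.
  elim=> [|i r IH].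
    by rewrite big_nil; apply: cvg_near_cst; apply: nearW => N; rewrite big_nil.
  rewrite big_cons; under eq_fun do rewrite big_cons.
  by apply: cvgD IH; apply: cvgM; [exact: cg | exact: cvg_cst].
exact.
Qed.

(** The power series differentiated term by term along [w]; these are the candidates fed to
    [AN_family]. *)
Definition fam m (c : {ffun 'I_m -> nat} -> R) (x0 : 'rV[R]_m) w (x : 'rV[R]_m) : R :=
  limn (sqs (fun k => c k * dmon k x0 w x)).

(** At radius [rho / 4] the doubling in [dmon_bound] gives [(rho / 2) ^ |k|], half the radius where
    the coefficients are bounded, which leaves the weight [hq]. *)
Lemma dmon_coef_bound m (c : {ffun 'I_m -> nat} -> R) (C rho : R) (x0 x : 'rV[R]_m) w k :
  0 < rho -> (forall k, `|c k| * rho ^+ mdeg k <= C) -> `|x - x0| <= rho / 4 ->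
  `|c k * dmon k x0 w x| <= C * ((rho / 4)^-1 ^+ size w * (size w)`!%:R) * hq k.
Proof.
move=> r0 cC xr; have e0 : 0 < rho / 4 by rewrite divr_gt0.
have E0 : 0 <= (rho / 4)^-1 ^+ size w * (size w)`!%:R :> R.
  by rewrite mulr_ge0 ?exprn_ge0 ?invr_ge0 ?ltW.
rewrite normrM; apply: (le_trans (ler_wpM2l (normr_ge0 _) (dmon_bound k w e0 xr))).
have -> : 2 * (rho / 4) = rho * 2^-1 by field.
rewrite exprMn /hq.
set E := (rho / 4)^-1 ^+ size w * _ in E0 *.
have -> : `|c k| * (rho ^+ mdeg k * 2^-1 ^+ mdeg k * E) =
   (`|c k| * rho ^+ mdeg k) * (E * 2^-1 ^+ mdeg k) by ring.
have -> : C * E * 2^-1 ^+ mdeg k = C * (E * 2^-1 ^+ mdeg k) by ring.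
by rewrite ler_wpM2r// mulr_ge0// exprn_ge0 ?invr_ge0.
Qed.

Lemma seg_norm_lt m (x0 x y : 'rV[R]_m) (t e : R) : 0 <= t <= 1 ->
  `|x - x0| <= e -> `|y - x0| <= e -> `|t *: (y - x) + x - x0| <= e.
Proof.
move=> /andP[t0 t1] xe ye.
have -> : t *: (y - x) + x - x0 = t *: (y - x0) + (1 - t) *: (x - x0).
  by apply/rowP => i; rewrite !mxE; ring.
apply: (le_trans (ler_normD _ _)); rewrite !normrZ (ger0_norm t0) ger0_norm ?subr_ge0//.
have : t * `|y - x0| + (1 - t) * `|x - x0| <= t * e + (1 - t) * e.
  by apply: lerD; apply: ler_wpM2l => //; rewrite subr_ge0.
by move=> h; apply: (le_trans h); rewrite -mulrDl addrC subrK mul1r.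
Qed.

Lemma grad_fam m (c : {ffun 'I_m -> nat} -> R) (C rho : R) (x0 x : 'rV[R]_m) w :
  0 < rho -> (forall k, `|c k| * rho ^+ mdeg k <= C) -> `|x - x0| * (4 / rho) < 1 ->
  grad (fam c x0 w) x (fun i => fam c x0 (i :: w) x).
Proof.
move=> r0 cC xr; have r4 : 0 < 4 / rho by rewrite divr_gt0.
have toe (y : 'rV[R]_m) : `|y - x0| * (4 / rho) < 1 -> `|y - x0| <= rho / 4.
  by rewrite -ltr_pdivlMr// invf_div mul1r => /ltW.
set l := size w.
exists (C * ((rho / 4)^-1 ^+ l.+2 * l.+2`!%:R) * m%:R ^+ 2 * 2 ^+ m).
apply: nearS (near_nearK r4 xr) => y yr.
have xr' := toe _ xr; have yr' := toe _ yr.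
have cv u z : `|z - x0| <= rho / 4 -> cvgn (sqs (fun k => c k * dmon k x0 u z)).
  by move=> zr; apply: sqs_cvg => k; exact: (dmon_coef_bound u k r0 cC zr).
rewrite /fam -(sqs_lim_lin (fun i => y ord0 i - x ord0 i) (cv w y yr') (cv w x xr')
  (fun i => cv (i :: w) x xr')).
apply: (le_trans (sqs_lim_le (C := C * ((rho / 4)^-1 ^+ l.+2 * l.+2`!%:R) *
   m%:R ^+ 2 * `|y - x| ^+ 2) _)); last first.
  by rewrite le_eqVlt; apply/orP; left; apply/eqP; ring.
move=> k.
(* Taylor's formula is applied to [dmon k x0 w] itself, whose further derivatives along [u] are
   indexed by [u ++ w]. *)
have g1 (t : R) : 0 <= t <= 1 -> forall u, grad (dmon k x0 (u ++ w)) (t *: (y - x) + x)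
    (fun i => dmon k x0 ((i :: u) ++ w) (t *: (y - x) + x)).
  by move=> _ u; exact: grad_dmon.
have e0 : 0 < rho / 4 by rewrite divr_gt0.
have b1 (t : R) : 0 <= t <= 1 ->
    `|jet (fun u => dmon k x0 (u ++ w)) (y - x) 2 (t *: (y - x) + x)| <=
    (m%:R * `|y - x|) ^+ 2 * ((2 * (rho / 4)) ^+ mdeg k * ((rho / 4)^-1 ^+ l.+2 * l.+2`!%:R)).
  move=> t01; apply: jet_le => u u2.
  have := dmon_bound k (u ++ w) e0 (seg_norm_lt t01 xr' yr').
  by rewrite size_cat u2 add2n.
have := taylor_seg g1 b1; rewrite subrK big_ord_recr big_ord1 /= !divr1 jet0 jet1 /=.
under eq_bigr => i _ do rewrite !mxE.
set d := _ - _ => hd.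
have -> : c k * dmon k x0 w y - c k * dmon k x0 w x -
   \sum_i c k * dmon k x0 (i :: w) x * (y ord0 i - x ord0 i) = c k * d.
  rewrite /d mulrBr mulrDr opprD addrA; congr (_ - _); rewrite mulr_sumr.
  by apply: eq_bigr => i _; ring.
rewrite normrM; apply: (le_trans (ler_wpM2l (normr_ge0 _) hd)).
have -> : 2 * (rho / 4) = rho * 2^-1 by field.
rewrite [(rho * 2^-1) ^+ _]exprMn exprMn /hq; set E := _ * l.+2`!%:R.
have E0 : 0 <= E by rewrite mulr_ge0 ?exprn_ge0 ?invr_ge0 ?ltW.
have -> : `|c k| * (m%:R ^+ 2 * `|y - x| ^+ 2 * (rho ^+ mdeg k * 2^-1 ^+ mdeg k * E)) =
  (`|c k| * rho ^+ mdeg k) * (E * m%:R ^+ 2 * `|y - x| ^+ 2 * 2^-1 ^+ mdeg k) by ring.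
have -> : C * E * m%:R ^+ 2 * `|y - x| ^+ 2 * 2^-1 ^+ mdeg k =
  C * (E * m%:R ^+ 2 * `|y - x| ^+ 2 * 2^-1 ^+ mdeg k) by ring.
rewrite ler_wpM2r//; apply: mulr_ge0; last by rewrite exprn_ge0 ?invr_ge0.
by apply: mulr_ge0; rewrite ?exprn_ge0//; apply: mulr_ge0; rewrite ?exprn_ge0.
Qed.

Lemma fam_center m (c : {ffun 'I_m -> nat} -> R) (x0 : 'rV[R]_m) w :
  fam c x0 w x0 = (\prod_i (count_mem i w)`!)%:R * c (cnt w).
Proof.
apply/cvg_lim => //; apply: cvg_near_cst; exists (size w).+1 => // N /= wN.
have lt i : (count_mem i w < N)%N by rewrite (leq_ltn_trans (count_size _ _)).
pose k0 : {ffun 'I_m -> 'I_N} := [ffun i => Ordinal (lt i)].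
have k0w : mi k0 = cnt w by apply/ffunP => i; rewrite !ffunE.
rewrite /sqs (bigD1 k0)//= k0w big1 => [|k kk0].
  rewrite addr0 mulrC; congr (_ * _); rewrite natr_prod; apply: eq_bigr => i _.
  by rewrite ffunE subnn expr0 mulr1 ffactnn.
have [i ki] : exists i, (k i : nat) != count_mem i w.
  apply/existsP; apply: contraNT kk0; rewrite negb_exists => /forallP h.
  by apply/eqP/ffunP => i; apply/val_inj; rewrite ffunE /=; apply/eqP/negbNE/h.
rewrite /dmon (bigD1 i)//= ffunE subrr expr0n subn_eq0.
have [lk|kl] := ltnP (k i) (count_mem i w); first by rewrite ffact_small// !mul0r mulr0.
by rewrite leqNgt ltn_neqAle eq_sym ki kl /= mulr0 mul0r mulr0.
Qed.

Lemma fam_perm m (c : {ffun 'I_m -> nat} -> R) (x0 : 'rV[R]_m) w w' :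
  perm_eq w w' -> fam c x0 w = fam c x0 w'.
Proof.
move=> ww'; apply/funext => x; congr (limn _); apply/funext => N.
by apply: eq_bigr => k _; rewrite (dmon_perm _ _ ww').
Qed.

Lemma AN_fam_series m (c : {ffun 'I_m -> nat} -> R) (C rho : R) (x0 : 'rV[R]_m)
    (f : 'rV[R]_m -> R) :
  0 < rho -> (forall k, `|c k| * rho ^+ mdeg k <= C) ->
  (\forall x \near x0, f x = fam c x0 [::] x) ->
  AN f x0 /\ \forall x \near x0, forall w, Dw w f x = fam c x0 w x.
Proof.
move=> r0 cC fc; have r4 : 0 < 4 / rho by rewrite divr_gt0.
apply: (@AN_family R m f x0 (fam c x0) (C * 2 ^+ m) ((rho / 4)^-1)).
apply: nearS (nearI fc (near_normK x0 r4)) => x [fx xr]; split=> // w.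
split; first exact: grad_fam cC xr.
have xr' : `|x - x0| <= rho / 4.
  by move: xr; rewrite -ltr_pdivlMr// invf_div mul1r => /ltW.
apply: (le_trans (sqs_lim_le (fun k => dmon_coef_bound w k r0 cC xr'))).
by rewrite le_eqVlt; apply/orP; left; apply/eqP; ring.
Qed.

(** Evaluate the absolute series at the diagonal point [x1]: all coordinates of [x1 - x0] equal
    [r / 2], so a single term is [|c k| (r / 2) ^ |k|] and lies below the bound [M] of the partial
    sums. *)
Lemma analytic_series m (f : 'rV[R]_m -> R) (x0 : 'rV[R]_m) : analytic_at f x0 ->
  exists (c : {ffun 'I_m -> nat} -> R) (C rho : R),
  [/\ 0 < rho, forall k, `|c k| * rho ^+ mdeg k <= C &
      \forall x \near x0, f x = fam c x0 [::] x].
Proof.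
move=> [c [r [r0 fr]]]; pose x1 : 'rV[R]_m := x0 + const_mx (r / 2).
have r2 : 0 < r / 2 by rewrite divr_gt0.
have x1r : `|x1 - x0| < r.
  rewrite /x1 addrC addKr; apply: (@le_lt_trans _ _ (r / 2)); last by lra.
  by apply: norm_rV_le => [|i]; [exact: ltW | rewrite mxE ger0_norm// ltW].
have [[M hM] _] := fr _ x1r.
exists c, M, (r / 2); split=> // [k|]; last first.
  have rV : 0 < r^-1 by rewrite invr_gt0.
  apply: nearS (near_normK x0 rV) => x; rewrite ltr_pdivrMr// mul1r => xr.
  have [_ /cvg_lim <-//] := fr _ xr.
  by congr (limn _); apply/funext => N; apply: eq_bigr => k _; rewrite dmon_nil.
pose N := (\max_i k i).+1.
have lt i : (k i < N)%N by rewrite ltnS leq_bigmax.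
pose k0 : {ffun 'I_m -> 'I_N} := [ffun i => Ordinal (lt i)].
have k0w : mi k0 = k by apply/ffunP => i; rewrite !ffunE.
apply: le_trans (hM N); rewrite (bigD1 k0)//= k0w.
have -> : `|c k * monom k x0 x1| = `|c k| * (r / 2) ^+ mdeg k.
  rewrite normrM; congr (_ * _); rewrite /monom normr_prod /mdeg expr_sum.
  apply: eq_bigr => i _; rewrite normrX.
  have -> : x1 ord0 i - x0 ord0 i = r / 2 by rewrite !mxE; ring.
  by rewrite ger0_norm// ltW.
by rewrite lerDl sumr_ge0.
Qed.

Lemma analytic_AN m (f : 'rV[R]_m -> R) (x0 : 'rV[R]_m) : analytic_at f x0 -> AN f x0.
Proof.
by move=> /analytic_series[c [C [rho [r0 cC fc]]]]; have [] := AN_fam_series r0 cC fc.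
Qed.

Lemma AN_series m (f : 'rV[R]_m -> R) (x0 : 'rV[R]_m) : AN f x0 ->
  exists (c : {ffun 'I_m -> nat} -> R) (C rho : R),
  [/\ 0 < rho, forall k, `|c k| * rho ^+ mdeg k <= C &
      forall w, Dw w f x0 = (\prod_i (count_mem i w)`!)%:R * c (cnt w)].
Proof.
move=> /AN_analytic/analytic_series[c [C [rho [r0 cC fc]]]]; exists c, C, rho; split=> // w.
have [_ /nbhs_singleton->] := AN_fam_series r0 cC fc; exact: fam_center.
Qed.

(** Derivatives of a monomial depend only on letter counts, and [f] agrees near [x0] with its
    series. *)
Lemma AN_sym m (f : 'rV[R]_m -> R) (x0 : 'rV[R]_m) w w' : AN f x0 -> perm_eq w w' ->
  Dw w f x0 = Dw w' f x0.
Proof.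
move=> /AN_analytic/analytic_series[c [C [rho [r0 cC fc]]]] ww'.
have [_ /nbhs_singleton h] := AN_fam_series r0 cC fc.
by rewrite !h (fam_perm _ _ ww').
Qed.

End Series.

(** * Closed analytic one-forms *)

Section Poincare.
Variable R : realType.

Lemma Dw_rcons m (w : seq 'I_m) i (f : 'rV[R]_m -> R) :
  Dw (rcons w i) f = Dw w (pd i f).
Proof. by rewrite /Dw foldr_rcons. Qed.

Lemma AN_identity m (f g : 'rV[R]_m -> R) x0 : AN f x0 -> AN g x0 ->
  (forall w, Dw w f x0 = Dw w g x0) -> \forall x \near x0, f x = g x.
Proof.
move=> fA gA fg.
have h w : Dw w (fun x => f x - g x) x0 = 0.
  by rewrite (nbhs_singleton (AN_sub_Dw fA gA)) fg subrr.
by apply: nearS (AN_zero (AN_sub fA gA) h) => x /eqP; rewrite subr_eq0 => /eqP.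
Qed.

Lemma prod_fact_rcons m (w : seq 'I_m) i :
  (\prod_j (count_mem j (rcons w i))`! =
   (count_mem i w).+1 * \prod_j (count_mem j w)`!)%N.
Proof.
rewrite (bigD1 i)//= [in RHS](bigD1 i)//= mulnA -factS.
have cr j : (count_mem j (rcons w i) = (i == j) + count_mem j w)%N.
  by rewrite -cats1 count_cat /= addn0 addnC.
rewrite cr eqxx; congr (_ * _)%N; apply: eq_bigr => j ji.
by rewrite cr eq_sym (negPf ji).
Qed.

Definition mdec m (k : {ffun 'I_m -> nat}) (i : 'I_m) : {ffun 'I_m -> nat} :=
  [ffun j => (k j - (j == i))%N].

Lemma poincare m (h : 'I_m -> 'rV[R]_m -> R) x0 : (forall i, AN (h i) x0) ->
  (\forall x \near x0, forall i j, pd j (h i) x = pd i (h j) x) ->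
  exists2 H, AN H x0 & \forall x \near x0, forall i, pd i H x = h i x.
Proof.
move=> hA hc.
have /choice[c cP] : forall i, exists c : {ffun 'I_m -> nat} -> R,
    (exists C rho : R, 0 < rho /\ forall k, `|c k| * rho ^+ mdeg k <= C) /\
    forall w, Dw w (h i) x0 = (\prod_j (count_mem j w)`!)%:R * c (cnt w).
  move=> i; have [c [C [rho [r0 cC cw]]]] := AN_series (hA i).
  by exists c; split=> //; exists C, rho.
have cw i := proj2 (cP i).
have /choice[C CP] : forall i, exists C : R, exists rho : R,
    0 < rho /\ forall k, `|c i k| * rho ^+ mdeg k <= C.
  by move=> i; have [[C [rho [r0 H]]] _] := cP i; exists C, rho.
have [rho rP] := choice CP.
have C0 i : 0 <= C i.
  have [r0 /(_ [ffun=> 0%N])] := rP i; apply: le_trans.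
  by rewrite mulr_ge0// exprn_ge0// ltW.
(* A common radius below every [rho i]; the leading [1] keeps it positive when there is no index. *)
pose r : R := (1 + \sum_i (rho i)^-1)^-1.
have S0 : 0 <= \sum_i (rho i)^-1.
  by apply: sumr_ge0 => i _; rewrite invr_ge0; have [/ltW] := rP i.
have r0 : 0 < r by rewrite invr_gt0 ltr_pwDl.
have rr i : r <= rho i.
  have [ri _] := rP i; rewrite -[leRHS]invrK lef_pV2 ?posrE ?invr_gt0 ?ltr_pwDl//.
  have h1 : 0 <= \sum_(j | j != i) (rho j)^-1.
    by apply: sumr_ge0 => j _; rewrite invr_ge0; have [/ltW] := rP j.
  by rewrite (bigD1 i)//=; lra.
have cr i k : `|c i k| * r ^+ mdeg k <= C i.
  have [ri /(_ k)] := rP i; apply: le_trans; rewrite ler_wpM2l// lerXn2r//.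
    by rewrite nnegrE ltW.
  by rewrite nnegrE ltW.
pose T (k : {ffun 'I_m -> nat}) i : R := if (0 < k i)%N then c i (mdec k i) else 0.
(* The radial homotopy formula on coefficients: integrating [\sum_i h_i(x) (x^i - x0^i)] along rays
   divides its part of degree [|k|] by [|k|]. In degree [0] division by zero returns [0], the
   constant term wanted. *)
pose Cc k : R := (\sum_i T k i) / (mdeg k)%:R.
have bC k : `|Cc k| * r ^+ mdeg k <= (\sum_i C i) * r.
  have [k0|kpos] := posnP (mdeg k).
    rewrite /Cc k0 invr0 mulr0 normr0 mul0r mulr_ge0 ?(ltW r0)//; exact: sumr_ge0.
  rewrite /Cc normrM normfV mulrAC ler_pdivrMr ?normr_gt0 ?pnatr_eq0 -?lt0n//.
  have d1 : 1 <= `|(mdeg k)%:R : R| by rewrite normr_nat ler1n.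
  have Cr0 : 0 <= (\sum_i C i) * r by rewrite mulr_ge0 ?(ltW r0)//; exact: sumr_ge0.
  apply: le_trans (_ : (\sum_i C i) * r <= _); last by rewrite ler_peMr.
  apply: (le_trans (ler_wpM2r (exprn_ge0 _ (ltW r0)) (ler_norm_sum _ _ _))).
  rewrite !mulr_suml; apply: ler_sum => i _; rewrite /T; case: ifP => ki; last first.
    by rewrite normr0 mul0r mulr_ge0// ltW.
  have -> : mdeg k = (mdeg (mdec k i)).+1.
    rewrite /mdeg (bigD1 i)//= [in RHS](bigD1 i)//= !ffunE eqxx subn1 -addSn prednK//.
    by congr (_ + _)%N; apply: eq_bigr => j ji; rewrite !ffunE (negPf ji) subn0.
  by rewrite exprSr mulrA ler_wpM2r ?(ltW r0).
have [HA HD] : AN (fam Cc x0 [::]) x0 /\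
    \forall x \near x0, forall w, Dw w (fam Cc x0 [::]) x = fam Cc x0 w x.
  by apply: AN_fam_series r0 bC _; apply: nearA.
exists (fam Cc x0 [::]) => //; apply: near_forall => i.
apply: AN_identity => [|//|w]; first exact: AN_pd.
rewrite -Dw_rcons (nbhs_singleton HD) fam_center cw prod_fact_rcons natrM -mulrA mulrCA.
congr (_ * _).
(* Closedness read off on Taylor coefficients. *)
have clos a b u : (count_mem b u).+1%:R * c a (cnt (rcons u b)) =
    (count_mem a u).+1%:R * c b (cnt (rcons u a)).
  have : Dw (rcons u b) (h a) x0 = Dw (rcons u a) (h b) x0.
    rewrite !Dw_rcons; apply: (nbhs_singleton (Dw_near _ _ _)).
      by apply: AN_pd.
    by apply: nearS hc => x ->.
  rewrite !cw !prod_fact_rcons !natrM; set P : R := (\prod_j _)%:R => PE.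
  have P0 : P != 0 by rewrite pnatr_eq0 -lt0n prodn_gt0// => j; rewrite fact_gt0.
  by apply: (mulfI P0); rewrite !mulrA ![P * _]mulrC.
have ce u a b : cnt (rcons u a) b = ((a == b) + count_mem b u)%N.
  by rewrite ffunE -cats1 count_cat /= addn0 addnC.
(* By closedness each summand of the potential becomes a multiple of the one coefficient
   [c i (cnt w)]. The multiplicities add up over [j] to [size w + 1], which cancels the division by
   the degree. *)
have TE j : (count_mem i w).+1%:R * T (cnt (rcons w i)) j =
    ((j == i) + count_mem j w)%N%:R * c i (cnt w).
  rewrite /T ce; have [->|ij] := eqVneq i j.
    rewrite add1n /=; congr (_ * c _ _); apply/ffunP => b.
    by rewrite ffunE ce ffunE (eq_sym j b) addKn.
  rewrite add0n; case: ifP => [jw|]; last first.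
    by move=> /negbT; rewrite -leqNgt leqn0 => /eqP->; rewrite mulr0 mul0r.
  have jw' : j \in w by rewrite -has_pred1 has_count.
  have pw := perm_to_rem jw'; set u := rem j w in pw.
  have cu b : count_mem b w = ((j == b) + count_mem b u)%N by have /permP-> := pw.
  have := clos j i u; rewrite cu eq_sym (negPf ij) add0n.
  have -> : cnt (rcons u j) = cnt w by apply/ffunP => b; rewrite ce ffunE cu.
  have -> : mdec (cnt (rcons w i)) j = cnt (rcons u i).
    by apply/ffunP => b; rewrite ffunE !ce cu (eq_sym j b) addnCA addKn.
  by rewrite (cu j) eqxx add1n.
rewrite /Cc.
have md : mdeg (cnt (rcons w i)) = (size w).+1 by rewrite /mdeg sum_cnt size_rcons.
have -> : (count_mem i w).+1%:R * ((\sum_j T (cnt (rcons w i)) j) / (mdeg (cnt (rcons w i)))%:R)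
  = (\sum_j (count_mem i w).+1%:R * T (cnt (rcons w i)) j) / (mdeg (cnt (rcons w i)))%:R.
  by rewrite mulrA mulr_sumr.
under eq_bigr => j _ do rewrite TE.
rewrite -mulr_suml -natr_sum big_split/= sum_count md.
have -> : (\sum_(j < m) (j == i) = 1)%N.
  by rewrite (bigD1 i)//= eqxx big1// => j /negPf->.
by rewrite add1n mulrAC divff ?mul1r// pnatr_eq0.
Qed.

End Poincare.

(** * Functions of one variable *)

Section OneVariable.
Variable R : realType.

Definition ev1 (a : R -> R) (y : 'rV[R]_1) : R := a (y ord0 ord0).

Lemma const_mx1 (y : 'rV[R]_1) : const_mx (y ord0 ord0) = y.
Proof. by apply/rowP => i; rewrite mxE (ord1 i). Qed.

Lemma norm_const_mx1 (s : R) : `|const_mx s : 'rV[R]_1| = `|s|.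
Proof.
apply/eqP; rewrite eq_le; apply/andP; split.
  by apply: norm_rV_le => // i; rewrite mxE.
by have := coord_le_norm (const_mx s : 'rV[R]_1) ord0; rewrite mxE.
Qed.

Lemma near_const_mx1 (s : R) (P : 'rV[R]_1 -> Prop) :
  (\forall y \near (const_mx s : 'rV[R]_1), P y) -> \forall t \near s, P (const_mx t).
Proof.
move=> /nearKP[K K0 KP]; apply/nearKP; exists K => // t tK; apply: KP.
by rewrite -raddfB /= norm_const_mx1.
Qed.

Lemma grad_ev1 (a : R -> R) (s : R) g : grad (ev1 a) (const_mx s) g ->
  is_derive s 1 a (g ord0).
Proof.
move=> [K hK]; apply: quad_is_derive; exists K.
have : \forall h \near (0 : R),
   `|ev1 a (const_mx (h *: 1 + s)) - ev1 a (const_mx s) - \sum_i g i *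
      ((const_mx (h *: 1 + s) : 'rV[R]_1) ord0 i - (const_mx s : 'rV[R]_1) ord0 i)|
     <= K * `|const_mx (h *: 1 + s) - const_mx s : 'rV[R]_1| ^+ 2.
  exact: (near_line (1 : R) (near_const_mx1 hK)).
apply: filterS => h; rewrite big_ord1 /ev1 -raddfB /= norm_const_mx1 !mxE addrK.
by rewrite [h *: 1]mulr1.
Qed.

Lemma AN_derive1 (a : R -> R) (s : R) : AN (ev1 a) (const_mx s) ->
  derive1 a s = pd ord0 (ev1 a) (const_mx s).
Proof. by move=> /AN_grad/grad_ev1[_ <-]; rewrite derive1E. Qed.

Lemma AN_ev1_derive1 (a : R -> R) (s : R) : AN (ev1 a) (const_mx s) ->
  AN (ev1 (derive1 a)) (const_mx s).
Proof.
move=> aA; apply: AN_eq (AN_pd ord0 aA); apply: nearS (AN_near aA) => y yA.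
by rewrite /ev1 AN_derive1 const_mx1.
Qed.

Lemma AN_ev1_near (a : R -> R) (s : R) : AN (ev1 a) (const_mx s) ->
  \forall t \near s, AN (ev1 a) (const_mx t).
Proof. by move=> aA; apply: near_const_mx1; exact: AN_near. Qed.

Lemma AN_ev1_is_derive (a : R -> R) (s : R) : AN (ev1 a) (const_mx s) ->
  is_derive s 1 a ((derive1 a) s).
Proof. by move=> aA; rewrite AN_derive1//; exact: grad_ev1 (AN_grad aA). Qed.

Lemma grad_comp1 n (a : R -> R) (f : 'rV[R]_n -> R) x g : grad f x g ->
  AN (ev1 a) (const_mx (f x)) -> grad (fun y => a (f y)) x (fun i => (derive1 a) (f x) * g i).
Proof.
move=> fg aA; pose v y : 'rV[R]_1 := const_mx (f y).
have gv (b : 'I_1) : grad (fun y => v y ord0 b) x ((fun i _ => g i)^~ b).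
  by apply: grad_near fg; apply: nearA => y; rewrite mxE.
apply: eq_grad (grad_near _ (grad_comp gv (AN_grad aA))) => [i|].
  by rewrite big_ord1 -AN_derive1// mulrC.
by apply: nearA => y; rewrite /ev1 mxE.
Qed.

End OneVariable.

(** * The implicit equation for the envelope parameter *)

Section Implicit.
Variable R : realType.

Lemma ANK_ev1 (K : R) (a : R -> R) s0 t : 0 < K -> ANK K (ev1 a) (const_mx s0) ->
  `|t - s0| * K < 1 ->
  [/\ AN (ev1 a) (const_mx t), `|a t| <= K & `|derive1 a t| <= K ^+ 2].
Proof.
move=> K0 aK tK.
have tK' : `|const_mx t - const_mx s0 : 'rV[R]_1| * K < 1.
  by rewrite -raddfB /= norm_const_mx1.
have tA := ANK_AN K0 aK tK'; split=> //.
  by have [_] := aK _ tK' [::]; rewrite /= /ev1 mxE !mulr1.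
by have [_] := aK _ tK' [:: ord0]; rewrite /= -AN_derive1// mulr1.
Qed.

Lemma ball_between (K s0 a b c : R) : 0 < K -> `|a - s0| * K < 1 -> `|b - s0| * K < 1 ->
  a <= c <= b -> `|c - s0| * K < 1.
Proof.
move=> K0; rewrite -!ltr_pdivlMr// !ltr_norml => /andP[a1 a2] /andP[b1 b2] /andP[c1 c2].
by apply/andP; split; lra.
Qed.

Lemma ANK_lip (K : R) (a : R -> R) s0 t t' : 0 < K -> ANK K (ev1 a) (const_mx s0) ->
  `|t - s0| * K < 1 -> `|t' - s0| * K < 1 -> `|a t' - a t| <= K ^+ 2 * `|t' - t|.
Proof.
move=> K0 aK; wlog tt' : t t' / t <= t'.
  move=> H h h'; have [tt|/ltW tt] := leP t t'; first exact: H.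
  by rewrite distrC [`|t' - t|]distrC; exact: H.
move=> h h'.
have bt (c : R) : c \in `[t, t']%R -> `|c - s0| * K < 1.
  by rewrite in_itv /=; exact: ball_between.
have dc (c : R) : c \in `[t, t']%R -> is_derive c 1 a (derive1 a c).
  by move=> /bt hc; have [cA _ _] := ANK_ev1 K0 aK hc; exact: AN_ev1_is_derive.
have mv1 (c : R) : c \in `]t, t'[%R -> is_derive c 1 a (derive1 a c).
  move=> ctt'; apply: dc; move: ctt'; rewrite !in_itv /= => /andP[/ltW-> /ltW->] //.
have mv2 : {within [set` `[t, t']%R], continuous a}.
  by apply: derivable_within_continuous => c /dc[].
have [c /bt hc ->] := MVT_segment tt' mv1 mv2.
by rewrite normrM ler_wpM2r//; have [] := ANK_ev1 K0 aK hc.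
Qed.

Lemma sum_coord_le n (g : 'I_n -> R) (h : 'rV[R]_n) (C : R) :
  (forall i, `|g i| <= C) -> `|\sum_i g i * h ord0 i| <= n%:R * C * `|h|.
Proof.
move=> gC; apply: (le_trans (ler_norm_sum _ _ _)).
apply: (@le_trans _ _ (\sum_(i < n) C * `|h|)).
  by apply: ler_sum => i _; rewrite normrM ler_pM// coord_le_norm.
by rewrite sumr_const card_ord -[leLHS]mulr_natl mulrA.
Qed.

(** A root [s x] is chosen pointwise by the intermediate value theorem. The equation then makes the
    chosen function Lipschitz, next differentiable with an explicit gradient; analyticity follows
    because that gradient is an analytic function of [(x, s x)]. *)
Lemma implicit n (phi : 'I_n -> R -> R) (x0 : 'rV[R]_n) (s0 : R) :
  (forall i, AN (ev1 (phi i)) (const_mx s0)) ->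
  exists s : 'rV[R]_n -> R, [/\ s x0 = s0, AN s x0 & \forall x \near x0,
    s x - s0 = \sum_i phi i (s x) * (x ord0 i - x0 ord0 i) /\
    grad s x (fun i => phi i (s x) /
      (1 - \sum_j derive1 (phi j) (s x) * (x ord0 j - x0 ord0 j)))].
Proof.
move=> pA; have [K K1 pK] := AN_common pA.
have K0 : 0 < K by lra.
(* Keeps [s] in the ball where the bounds on [phi] hold, with [d * K = 1/2]. *)
pose d : R := (2 * K)^-1.
have d0 : 0 < d by rewrite invr_gt0 mulr_gt0.
have dK t : `|t - s0| <= d -> `|t - s0| * K < 1.
  move=> td; apply: (@le_lt_trans _ _ (d * K)); first by rewrite ler_wpM2r// ltW.
  by rewrite /d invfM -mulrA mulVf ?gt_eqF// mulr1 invf_lt1// ltr1n.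
(* Forces [n * K ^+ 2 * |x - x0| <= 1/4]. This bounds the right-hand side of the equation by
   [d / 2], gives the contraction factor [1/4] in [lip], and keeps [D] away from [0]. *)
pose K2 : R := 4 * n.+1%:R * K ^+ 2.
have K20 : 0 < K2 by rewrite !mulr_gt0 ?exprn_gt0.
have small (h : 'rV[R]_n) : `|h| * K2 < 1 -> n%:R * K ^+ 2 * `|h| <= 4^-1.
  have hK : 0 <= K ^+ 2 * `|h| by rewrite mulr_ge0// exprn_ge0// ltW.
  have -> : `|h| * K2 = 4 * (n%:R * K ^+ 2 * `|h|) + 4 * (K ^+ 2 * `|h|).
    by rewrite /K2 -natr1; ring.
  by lra.
have smallp (h : 'rV[R]_n) t : `|h| * K2 < 1 -> `|t - s0| <= d ->
    `|\sum_i phi i t * h ord0 i| <= d / 2.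
  move=> hK td; apply: (@le_trans _ _ (n%:R * K * `|h|)).
    by apply: sum_coord_le => i; have [] := ANK_ev1 K0 (pK i) (dK _ td).
  have := small h hK; rewrite /d.
  have -> : n%:R * K ^+ 2 * `|h| = (n%:R * K * `|h|) * K by ring.
  suff -> : (2 * K)^-1 / 2 = 4^-1 / K by rewrite -ler_pdivlMr.
  by field; rewrite gt_eqF.
have hE (x : 'rV[R]_n) i : x ord0 i - x0 ord0 i = (x - x0) ord0 i by rewrite !mxE.
have ex (x : 'rV[R]_n) : exists t : R, `|x - x0| * K2 < 1 ->
    `|t - s0| <= d /\ t - s0 = \sum_i phi i t * (x ord0 i - x0 ord0 i).
  (* Outside the ball the value [0] is arbitrary. Inside, [psi] changes sign on the interval, since
     the sum is at most [d / 2] at both ends. *)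
  have [xK|xK] := ltP (`|x - x0| * K2) 1; last by exists 0.
  pose psi (t : R) := t - s0 - \sum_i phi i t * (x - x0) ord0 i.
  have [t] : exists2 t : R, t \in `[s0 - d, s0 + d]%R & psi t = 0.
    apply: IVT; first by lra.
      apply: derivable_within_continuous => t; rewrite in_itv/= => tI.
      have tK : `|t - s0| * K < 1 by apply: dK; rewrite ler_norml; apply/andP; split; lra.
      have tA : AN (ev1 psi) (const_mx t).
        apply: AN_sub; first by apply: AN_sub; [exact: AN_coord | exact: AN_cst].
        apply: AN_sum => i; apply: AN_mul; last exact: AN_cst.
        by have [] := ANK_ev1 K0 (pK i) tK.
      by have [] := AN_ev1_is_derive tA.
    have b1 := smallp _ (s0 - d) xK; have b2 := smallp _ (s0 + d) xK.
    have e1 : s0 - d - s0 = - d by ring.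
    have e2 : s0 + d - s0 = d by ring.
    rewrite e1 normrN gtr0_norm// in b1; rewrite e2 gtr0_norm// in b2.
    have {b1} := b1 (lexx _); rewrite ler_norml => /andP[b11 b12].
    have {b2} := b2 (lexx _); rewrite ler_norml => /andP[b21 b22].
    rewrite /psi e1 e2 ge_min le_max; apply/andP; split; apply/orP; [left|right]; lra.
  rewrite in_itv /= => tI /eqP; rewrite subr_eq0 => /eqP pt.
  exists t => _; split; first by rewrite ler_norml; apply/andP; split; lra.
  by rewrite pt; apply: eq_bigr => i _; rewrite hE.
have [s sP] := choice ex.
have sx0 : s x0 = s0.
  have [|_] := sP x0; first by rewrite subrr normr0 mul0r.
  rewrite big1 => [/eqP|i _]; last by rewrite subrr mulr0.
  by rewrite subr_eq0 => /eqP.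
have lip (x y : 'rV[R]_n) : `|x - x0| * K2 < 1 -> `|y - x0| * K2 < 1 ->
    `|s y - s x| <= 2 * (n%:R * K) * `|y - x|.
  move=> xK yK; have [sxd sxE] := sP _ xK; have [syd syE] := sP _ yK.
  (* The second sum is at most a quarter of [|s y - s x|] and is absorbed on the left. *)
  have e : s y - s x = \sum_i phi i (s y) * (y - x) ord0 i +
      \sum_i (phi i (s y) - phi i (s x)) * (x - x0) ord0 i.
    have -> : s y - s x = (s y - s0) - (s x - s0) by ring.
    rewrite syE sxE -sumrB -big_split/=; apply: eq_bigr => i _.
    by rewrite !mxE; ring.
  have h1 : `|\sum_i phi i (s y) * (y - x) ord0 i| <= n%:R * K * `|y - x|.
    by apply: sum_coord_le => i; have [] := ANK_ev1 K0 (pK i) (dK _ syd).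
  have h2 : `|\sum_i (phi i (s y) - phi i (s x)) * (x - x0) ord0 i| <=
      n%:R * (K ^+ 2 * `|s y - s x|) * `|x - x0|.
    by apply: sum_coord_le => i; exact: ANK_lip (pK i) (dK _ sxd) (dK _ syd).
  have h3 : n%:R * (K ^+ 2 * `|s y - s x|) * `|x - x0| <= 4^-1 * `|s y - s x|.
    have -> : n%:R * (K ^+ 2 * `|s y - s x|) * `|x - x0| =
      (n%:R * K ^+ 2 * `|x - x0|) * `|s y - s x| by ring.
    by rewrite ler_wpM2r// small.
  have := ler_normD (\sum_i phi i (s y) * (y - x) ord0 i)
     (\sum_i (phi i (s y) - phi i (s x)) * (x - x0) ord0 i).
  rewrite -e; have := normr_ge0 (s y - s x); lra.
pose D (x : 'rV[R]_n) := 1 - \sum_j derive1 (phi j) (s x) * (x ord0 j - x0 ord0 j).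
have D0 (x : 'rV[R]_n) : `|x - x0| * K2 < 1 -> D x != 0.
  move=> xK; have [sxd _] := sP _ xK.
  have : `|\sum_j derive1 (phi j) (s x) * (x - x0) ord0 j| <= n%:R * K ^+ 2 * `|x - x0|.
    by apply: sum_coord_le => i; have [] := ANK_ev1 K0 (pK i) (dK _ sxd).
  have := small _ xK; move=> h1 h2; have := le_trans h2 h1.
  rewrite ler_norml => /andP[_ h3]; rewrite /D gt_eqF// subr_gt0.
  by under eq_bigr do rewrite hE; lra.
have gs (x : 'rV[R]_n) : `|x - x0| * K2 < 1 ->
    grad s x (fun i => phi i (s x) / D x).
  move=> xK; have [sxd sxE] := sP _ xK; have Dx := D0 _ xK.
  have qphi i : exists k : R, \forall y \near x,
     `|phi i (s y) - phi i (s x) - derive1 (phi i) (s x) * (s y - s x)| <= k * `|y - x| ^+ 2.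
    have [pAx _ _] := ANK_ev1 K0 (pK i) (dK _ sxd).
    have [k hk] := AN_grad pAx; have hk' := near_const_mx1 hk.
    have sc : \forall y \near x, `|s y - s x| <= (2 * (n%:R * K) + 1) * `|y - x|.
      apply: nearS (near_nearK K20 xK) => y yK; apply: (le_trans (lip _ _ xK yK)).
      by rewrite ler_wpM2r// lerDl.
    have L0 : 0 < 2 * (n%:R * K) + 1 by rewrite ltr_pwDr// mulr_ge0// mulr_ge0// ltW.
    exists (`|k| * (2 * (n%:R * K) + 1) ^+ 2).
    have /nearKP[k2 k20 hk2] := hk'.
    have := nearI sc (near_normK x (mulr_gt0 L0 k20)).
    apply: nearS => y [y1 y2].
    have yk2 : `|s y - s x| * k2 < 1.
      apply: le_lt_trans y2.
      have -> : `|y - x| * ((2 * (n%:R * K) + 1) * k2) =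
        (2 * (n%:R * K) + 1) * `|y - x| * k2 by ring.
      by rewrite ler_wpM2r// ltW.
    have := hk2 _ yk2; rewrite big_ord1 /ev1 -raddfB /= norm_const_mx1 !mxE -AN_derive1//.
    move=> H; apply: (le_trans H); apply: (@le_trans _ _ (`|k| * `|s y - s x| ^+ 2)).
      by rewrite ler_wpM2r ?exprn_ge0// ler_norm.
    rewrite -mulrA ler_wpM2l// -exprMn lerXn2r ?nnegrE//.
    by rewrite mulr_ge0// ltW.
  have [k qk] := choice qphi.
  have qk' : \forall y \near x, forall i, `|phi i (s y) - phi i (s x) -
      derive1 (phi i) (s x) * (s y - s x)| <= k i * `|y - x| ^+ 2 by exact: near_forall.
  exists (`|(D x)^-1| * (n%:R * (K ^+ 2 * (2 * (n%:R * K))) +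
     n%:R * (\sum_i `|k i|) * `|x - x0|)).
  apply: nearS (nearI qk' (near_nearK K20 xK)) => y [yq yK].
  have [syd syE] := sP _ yK.
  set S1 := \sum_i (phi i (s y) - phi i (s x)) * (y - x) ord0 i.
  set S2 := \sum_i (phi i (s y) - phi i (s x) - derive1 (phi i) (s x) * (s y - s x)) *
     (x - x0) ord0 i.
  (* Multiplying by [D x] leaves [S1], a sum of products of two increments, and [S2], the
     second-order remainders of the [phi i]; both are quadratic. *)
  have e : s y - s x - \sum_i phi i (s x) / D x * (y ord0 i - x ord0 i) = (D x)^-1 * (S1 + S2).
    apply: (mulfI Dx); rewrite mulrA divff// mul1r mulrBr mulr_sumr.
    have -> : \sum_i D x * (phi i (s x) / D x * (y ord0 i - x ord0 i)) =
       \sum_i phi i (s x) * (y ord0 i - x ord0 i).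
      by apply: eq_bigr => i _; field.
    rewrite {1}/D mulrBl mul1r mulr_suml.
    have -> : s y - s x = \sum_i (phi i (s y) * (y ord0 i - x0 ord0 i) -
        phi i (s x) * (x ord0 i - x0 ord0 i)) by rewrite sumrB -syE -sxE; ring.
    rewrite -!sumrB -big_split/=; apply: eq_bigr => i _.
    have -> : \sum_i (phi i (s y) * (y ord0 i - x0 ord0 i) -
        phi i (s x) * (x ord0 i - x0 ord0 i)) = s y - s x by rewrite sumrB -syE -sxE; ring.
    by rewrite !mxE; ring.
  rewrite e normrM -[leRHS]mulrA ler_wpM2l// mulrDl; apply: (le_trans (ler_normD _ _)); apply: lerD.
    apply: (@le_trans _ _ (n%:R * (K ^+ 2 * `|s y - s x|) * `|y - x|)).
      by apply: sum_coord_le => i; exact: ANK_lip (pK i) (dK _ sxd) (dK _ syd).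
    have -> : n%:R * (K ^+ 2 * (2 * (n%:R * K))) * `|y - x| ^+ 2 =
      n%:R * (K ^+ 2 * (2 * (n%:R * K) * `|y - x|)) * `|y - x| by ring.
    rewrite ler_wpM2r// ler_wpM2l// ler_wpM2l ?exprn_ge0 ?(ltW K0)//.
    exact: lip.
  apply: (@le_trans _ _ (n%:R * ((\sum_i `|k i|) * `|y - x| ^+ 2) * `|x - x0|)); last first.
    by rewrite le_eqVlt; apply/orP; left; apply/eqP; ring.
  apply: sum_coord_le => i; apply: (le_trans (yq i)); rewrite ler_wpM2r ?exprn_ge0//.
  apply: (le_trans (ler_norm _)); rewrite (bigD1 i)//= lerDl; exact: sumr_ge0.
exists s; split=> //; last first.
  apply: nearS (near_normK x0 K20) => x xK; split; last exact: gs.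
  by have [] := sP _ xK.
(* The graph of [s] solves a first-order system whose right-hand side is rational in [phi i], their
   derivatives and the coordinates. *)
pose V (x : 'rV[R]_n) : 'rV[R]_(n + 1) := row_mx x (const_mx (s x)).
pose last (z : 'rV[R]_(n + 1)) : R := z ord0 (rshift n ord0).
have lastV x : last (V x) = s x by rewrite /last row_mxEr mxE.
have VE x j : V x ord0 (lshift 1 j) = x ord0 j by rewrite row_mxEl.
pose Den (z : 'rV[R]_(n + 1)) : R := 1 - \sum_j derive1 (phi j) (last z) *
   (z ord0 (lshift 1 j) - x0 ord0 j).
pose Phi (i : 'I_n) (b : 'I_(n + 1)) : 'rV[R]_(n + 1) -> R :=
  match fintype.split b with
  | inl j => fun=> (i == j)%:R
  | inr _ => fun z => phi i (last z) / Den z end.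
have DenV x : Den (V x) = D x.
  by rewrite /Den /D lastV; congr (_ - _); apply: eq_bigr => j _; rewrite VE.
have lA : AN last (V x0) by exact: AN_coord.
apply: (@AN_ext _ _ (fun x => last (V x))); first by move=> x; rewrite lastV.
apply: (@AN_flow _ _ _ V Phi last) => //.
- apply: nearS (near_normK x0 K20) => x xK b; rewrite /Phi; case: (split_ordP b) => j ->.
    by apply: grad_near (grad_coord j x); apply: nearA => y; rewrite VE.
  rewrite lastV DenV; apply: grad_near (gs _ xK).
  by apply: nearA => y; rewrite row_mxEr mxE.
- move=> i b; rewrite /Phi; case: (split_ordP b) => j _; first exact: AN_cst.
  have comp a : AN (ev1 a) (const_mx s0) -> AN (fun z => a (last z)) (V x0).
    by move=> aA; apply: AN_comp1 lA _; rewrite lastV sx0.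
  apply: AN_mul; first exact: comp.
  apply: AN_inv; last by rewrite DenV D0// subrr normr0 mul0r.
  apply: AN_sub; first exact: AN_cst.
  apply: AN_sum => k; apply: AN_mul; first by apply: comp; exact: AN_ev1_derive1.
  by apply: AN_sub; [exact: AN_coord | exact: AN_cst].
Qed.

End Implicit.

(** * Restriction to the initial line *)

Section Line.
Variables (R : realType) (n : nat) (i1 : 'I_n).
Implicit Types (f u : 'rV[R]_n -> R) (x : 'rV[R]_n).

Lemma near_near (x0 : 'rV[R]_n) (P : 'rV[R]_n -> Prop) : (\forall x \near x0, P x) ->
  \forall x \near x0, \forall y \near x, P y.
Proof.
move=> /nearKP[K K0 KP]; apply: nearS (near_normK x0 K0) => x xK.
by apply: nearS (near_nearK K0 xK).
Qed.

Lemma near_near1 (s : R) (P : R -> Prop) : (\forall t \near s, P t) ->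
  \forall t \near s, \forall t' \near t, P t'.
Proof.
move=> /nearKP[K K0 KP]; apply/nearKP; exists K => // t tK.
by have := near_nearK K0 tK; apply: filterS.
Qed.

Lemma near1I (s : R) (P Q : R -> Prop) : (\forall t \near s, P t) ->
  (\forall t \near s, Q t) -> \forall t \near s, P t /\ Q t.
Proof. by move=> h1 h2; exact: filterI. Qed.

Lemma near1_forall (T : finType) (s : R) (P : T -> R -> Prop) :
  (forall i, \forall t \near s, P i t) -> \forall t \near s, forall i, P i t.
Proof. by move=> h; exact: (@filter_forall _ _ P (nbhs s)). Qed.

Lemma near_open (W : set 'rV[R]_n) x : open W -> W x -> \forall y \near x, W y.
Proof. by move=> oW Wx; exact: open_nbhs_nbhs. Qed.

Lemma near_open1 (W : set R) t : open W -> W t -> \forall y \near t, W y.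
Proof. by move=> oW Wx; exact: open_nbhs_nbhs. Qed.

Lemma pt_id (x0 : 'rV[R]_n) : pt i1 x0 (x0 ord0 i1) = x0.
Proof. by apply/rowP => j; rewrite mxE; case: eqP => // ->. Qed.

Lemma norm_pt (x0 : 'rV[R]_n) s t : `|pt i1 x0 s - pt i1 x0 t| <= `|s - t|.
Proof.
apply: norm_rV_le => // j; rewrite !mxE; case: eqP => // _.
by rewrite subrr normr0.
Qed.

Lemma near_pt (x0 : 'rV[R]_n) s (P : 'rV[R]_n -> Prop) : (\forall x \near pt i1 x0 s, P x) ->
  \forall t \near s, P (pt i1 x0 t).
Proof.
move=> /nearKP[K K0 KP]; apply/nearKP; exists K => // t tK; apply: KP.
by apply: le_lt_trans tK; rewrite ler_wpM2r ?norm_pt// ltW.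
Qed.

Lemma near_pt0 (x0 : 'rV[R]_n) (P : 'rV[R]_n -> Prop) : (\forall x \near x0, P x) ->
  \forall t \near x0 ord0 i1, P (pt i1 x0 t).
Proof. by rewrite -{1}(pt_id x0); exact: near_pt. Qed.

Lemma grad_pt_is_derive f (x0 : 'rV[R]_n) s g : grad f (pt i1 x0 s) g ->
  is_derive s 1 (fun t => f (pt i1 x0 t)) (g i1).
Proof.
move=> [K hK]; apply: quad_is_derive; exists `|K|.
have : \forall h \near (0 : R), `|f (pt i1 x0 (h *: 1 + s)) - f (pt i1 x0 s) -
   \sum_i g i * (pt i1 x0 (h *: 1 + s) ord0 i - pt i1 x0 s ord0 i)|
   <= K * `|pt i1 x0 (h *: 1 + s) - pt i1 x0 s| ^+ 2.
  exact: (near_line (1 : R) (near_pt hK)).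
apply: filterS => h H; apply: le_trans (_ : `|K| * `|h| ^+ 2 <= _); last by [].
have -> : g i1 * h = \sum_i g i * (pt i1 x0 (h *: 1 + s) ord0 i - pt i1 x0 s ord0 i).
  rewrite (bigD1 i1)//= big1 => [|j /negPf ji]; rewrite !mxE ?eqxx ?ji ?subrr ?mulr0//.
  by rewrite addr0 addrK [h *: 1]mulr1.
apply: (le_trans H); apply: (@le_trans _ _ (`|K| * `|pt i1 x0 (h *: 1 + s) - pt i1 x0 s| ^+ 2)).
  by rewrite ler_wpM2r ?exprn_ge0// ler_norm.
rewrite ler_wpM2l// lerXn2r ?nnegrE//; apply: (le_trans (norm_pt _ _ _)).
by rewrite addrK [h *: 1]mulr1.
Qed.

Lemma pd_on_line f (x0 : 'rV[R]_n) (a : R -> R) : AN f x0 ->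
  (\forall t \near x0 ord0 i1, f (pt i1 x0 t) = a t) ->
  \forall t \near x0 ord0 i1, pd i1 f (pt i1 x0 t) = derive1 a t.
Proof.
move=> fA fa; have := near1I (near_pt0 (AN_near fA)) (near_near1 fa).
apply: filterS => t [tA ta].
have [_ <-] := grad_pt_is_derive (AN_grad tA); rewrite derive1E.
by apply: near_eq_derive; rewrite ?oner_neq0.
Qed.

Lemma Dw_cst0 m (w : seq 'I_m) : Dw w (fun _ : 'rV[R]_m => 0 : R) = fun=> 0.
Proof.
elim: w => //= i w ->; apply/funext => x.
by rewrite (grad_pd i (grad_cst 0 x)).
Qed.

Lemma AN_neq0 m (g : 'rV[R]_m -> R) (x0 : 'rV[R]_m) : AN g x0 -> g x0 != 0 ->
  \forall x \near x0, g x != 0.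
Proof.
move=> gA g0; have [L L0 gL] := grad_lip (AN_grad gA).
have c0 : 0 < L / `|g x0| by rewrite divr_gt0// normr_gt0.
apply: nearS (nearI gL (near_normK x0 c0)) => x [xL].
rewrite mulrA ltr_pdivrMr ?normr_gt0// mul1r mulrC => xg.
apply/eqP => gx; move: (le_lt_trans xL xg).
by rewrite gx sub0r normrN ltxx.
Qed.

(** All Taylor coefficients of the restriction vanish: its value by assumption, the others because
    its derivative is zero near the point. *)
Lemma line_zero f (x0 : 'rV[R]_n) : AN f x0 -> f x0 = 0 -> (\forall x \near x0, pd i1 f x = 0) ->
  \forall t \near x0 ord0 i1, f (pt i1 x0 t) = 0.
Proof.
move=> fA f0 pf; set s0 := x0 ord0 i1.
pose v (y : 'rV[R]_1) := pt i1 x0 (y ord0 ord0).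
have v0 : v (const_mx s0) = x0 by rewrite /v mxE pt_id.
pose F := ev1 (fun t => f (pt i1 x0 t)).
have FA : AN F (const_mx s0).
  apply: (@AN_affine _ _ _ v (fun _ b => (b == i1)%:R) f); last by rewrite v0.
  move=> y b; have [->|bi] := eqVneq b i1.
    apply: eq_grad (grad_near _ (grad_coord ord0 y)) => [i|]; first by rewrite (ord1 i).
    by apply: nearA => z; rewrite mxE eqxx.
  apply: grad_near (grad_cst (x0 ord0 b) y).
  by apply: nearA => z; rewrite mxE (negPf bi).
have pF : \forall y \near (const_mx s0 : 'rV[R]_1), pd ord0 F y = (fun=> 0) y.
  have h : \forall t \near s0, AN f (pt i1 x0 t) /\ pd i1 f (pt i1 x0 t) = 0.
    exact: near_pt0 (nearI (AN_near fA) pf).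
  move/nearKP: h => [K K0 hK].
  apply: nearS (nearI (AN_near FA) (near_normK (const_mx s0) K0)) => y [yA yK].
  rewrite -(const_mx1 y) -AN_derive1 ?const_mx1// derive1E.
  have [|pA p0] := hK (y ord0 ord0).
    by move: yK; rewrite -{1}(const_mx1 y) -raddfB /= norm_const_mx1.
  by have [_ ->] := grad_pt_is_derive (AN_grad pA).
have Fz w : Dw w F (const_mx s0) = 0.
  case/lastP: w => [|w i]; first by rewrite /= /F /ev1 mxE pt_id.
  rewrite Dw_rcons (ord1 i) (nbhs_singleton (Dw_near w (AN_pd ord0 FA) pF)).
  by rewrite Dw_cst0.
by have := near_const_mx1 (AN_zero FA Fz); apply: filterS => t; rewrite /F /ev1 mxE.
Qed.

End Line.

(** * Uniqueness *)

Section Uniqueness.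
Variables (R : realType) (n : nat) (i1 : 'I_n) (x0 : 'rV[R]_n).
Implicit Types (f g u : 'rV[R]_n -> R).

(* Analytic germs at [x0] vanishing to order [m] in the variables other than
   the distinguished one. *)
Definition vanish (m : nat) f : Prop :=
  AN f x0 /\ forall w, (count (predC1 i1) w < m)%N -> Dw w f x0 = 0.

Lemma vanish_le m m' f : (m <= m')%N -> vanish m' f -> vanish m f.
Proof. by move=> mm [fA fv]; split=> // w wm; apply: fv; exact: leq_trans wm mm. Qed.

Lemma vanish_eq m f f' : (\forall x \near x0, f x = f' x) -> vanish m f -> vanish m f'.
Proof.
move=> ff' [fA fv]; split=> [|w wm]; first exact: AN_eq fA.
by rewrite -(nbhs_singleton (Dw_near w fA ff')) fv.
Qed.

Lemma vanish_mul m f g : vanish m f -> AN g x0 -> vanish m (fun x => f x * g x).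
Proof.
move=> [fA fv] gA; have [h hD] := AN_mul_Leibniz fA gA; split=> // w wm.
rewrite (nbhs_singleton hD) big_seq big1// => p /(splits_count (predC1 i1)) pw.
by rewrite fv ?mul0r// (leq_ltn_trans _ wm)// -pw leq_addr.
Qed.

Lemma vanish_sub m f g : vanish m f -> vanish m g -> vanish m (fun x => f x - g x).
Proof.
move=> [fA fv] [gA gv]; split=> [|w wm]; first exact: AN_sub.
by rewrite (nbhs_singleton (AN_sub_Dw fA gA)) fv// gv// subrr.
Qed.

Lemma vanish_add m f g : vanish m f -> vanish m g -> vanish m (fun x => f x + g x).
Proof.
move=> fv gv.
have gv' := vanish_mul gv (AN_cst (-1) x0).
apply: vanish_eq (vanish_sub fv gv'); apply: nearA => x; ring.
Qed.

(** Differentiating along the initial line costs no order of vanishing, whereas [vanish_pd] loses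
    one. The induction for uniqueness rests on this difference. *)
Lemma vanish_pd1 m f : vanish m f -> vanish m (pd i1 f).
Proof.
move=> [fA fv]; split=> [|w wm]; first exact: AN_pd.
by rewrite -Dw_rcons fv// -cats1 count_cat /= eqxx !addn0.
Qed.

Lemma vanish_pd m f i : vanish m.+1 f -> vanish m (pd i f).
Proof.
move=> [fA fv]; split=> [|w wm]; first exact: AN_pd.
rewrite -Dw_rcons fv// -cats1 count_cat /= addn0 ltnS.
by apply: leq_trans wm; rewrite -addn1 leq_add2l leq_b1.
Qed.

Lemma vanish_unit m f g : AN f x0 -> AN g x0 -> g x0 != 0 ->
  vanish m (fun x => f x * g x) -> vanish m f.
Proof.
move=> fA gA g0 fg; apply: vanish_eq (vanish_mul fg (AN_inv gA g0)).
by apply: nearS (AN_neq0 gA g0) => x gx; rewrite mulfK.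
Qed.

Lemma AN_line_Dw f l : AN f x0 -> (\forall t \near x0 ord0 i1, f (pt i1 x0 t) = 0) ->
  Dw (nseq l i1) f x0 = 0.
Proof.
move=> fA f0; elim: l f fA f0 => [|l IH] f fA f0.
  by have := nbhs_singleton f0; rewrite pt_id.
have -> : nseq l.+1 i1 = rcons (nseq l i1) i1.
  by rewrite -cats1 -[[:: i1]]/(nseq 1 i1) -nseqD addn1.
rewrite Dw_rcons; apply: IH; first exact: AN_pd.
by apply: filterS (pd_on_line fA f0) => t ->; rewrite derive1_cst.
Qed.

(** A word with fewer than two transverse letters is a pure derivative along the line, or becomes
    one of some [pd al f] after moving the transverse letter innermost. *)
Lemma vanish2_line f : AN f x0 -> (\forall t \near x0 ord0 i1, f (pt i1 x0 t) = 0) ->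
  (forall al, al != i1 -> \forall t \near x0 ord0 i1, pd al f (pt i1 x0 t) = 0) ->
  vanish 2 f.
Proof.
move=> fA f0 fa; split=> // w w2.
have all1 (u : seq 'I_n) : count (predC1 i1) u = 0%N -> u = nseq (size u) i1.
  by elim: u => //= i u IH; case: eqP => [-> /= /IH <-//|].
have [/all1->|c0] := eqVneq (count (predC1 i1) w) 0%N; first exact: AN_line_Dw.
have [a aw ai] : exists2 a, a \in w & predC1 i1 a by apply/hasP; rewrite has_count lt0n.
have pw := perm_to_rem aw; set u := rem a w in pw.
have pw' : perm_eq w (rcons u a) by rewrite perm_sym perm_rcons perm_sym.
rewrite (AN_sym fA pw') Dw_rcons.
have /all1-> : count (predC1 i1) u = 0%N.
  by move: w2; have /permP-> := pw; rewrite /= (ai : a != i1) add1n !ltnS leqn0 => /eqP.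
by apply: AN_line_Dw; [exact: AN_pd | exact: fa].
Qed.

Lemma sol_unique (u1 u2 : 'rV[R]_n -> R) (g : 'I_n -> 'I_n -> 'rV[R]_n -> R) :
  AN u1 x0 -> AN u2 x0 ->
  (forall al be, al != i1 -> be != i1 -> AN (g al be) x0) ->
  pd i1 (pd i1 u1) x0 != 0 ->
  (\forall x \near x0, forall al be, al != i1 -> be != i1 ->
     Delta i1 al be u1 x = g al be x * pd i1 (pd i1 u1) x /\
     Delta i1 al be u2 x = g al be x * pd i1 (pd i1 u2) x) ->
  (\forall t \near x0 ord0 i1, u1 (pt i1 x0 t) = u2 (pt i1 x0 t)) ->
  (forall al, al != i1 -> \forall t \near x0 ord0 i1,
     pd al u1 (pt i1 x0 t) = pd al u2 (pt i1 x0 t)) ->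
  \forall x \near x0, u1 x = u2 x.
Proof.
move=> A1 A2 gA u0 eqs d0 d1; pose w x := u1 x - u2 x.
have wA : AN w x0 by exact: AN_sub.
have wD : \forall x \near x0, forall v, Dw v w x = Dw v u1 x - Dw v u2 x.
  exact: AN_sub_Dw.
have v2 : vanish 2 w.
  apply: vanish2_line => // [|al ai].
    by apply: filterS d0 => t; rewrite /w => ->; rewrite subrr.
  have := near1I (d1 al ai) (near_pt0 i1 wD); apply: filterS => t [e /(_ [:: al]) /= ->].
  by rewrite e subrr.
(* Move two transverse letters [b], [a] of the word innermost, leaving [m] others. It suffices that
   [pd b (pd a w)] vanish to order [m + 1], one more than two transverse derivatives of [w] give by
   themselves. *)
have step m : vanish m.+2 w -> vanish m.+3 w.
  move=> wv; have [_ wv'] := wv; split=> // v; rewrite ltnS leq_eqVlt => /predU1P[vm|/wv'//].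
  have [a av ai] : exists2 a, a \in v & predC1 i1 a by apply/hasP; rewrite has_count vm.
  have pv := perm_to_rem av; set v' := rem a v in pv.
  have cv' : count (predC1 i1) v' = m.+1.
    by move: vm; have /permP-> := pv; rewrite /= (ai : a != i1) => -[].
  have [b bv bi] : exists2 b, b \in v' & predC1 i1 b by apply/hasP; rewrite has_count cv'.
  have pv' := perm_to_rem bv; set v'' := rem b v' in pv'.
  have cv'' : count (predC1 i1) v'' = m.
    by move: cv'; have /permP-> := pv'; rewrite /= (bi : b != i1) => -[].
  have pp : perm_eq v (rcons (rcons v'' b) a).
    rewrite perm_sym perm_rcons perm_sym; apply: (perm_trans pv); rewrite perm_cons.
    by rewrite perm_sym perm_rcons perm_sym.
  rewrite (AN_sym wA pp) !Dw_rcons.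
  suff [_ H] : vanish m.+1 (pd b (pd a w)) by apply: H; rewrite cv''.
  apply: (vanish_unit (g := pd i1 (pd i1 u1))) => //; do ?exact/AN_pd/AN_pd.
  have h1 : vanish m.+1 (pd i1 (pd a w)) by apply/vanish_pd1/vanish_pd.
  have h2 : vanish m.+1 (pd b (pd i1 w)) by apply/vanish_pd/vanish_pd1.
  have h3 : vanish m.+1 (pd i1 (pd i1 w)).
    exact: vanish_le (leqnSn m.+1) (vanish_pd1 (vanish_pd1 wv)).
  have B1 : AN (pd b (pd i1 u1)) x0 by exact/AN_pd/AN_pd.
  have B2 : AN (pd i1 (pd a u2)) x0 by exact/AN_pd/AN_pd.
  have B3 : AN (fun x => g b a x - pd b (pd a u2) x) x0.
    by apply: AN_sub; [exact: gA | exact/AN_pd/AN_pd].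
  (* The difference of the two equations writes [w_{ba}], times the unit [u1_11], through [w_{1a}],
     [w_{b1}] and [w_11]. Each contains at most one transverse derivative, hence vanishes to order
     [m + 1]. *)
  apply: vanish_eq (vanish_add (vanish_add (vanish_mul h1 B1) (vanish_mul h2 B2))
    (vanish_mul h3 B3)).
  apply: nearS (nearI wD eqs) => x [Dx /(_ b a bi ai)[]].
  have := Dx [:: b; a]; have := Dx [:: i1; a]; have := Dx [:: b; i1]; have := Dx [:: i1; i1].
  rewrite /Delta /= => -> -> -> ->.
  move: (pd i1 (pd i1 u1) x) (pd i1 (pd i1 u2) x) (pd b (pd i1 u1) x) (pd b (pd i1 u2) x)
    (pd i1 (pd a u1) x) (pd i1 (pd a u2) x) (pd b (pd a u1) x) (pd b (pd a u2) x) (g b a x).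
  move=> p1 p2 q1 q2 r1 r2 s1 s2 G e1 e2.
  have E1 : p1 * s1 = r1 * q1 + G * p1 by rewrite -e1; ring.
  have E2 : p2 * s2 = r2 * q2 + G * p2 by rewrite -e2; ring.
  have -> : (s1 - s2) * p1 = p1 * s1 - p2 * s2 - s2 * (p1 - p2) by ring.
  by rewrite E1 E2; ring.
have vall m : vanish m.+2 w by elim: m => // m; exact: step.
have : \forall x \near x0, w x = 0.
  apply: AN_zero => // v; have [_] := vall (count (predC1 i1) v); apply.
  by rewrite !ltnS leqnSn.
by apply: nearS => x /eqP; rewrite subr_eq0 => /eqP.
Qed.

End Uniqueness.

(** * Existence *)

Section Existence.
Variables (R : realType) (n : nat) (i1 : 'I_n).

Lemma pd_near (f f' : 'rV[R]_n -> R) x i : (\forall y \near x, f y = f' y) ->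
  pd i f x = pd i f' x.
Proof. by move=> ff'; exact: near_eq_derive. Qed.

Lemma poincare0 (h : 'I_n -> 'rV[R]_n -> R) x0 : (forall i, AN (h i) x0) ->
  (\forall x \near x0, forall i j, pd j (h i) x = pd i (h j) x) ->
  exists H, [/\ AN H x0, H x0 = 0 & \forall x \near x0, forall i, pd i H x = h i x].
Proof.
move=> hA hc; have [H HA Hh] := poincare hA hc.
exists (fun x => H x - H x0); split; [by apply: AN_sub HA (AN_cst _ _)|exact: subrr|].
apply: nearS (nearI (AN_near HA) Hh) => x [xA xh] i; rewrite -xh.
by rewrite (grad_pd i (gradB (AN_grad xA) (grad_cst (H x0) x))) subr0.
Qed.

Lemma pd_cst (c : R) (x : 'rV[R]_n) i : pd i (fun=> c) x = 0.
Proof. exact: grad_pd (grad_cst c x). Qed.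

(** Two integrations, with every component along [i1] set to [0]: first each row of [g] into [F al],
    then the [F al] into [G]. The second form is closed by the symmetry of [g], the first by the
    other two conditions. Normalising all potentials at [x0] gives zero Cauchy data on the line. *)
Lemma potential (g : 'I_n -> 'I_n -> 'rV[R]_n -> R) x0 :
  (forall al be, al != i1 -> be != i1 -> AN (g al be) x0) ->
  (\forall x \near x0, forall al be ga, al != i1 -> be != i1 -> ga != i1 ->
     [/\ g al be x = g be al x, pd i1 (g al be) x = 0 &
         pd ga (g al be) x = pd be (g al ga) x]) ->
  exists G, [/\ AN G x0,
    \forall x \near x0, pd i1 G x = 0,
    \forall x \near x0, forall al be, al != i1 -> be != i1 ->
      pd al (pd be G) x = g al be x /\ pd i1 (pd be G) x = 0 &
    \forall t \near x0 ord0 i1, G (pt i1 x0 t) = 0 /\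
      forall al, al != i1 -> pd al G (pt i1 x0 t) = 0].
Proof.
move=> gA gc.
pose h al j x : R := if j == i1 then 0 else g al j x.
have h1 al : h al i1 = fun=> 0 by apply/funext => x; rewrite /h eqxx.
have h2 al j : j != i1 -> h al j = g al j by move=> /negPf ji; apply/funext => x; rewrite /h ji.
have /choice[F FP] : forall al, exists H, al != i1 ->
    [/\ AN H x0, H x0 = 0 & \forall x \near x0, forall i, pd i H x = h al i x].
  move=> al; have [->|ai] := eqVneq al i1; first by exists (fun=> 0).
  suff [H HP] : exists H, [/\ AN H x0, H x0 = 0 &
      \forall x \near x0, forall i, pd i H x = h al i x] by exists H.
  apply: poincare0.
    move=> i; have [->|ii] := eqVneq i i1; first by rewrite h1; exact: AN_cst.
    by rewrite h2//; exact: gA.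
  apply: nearS gc => x xc i j.
  have [->|ii] := eqVneq i i1; have [->|ji] := eqVneq j i1 => //.
  - by rewrite h1 h2// pd_cst; have [_ ->] := xc al j j ai ji ji.
  - by rewrite h1 h2// pd_cst; have [_ ->] := xc al i i ai ii ii.
  - by rewrite !h2//; have [_ _ ->] := xc al i j ai ii ji.
have FD : \forall x \near x0, forall al, al != i1 -> forall i, pd i (F al) x = h al i x.
  apply: near_forall => al; have [->|ai] := eqVneq al i1; first by apply: nearA.
  by have [_ _] := FP al ai; apply: nearS => x xF _ i; rewrite xF.
pose k j x : R := if j == i1 then 0 else F j x.
have k1 : k i1 = fun=> 0 by apply/funext => x; rewrite /k eqxx.
have k2 j : j != i1 -> k j = F j by move=> /negPf ji; apply/funext => x; rewrite /k ji.
have [G [GA G0 GD]] : exists G, [/\ AN G x0, G x0 = 0 &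
    \forall x \near x0, forall i, pd i G x = k i x].
  apply: poincare0.
    move=> i; have [->|ii] := eqVneq i i1; first by rewrite k1; exact: AN_cst.
    by rewrite k2//; have [] := FP i ii.
  apply: nearS (nearI gc FD) => x [xc xF] i j.
  have [->|ii] := eqVneq i i1; have [->|ji] := eqVneq j i1 => //.
  - by rewrite k1 k2// pd_cst xF// h1.
  - by rewrite k1 k2// pd_cst xF// h1.
  - by rewrite !k2// !xF// !h2//; have [-> _] := xc i j i ii ji ii.
have G1 : \forall x \near x0, pd i1 G x = 0.
  by apply: nearS GD => x ->; rewrite k1.
have G2 : \forall x \near x0, forall al be, al != i1 -> be != i1 ->
      pd al (pd be G) x = g al be x /\ pd i1 (pd be G) x = 0.
  apply: nearS (nearI (nearI gc FD) (near_near GD)) => x [[xc xF] xG] al be ai bi.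
  have e i : pd i (pd be G) x = h be i x.
    by rewrite -xF// -k2//; apply: pd_near; apply: nearS xG => y ->.
  by rewrite !e h1 h2//; have [-> _] := xc be al al bi ai ai.
exists G; split=> //.
have l1 : \forall t \near x0 ord0 i1, G (pt i1 x0 t) = 0 by exact: line_zero.
have l2 al : \forall t \near x0 ord0 i1, al != i1 -> pd al G (pt i1 x0 t) = 0.
  have [->|ai] := eqVneq al i1; first by apply/nearKP; exists 1.
  have : \forall t \near x0 ord0 i1, pd al G (pt i1 x0 t) = 0.
    apply: line_zero; first exact: AN_pd.
      by rewrite (nbhs_singleton GD) k2//; have [] := FP al ai.
    by apply: nearS G2 => x xG; have [] := xG al al ai ai.
  by apply: filterS => t ->.
exact: near1I l1 (near1_forall l2).
Qed.

Lemma near_AN_comp (s : 'rV[R]_n -> R) x0 (P : R -> Prop) : AN s x0 ->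
  (\forall t \near s x0, P t) -> \forall x \near x0, P (s x).
Proof.
move=> sA /nearKP[K K0 KP]; have [L L0 sL] := grad_lip (AN_grad sA).
apply: nearS (nearI sL (near_normK x0 (mulr_gt0 L0 K0))) => x [xL xK]; apply: KP.
by apply: le_lt_trans xK; rewrite mulrA [`|x - x0| * L]mulrC ler_wpM2r// ltW.
Qed.

(* [u - G] is the envelope of the family of affine functions
   [a s + \sum_i A i s * (x_i - x0_i) - a' s * (s - s0)], where [A i1 = a'] and
   [A al = aa al]; [s] is constant along the characteristics. *)
Lemma sol_exists (g : 'I_n -> 'I_n -> 'rV[R]_n -> R) (x0 : 'rV[R]_n) (G : 'rV[R]_n -> R)
    (a : R -> R) (aa : 'I_n -> R -> R) (V : set R) :
  open V -> V (derive1 (derive1 a) (x0 ord0 i1)) ->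
  derive1 (derive1 a) (x0 ord0 i1) != 0 ->
  AN (ev1 a) (const_mx (x0 ord0 i1)) ->
  (forall al, al != i1 -> AN (ev1 (aa al)) (const_mx (x0 ord0 i1))) ->
  AN G x0 ->
  (\forall x \near x0, pd i1 G x = 0) ->
  (\forall x \near x0, forall al be, al != i1 -> be != i1 ->
      pd al (pd be G) x = g al be x /\ pd i1 (pd be G) x = 0) ->
  (\forall t \near x0 ord0 i1, G (pt i1 x0 t) = 0 /\
      forall al, al != i1 -> pd al G (pt i1 x0 t) = 0) ->
  exists u, [/\ AN u x0,
    \forall x \near x0, V (pd i1 (pd i1 u) x) /\ forall al be, al != i1 -> be != i1 ->
       Delta i1 al be u x = g al be x * pd i1 (pd i1 u) x &
    \forall t \near x0 ord0 i1, u (pt i1 x0 t) = a t /\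
      forall al, al != i1 -> pd al u (pt i1 x0 t) = aa al t].
Proof.
move=> oV Va a0 aA aaA GA G1 G2 Gl; set s0 := x0 ord0 i1 in Va a0 aA aaA Gl *.
pose b1 := derive1 a; pose b2 := derive1 b1.
have b1A : AN (ev1 b1) (const_mx s0) by exact: AN_ev1_derive1.
have b2A : AN (ev1 b2) (const_mx s0) by exact: AN_ev1_derive1.
pose A i := if i == i1 then b1 else aa i.
have A1 : A i1 = b1 by rewrite /A eqxx.
have A2 i : i != i1 -> A i = aa i by rewrite /A => /negPf->.
have AA i : AN (ev1 (A i)) (const_mx s0).
  by rewrite /A; case: eqVneq => // ii; exact: aaA.
(* Stationarity in [s] of the affine family reads [\sum_i A i' (x^i - x0^i) = a'' (s - s0)];
   dividing by [a''] gives the [phi i]. *)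
pose phi i t := derive1 (A i) t / b2 t.
have pA i : AN (ev1 (phi i)) (const_mx s0).
  have e : ev1 b2 (const_mx s0) != 0 by rewrite /ev1 mxE.
  exact: AN_mul (AN_ev1_derive1 (AA i)) (AN_inv b2A e).
have phi1 t : b2 t != 0 -> phi i1 t = 1 by rewrite /phi A1; exact: divff.
have [s [sx0 sA sP]] := implicit x0 pA.
have good : \forall t \near s0, [/\ AN (ev1 a) (const_mx t), AN (ev1 b1) (const_mx t),
    forall i, AN (ev1 (A i)) (const_mx t) & b2 t != 0].
  have c1 : \forall t \near s0, forall i, AN (ev1 (A i)) (const_mx t).
    by apply: near1_forall => i; exact: AN_ev1_near.
  have c2 : \forall t \near s0, b2 t != 0.
    have : ev1 b2 (const_mx s0) != 0 by rewrite /ev1 mxE.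
    move=> /(AN_neq0 b2A)/near_const_mx1; apply: filterS => t.
    by rewrite /ev1 mxE.
  have := near1I (near1I (AN_ev1_near aA) (AN_ev1_near b1A)) (near1I c1 c2).
  by apply: filterS => t [[? ?] [? ?]].
pose sig i x := phi i (s x) / (1 - \sum_j derive1 (phi j) (s x) * (x ord0 j - x0 ord0 j)).
have gs : \forall x \near x0,
    [/\ s x - s0 = \sum_i phi i (s x) * (x ord0 i - x0 ord0 i),
        grad s x (fun i => sig i x) & [/\ AN (ev1 a) (const_mx (s x)),
        AN (ev1 b1) (const_mx (s x)), forall i, AN (ev1 (A i)) (const_mx (s x)) & b2 (s x) != 0]].
  rewrite -sx0 in good *.
  by apply: nearS (nearI sP (near_AN_comp sA good)) => x [[e1 e2] e3]; split=> //; rewrite -e1 sx0.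
pose u y := G y + a (s y) + \sum_j A j (s y) * (y ord0 j - x0 ord0 j) - b1 (s y) * (s y - s0).
have comp c : AN (ev1 c) (const_mx s0) -> AN (fun x => c (s x)) x0.
  by move=> cA; apply: AN_comp1 sA _; rewrite sx0.
have uA : AN u x0.
  apply: AN_sub; last first.
    by apply: AN_mul; [exact: comp | apply: AN_sub sA (AN_cst _ _)].
  apply: AN_add; first by apply: AN_add => //; exact: comp.
  apply: AN_sum => j; apply: AN_mul; first exact: comp.
  by apply: AN_sub; [exact: AN_coord | exact: AN_cst].
(* By stationarity the terms carrying the derivative of [s] cancel, so the gradient of [u - G]
   depends on [s] alone. *)
have uD : \forall x \near x0, forall i, pd i u x = pd i G x + A i (s x).
  apply: nearS (nearI (AN_near GA) gs) => x [xG [e1 gx [xa xb xA b20]]] i.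
  have g1 := grad_comp1 gx xa.
  have g2 j := gradM (grad_comp1 gx (xA j)) (gradB (grad_coord j x) (grad_cst (x0 ord0 j) x)).
  have g3 := gradM (grad_comp1 gx xb) (gradB gx (grad_cst s0 x)).
  rewrite (grad_pd i (gradB (gradD (gradD (AN_grad xG) g1) (grad_sum (index_enum _) g2)) g3)).
  have -> : \sum_j (derive1 (A j) (s x) * sig i x * (x ord0 j - x0 ord0 j) +
      A j (s x) * ((i == j)%:R - 0)) = sig i x * (b2 (s x) * (s x - s0)) + A i (s x).
    rewrite big_split /=; congr (_ + _).
      rewrite e1 !mulr_sumr; apply: eq_bigr => j _; rewrite /phi; field.
      by [].
    rewrite (bigD1 i)//= eqxx big1 => [|j /negPf ji].
      by rewrite subr0 mulr1 addr0.
    by rewrite eq_sym ji subr0 mulr0.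
  by rewrite -/b1 -/b2; ring.
have uDD : \forall x \near x0, forall i j,
    pd j (pd i u) x = pd j (pd i G) x + derive1 (A i) (s x) * sig j x.
  apply: nearS (nearI (nearI (near_near uD) (AN_near GA)) gs).
  move=> x [[xu xG] [e1 gx [xa xb xA b20]]] i j.
  rewrite (pd_near j (f' := fun y => pd i G y + A i (s y))).
    exact: (grad_pd j (gradD (AN_grad (AN_pd i xG)) (grad_comp1 gx (xA i)))).
  by apply: nearS xu => y ->.
have G1' : \forall x \near x0, forall j, pd j (pd i1 G) x = 0.
  apply: nearS (near_near G1) => x xG j; rewrite (pd_near j (f' := fun=> 0))//.
  exact: pd_cst.
have u11 : pd i1 (pd i1 u) x0 = b2 s0.
  rewrite (nbhs_singleton uDD) (nbhs_singleton G1') A1 add0r sx0 -/b2 /sig big1 => [|j _].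
    by rewrite subr0 divr1 sx0 /phi A1 -/b2 divff// mulr1.
  by rewrite subrr mulr0.
exists u; split; first exact: uA.
- have VP : \forall x \near x0, V (pd i1 (pd i1 u) x).
    apply: near_AN_comp; first exact/AN_pd/AN_pd.
    by rewrite u11; exact: (near_open1 oV Va).
  apply: nearS (nearI (nearI VP uDD) (nearI G1' G2)).
  move=> x [[xV xu] [xG xG2]]; split=> [|al be ai bi]; first exact: xV.
  (* The Hessian of [u - G] is the product of [A i'] and the gradient of [s]; its minors vanish, and
     only the cross term of [b2 * sig i1] with [g] remains. *)
  rewrite /Delta (xu i1 i1) (xu be al) (xu be i1) (xu i1 al) (xG i1) (xG al) A1 -/b2.
  have [-> ->] := xG2 al be ai bi.
  move: (b2 (s x)) (derive1 (A be) (s x)) (g al be x) (sig i1 x) (sig al x).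
  by move=> p q r p' q'; ring.
- have := near1I (near1I Gl (near_pt0 i1 gs)) (near_pt0 i1 uD).
  apply: filterS => t [[[G0 Ga] [e1 _ [_ _ _ b20]]] Du].
  (* On the initial line only the index [i1] survives in the implicit equation, and [phi i1 = 1], so
     the parameter is the coordinate itself. *)
  have st : s (pt i1 x0 t) = t.
    move: e1; rewrite (bigD1 i1 isT) /= big1; last first.
      by move=> j /negPf ji; rewrite mxE ji subrr mulr0.
    rewrite mxE eqxx addr0 (phi1 _ b20) mul1r -/s0.
    by move: (s (pt i1 x0 t)) => s' /(congr1 (+%R s0)); rewrite !(addrC s0) !subrK.
  split; last first.
    by move=> al ai; rewrite Du (Ga al ai) add0r st (A2 al ai).
  rewrite /u st G0 add0r (bigD1 i1 isT) /= big1; last first.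
    by move=> j /negPf ji; rewrite mxE ji subrr mulr0.
  rewrite A1 mxE eqxx addr0 -/s0.
  by rewrite addrK.
Qed.

End Existence.

(** * From the normal form of [f] to the local Cauchy problem *)

Section Sufficiency.
Variables (R : realType) (n : nat) (i1 : 'I_n).
Variables (U : set 'rV[R]_n) (V : set R) (f : 'I_n -> 'I_n -> 'rV[R]_n -> R -> R).
Hypotheses (oU : open U) (oV : open V) (V0 : V `<=` [set t | t != 0]).
Hypothesis fA : forall al be, al != i1 -> be != i1 -> analytic_on2 (f al be) U V.

Lemma AN_slice al be x t : al != i1 -> be != i1 -> U x -> V t ->
  AN (fun z : 'rV[R]_(n + 1) => f al be (lsubmx z) (rsubmx z ord0 ord0))
     (row_mx x (const_mx t)).
Proof.
move=> ai bi Ux Vt; apply: analytic_AN; apply: fA => //=.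
by rewrite row_mxKl row_mxKr mxE.
Qed.

(** Condition (ii) does not state that [g] is analytic; this is recovered from [f] by freezing a
    nonzero [t] in [V] and dividing by it. *)
Lemma AN_coeff g al be x t : al != i1 -> be != i1 ->
  (forall x t, U x -> V t -> f al be x t = g x * t) -> U x -> V t -> AN g x.
Proof.
move=> ai bi fg Ux Vt.
pose v (y : 'rV[R]_n) : 'rV[R]_(n + 1) := row_mx y (const_mx t).
have h : AN (fun y => f al be y t * t^-1) x.
  apply: AN_mul (AN_cst _ _).
  apply: AN_ext (@AN_affine _ _ _ v (fun i b => (lshift 1 i == b)%:R) _ x _ (AN_slice ai bi Ux Vt)).
    by move=> y; rewrite row_mxKl row_mxKr mxE.
  move=> y b; case: (split_ordP b) => j ->.
    apply: eq_grad (grad_near _ (grad_coord j y)) => [i|].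
      by rewrite (inj_eq (@lshift_inj _ _)).
    by apply: nearA => z; rewrite row_mxEl.
  apply: eq_grad (grad_near _ (grad_cst t y)) => [i|].
    by rewrite eq_lrshift.
  by apply: nearA => z; rewrite row_mxEr mxE.
apply: AN_eq h; apply: nearS (near_open oU Ux) => y Uy.
by rewrite fg// mulfK//; exact: V0.
Qed.

Lemma analytic_on1_AN (a : R -> R) (I : set R) s : analytic_on1 a I -> I s ->
  AN (ev1 a) (const_mx s).
Proof. by move=> aI Is; apply: analytic_AN; apply: aI; rewrite /= mxE. Qed.

Lemma solves_AN x0 a aa I W u : solves i1 U V f x0 a aa I W u -> AN u x0.
Proof. by move=> [[_ Wx] _ uA _ _]; exact/analytic_AN/uA. Qed.

Lemma compat_wellposed (g : 'I_n -> 'I_n -> 'rV[R]_n -> R) :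
  (forall al be, al != i1 -> be != i1 ->
     forall x t, U x -> V t -> f al be x t = g al be x * t) ->
  (forall al be ga, al != i1 -> be != i1 -> ga != i1 -> forall x, U x ->
     [/\ g al be x = g be al x, pd i1 (g al be) x = 0 &
         pd ga (g al be) x = pd be (g al ga) x]) ->
  forall x0, U x0 -> forall (a : R -> R) (aa : 'I_n -> R -> R) (I : set R),
    open I -> I (x0 ord0 i1) -> analytic_on1 a I ->
    (forall al, al != i1 -> analytic_on1 (aa al) I) ->
    V (derive1 (derive1 a) (x0 ord0 i1)) ->
    (exists W u, solves i1 U V f x0 a aa I W u) /\
    (forall W1 u1 W2 u2, solves i1 U V f x0 a aa I W1 u1 ->
       solves i1 U V f x0 a aa I W2 u2 -> \forall x \near x0, u1 x = u2 x).
Proof.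
move=> fg gc x0 Ux0 a aa I oI Is aA aaA Va.
have gA al be : al != i1 -> be != i1 -> AN (g al be) x0.
  by move=> ai bi; exact: AN_coeff (fg al be ai bi) Ux0 Va.
have nU := near_open oU Ux0.
split; last first.
  move=> W1 u1 W2 u2 S1 S2; have A1 := solves_AN S1; have A2 := solves_AN S2.
  move: S1 S2 => [[oW1 W1x] W1U _ e1 d1] [[oW2 W2x] W2U _ e2 d2].
  have nW1 := near_open oW1 W1x; have nW2 := near_open oW2 W2x.
  have lin : \forall t \near x0 ord0 i1, I t /\ W1 (pt i1 x0 t) /\ W2 (pt i1 x0 t).
    exact: near1I (near_open1 oI Is) (near1I (near_pt0 i1 nW1) (near_pt0 i1 nW2)).
  apply: (sol_unique A1 A2 gA).
  - by apply: V0; have [] := e1 _ W1x.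
  - apply: nearS (nearI nW1 nW2) => x [x1 x2] al be ai bi.
    have [v1 /(_ al be ai bi)->] := e1 _ x1; have [v2 /(_ al be ai bi)->] := e2 _ x2.
    exact: conj (fg al be ai bi _ _ (W1U _ x1) v1) (fg al be ai bi _ _ (W1U _ x1) v2).
  - apply: filterS lin => t [It [t1 t2]].
    by have [-> _] := d1 t It t1; have [-> _] := d2 t It t2.
  - move=> al ai; apply: filterS lin => t [It [t1 t2]].
    by have [_ ->//] := d1 t It t1; have [_ ->] := d2 t It t2.
have [G [GA G1 G2 Gl]] : exists G, [/\ AN G x0, \forall x \near x0, pd i1 G x = 0,
    \forall x \near x0, forall al be, al != i1 -> be != i1 ->
      pd al (pd be G) x = g al be x /\ pd i1 (pd be G) x = 0 &
    \forall t \near x0 ord0 i1, G (pt i1 x0 t) = 0 /\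
      forall al, al != i1 -> pd al G (pt i1 x0 t) = 0].
  by apply: potential => //; apply: nearS nU => x Ux al be ga ai bi ci; exact: gc.
have [u [uA uE uI]] := sol_exists oV Va (V0 Va) (analytic_on1_AN aA Is)
  (fun al ai => analytic_on1_AN (aaA al ai) Is) GA G1 G2 Gl.
have /nearKP[K1 K10 h1] := nearI (nearI nU (AN_near uA)) uE.
have /nearKP[K2 K20 h2] := uI.
have K0 : 0 < K1 + K2 by rewrite addr_gt0.
pose W := [set x : 'rV[R]_n | `|x - x0| * (K1 + K2) < 1].
have WK x : W x -> `|x - x0| * K1 < 1 /\ `|x - x0| * K2 < 1.
  rewrite /W /= mulrDr => h; split; apply: le_lt_trans h; rewrite ?lerDl ?lerDr mulr_ge0// ltW//.
exists W, u; split.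
- split; last by rewrite /W /= subrr normr0 mul0r.
  rewrite openE => x Wx; suff : \forall y \near x, W y by [].
  exact: (near_nearK K0 Wx).
- by move=> x /WK[/h1[[]]].
- by move=> x /WK[/h1[[_ xA] _] _]; exact: AN_analytic.
- move=> x /WK[/h1[[Ux _] [Vx e]] _]; split=> // al be ai bi.
  by rewrite e// fg.
- move=> t It /WK[_ tK]; apply: h2; apply: le_lt_trans tK; rewrite ler_wpM2r ?(ltW K20)//.
  by have := coord_le_norm (pt i1 x0 t - x0) i1; rewrite !mxE eqxx.
Qed.

End Sufficiency.

(** * Necessity of the compatibility conditions *)

Section Necessity.
Variables (R : realType) (n : nat) (i1 : 'I_n).
Variables (U : set 'rV[R]_n) (V : set R) (f : 'I_n -> 'I_n -> 'rV[R]_n -> R -> R).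
Hypothesis V0 : V `<=` [set t | t != 0].
Hypothesis fA : forall al be, al != i1 -> be != i1 -> analytic_on2 (f al be) U V.

(** The polynomial with 2-jet [(c0, c1, c2)] at [s0]. Data of this shape already give free values to
    all derivatives needed for necessity. *)
Definition quad (s0 c0 c1 c2 s : R) : R := c0 + c1 * (s - s0) + c2 / 2 * ((s - s0) * (s - s0)).

Lemma derive1_quad s0 c0 c1 c2 : derive1 (quad s0 c0 c1 c2) = quad s0 c1 c2 0.
Proof.
apply/funext => s.
have [_ e] : is_derive s 1 (quad s0 c0 c1 c2) (quad s0 c1 c2 0 s).
  apply: quad_is_derive; exists `|c2 / 2|; apply/nearKP; exists 1 => // h _.
  rewrite -normrX -normrM le_eqVlt; apply/orP; left; apply/eqP; congr `|_|.
  by rewrite [h *: 1]mulr1 /quad; field.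
by rewrite derive1E e.
Qed.

Lemma quad_center s0 c0 c1 c2 : quad s0 c0 c1 c2 s0 = c0.
Proof. by rewrite /quad subrr !mulr0 !addr0. Qed.

Lemma analytic_quad s0 c0 c1 c2 : analytic_on1 (quad s0 c0 c1 c2) setT.
Proof.
move=> y _; apply: AN_analytic.
have cA : AN (fun y : 'rV[R]_1 => y ord0 ord0 - s0) y.
  by apply: AN_sub; [exact: AN_coord | exact: AN_cst].
apply: AN_add; first apply: AN_add; first exact: AN_cst.
  by apply: AN_mul => //; exact: AN_cst.
by apply: AN_mul; [exact: AN_cst | exact: AN_mul].
Qed.

Definition slice al be (z : 'rV[R]_(n + 1)) : R := f al be (lsubmx z) (rsubmx z ord0 ord0).

Definition fx al be x t j : R := pd (lshift 1 j) (slice al be) (row_mx x (const_mx t)).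
Definition ft al be x t : R := pd (rshift n ord0) (slice al be) (row_mx x (const_mx t)).

Lemma grad_slice al be x t : al != i1 -> be != i1 -> U x -> V t ->
  grad (slice al be) (row_mx x (const_mx t))
    (fun b => pd b (slice al be) (row_mx x (const_mx t))).
Proof. by move=> ai bi Ux Vt; apply: AN_grad; exact: (AN_slice fA). Qed.

Lemma grad_subst al be x (h : 'rV[R]_n -> R) dh : al != i1 -> be != i1 -> U x -> V (h x) ->
  grad h x dh ->
  grad (fun y => f al be y (h y)) x
    (fun i => fx al be x (h x) i + dh i * ft al be x (h x)).
Proof.
move=> ai bi Ux Vh hg; pose v (y : 'rV[R]_n) : 'rV[R]_(n + 1) := row_mx y (const_mx (h y)).
pose dv (i : 'I_n) (b : 'I_(n + 1)) : R :=
  match fintype.split b with inl j => (i == j)%:R | inr _ => dh i end.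
have gv b : grad (fun y => v y ord0 b) x (dv^~ b).
  rewrite /dv; case: (split_ordP b) => j ->.
    by apply: grad_near (grad_coord j x); apply: nearA => y; rewrite row_mxEl.
  by apply: grad_near hg; apply: nearA => y; rewrite row_mxEr mxE.
apply: eq_grad (grad_near _ (grad_comp gv (grad_slice ai bi Ux Vh))) => [i|]; last first.
  by apply: nearA => y; rewrite /slice row_mxKl row_mxKr mxE.
rewrite big_split_ord /= big_ord1 (bigD1 i isT) /= big1 => [|j ji].
  by rewrite /dv !(unsplitK (inl _)) !(unsplitK (inr _)) eqxx mul1r addr0.
by rewrite /dv (unsplitK (inl _)) eq_sym (negPf ji) mul0r.
Qed.

Hypothesis solvable : forall x0, U x0 ->
  forall (a : R -> R) (aa : 'I_n -> R -> R) (I : set R),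
    open I -> I (x0 ord0 i1) -> analytic_on1 a I ->
    (forall al, al != i1 -> analytic_on1 (aa al) I) ->
    V (derive1 (derive1 a) (x0 ord0 i1)) ->
    exists W u, solves i1 U V f x0 a aa I W u.

Lemma quad_solution x0 t (p r : 'I_n -> R) : U x0 -> V t -> exists u,
  [/\ AN u x0,
    \forall x \near x0, forall al be, al != i1 -> be != i1 ->
      Delta i1 al be u x = f al be x (pd i1 (pd i1 u) x),
    Dw [:: i1; i1] u x0 = t, Dw [:: i1; i1; i1] u x0 = 0 &
    forall al, al != i1 -> Dw [:: i1; al] u x0 = p al /\ Dw [:: i1; i1; al] u x0 = r al].
Proof.
move=> Ux Vt; set s0 := x0 ord0 i1.
(* Quadratic data make [u_11 = t] and [u_111 = 0] at the point, and leave [u_{1 al} = p al] and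
   [u_{11 al} = r al] free. *)
have [|||W [u [[oW Wx] _ uA ue ud]]] := solvable Ux (a := quad s0 0 0 t)
  (aa := fun al => quad s0 0 (p al) (r al)) (I := setT) openT I.
- exact: analytic_quad.
- by move=> al _; exact: analytic_quad.
- by rewrite !derive1_quad quad_center.
have {}uA : AN u x0 by exact/analytic_AN/uA.
have nW := near_open oW Wx.
have c0 : \forall s \near s0, u (pt i1 x0 s) = quad s0 0 0 t s.
  by apply: filterS (near_pt0 i1 nW) => s sW; have [] := ud s I sW.
have c1 := pd_on_line uA c0.
have c2 := pd_on_line (AN_pd i1 uA) c1.
have c3 := pd_on_line (AN_pd i1 (AN_pd i1 uA)) c2.
exists u; split=> //.
- by apply: nearS nW => x Wx' al be ai bi; have [_ ->] := ue x Wx'.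
- by have := nbhs_singleton c2; rewrite pt_id !derive1_quad quad_center.
- by have := nbhs_singleton c3; rewrite pt_id !derive1_quad quad_center.
move=> al ai.
have d0 : \forall s \near s0, pd al u (pt i1 x0 s) = quad s0 0 (p al) (r al) s.
  by apply: filterS (near_pt0 i1 nW) => s sW; have [_ ->] := ud s I sW.
have d1 := pd_on_line (AN_pd al uA) d0.
have d2 := pd_on_line (AN_pd i1 (AN_pd al uA)) d1.
split.
- by have := nbhs_singleton d1; rewrite pt_id !derive1_quad quad_center.
- by have := nbhs_singleton d2; rewrite pt_id !derive1_quad quad_center.
Qed.

Lemma diff_equation x0 t (u : 'rV[R]_n -> R) al be ga : al != i1 -> be != i1 ->
  U x0 -> V t -> AN u x0 ->
  (\forall x \near x0, Delta i1 al be u x = f al be x (pd i1 (pd i1 u) x)) ->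
  Dw [:: i1; i1] u x0 = t ->
  Dw [:: ga; i1; i1] u x0 * Dw [:: al; be] u x0 + t * Dw [:: ga; al; be] u x0 -
  (Dw [:: ga; i1; be] u x0 * Dw [:: al; i1] u x0 + Dw [:: i1; be] u x0 * Dw [:: ga; al; i1] u x0)
  = fx al be x0 t ga + Dw [:: ga; i1; i1] u x0 * ft al be x0 t.
Proof.
move=> ai bi Ux Vt uA ue ut.
have g2 a b : grad (Dw [:: a; b] u) x0 (fun c => Dw [:: c; a; b] u x0).
  exact: (nbhs_singleton (AN_nearD uA)).
have gL := gradB (gradM (g2 i1 i1) (g2 al be)) (gradM (g2 i1 be) (g2 al i1)).
have Vu : V (Dw [:: i1; i1] u x0) by rewrite ut.
have gR := grad_subst ai bi Ux Vu (g2 i1 i1).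
have := grad_pd ga (grad_near ue gL); rewrite (grad_pd ga gR) ut => ->.
by [].
Qed.

Lemma Delta_center x0 t (u : 'rV[R]_n -> R) al be : Dw [:: i1; i1] u x0 = t ->
  Delta i1 al be u x0 = f al be x0 (pd i1 (pd i1 u) x0) ->
  t * Dw [:: al; be] u x0 - Dw [:: i1; be] u x0 * Dw [:: al; i1] u x0 = f al be x0 t.
Proof. by move=> <-. Qed.

(** Subtract the [be]-derivative of equation [(al, ga)] from the [ga]-derivative of equation
    [(al, be)]: both contain [t u_{al be ga}] and [u_{1 be ga} p al], which cancel. The remaining
    unknowns are fixed by the equations themselves and by their [x^1]-derivatives. *)
Lemma third_order x0 t (p r : 'I_n -> R) al be ga : al != i1 -> be != i1 -> ga != i1 ->
  U x0 -> V t -> exists dab dac mab mac : R,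
  [/\ t * dab = p al * p be + f al be x0 t, t * dac = p al * p ga + f al ga x0 t,
      t * mab = r be * p al + p be * r al + fx al be x0 t i1,
      t * mac = r ga * p al + p ga * r al + fx al ga x0 t i1 &
      r ga * dab - r be * dac - (p be * mac - p ga * mab) =
      fx al be x0 t ga - fx al ga x0 t be + r ga * ft al be x0 t - r be * ft al ga x0 t].
Proof.
move=> ai bi ci Ux Vt; have [u [uA ue ut uq ud]] := quad_solution p r Ux Vt.
have [pa ra] := ud al ai; have [pb rb] := ud be bi; have [pc rc] := ud ga ci.
have sym w w' : perm_eq w w' -> Dw w u x0 = Dw w' u x0 by exact: AN_sym.
have ux al' be' : al' != i1 -> be' != i1 ->
    t * Dw [:: al'; be'] u x0 - Dw [:: i1; be'] u x0 * Dw [:: al'; i1] u x0 = f al' be' x0 t.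
  by move=> ai' bi'; exact: Delta_center ut (nbhs_singleton ue al' be' ai' bi').
have ue' al' be' : al' != i1 -> be' != i1 ->
    \forall x \near x0, Delta i1 al' be' u x = f al' be' x (pd i1 (pd i1 u) x).
  by move=> ai' bi'; apply: nearS ue => x; exact.
have p2 (a b : 'I_n) : perm_eq [:: a; b] [:: b; a] by rewrite (perm_catC [:: a] [:: b]).
have p213 (a b c : 'I_n) : perm_eq [:: a; b; c] [:: b; a; c].
  by rewrite (perm_cat2r [:: c] [:: a; b] [:: b; a]).
have p132 (a b c : 'I_n) : perm_eq [:: a; b; c] [:: a; c; b] by rewrite perm_cons.
have s1 a : Dw [:: a; i1] u x0 = Dw [:: i1; a] u x0 by exact: sym.
have s2 a : Dw [:: a; i1; i1] u x0 = Dw [:: i1; i1; a] u x0.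
  by rewrite (sym _ _ (p213 _ _ _)) (sym _ _ (p132 _ _ _)).
have s3 a b : Dw [:: a; i1; b] u x0 = Dw [:: i1; a; b] u x0 by exact: sym.
have s4 a b : Dw [:: a; b; i1] u x0 = Dw [:: i1; a; b] u x0.
  by rewrite (sym _ _ (p132 _ _ _)) s3.
have s5 a b : Dw [:: i1; a; b] u x0 = Dw [:: i1; b; a] u x0 by exact: sym.
have s6 : Dw [:: ga; al; be] u x0 = Dw [:: be; al; ga] u x0.
  by rewrite (sym _ _ (p132 _ _ _)) (sym _ _ (p213 _ _ _)) (sym _ _ (p132 _ _ _)).
exists (Dw [:: al; be] u x0), (Dw [:: al; ga] u x0),
  (Dw [:: i1; al; be] u x0), (Dw [:: i1; al; ga] u x0).
have E1 := diff_equation i1 ai bi Ux Vt uA (ue' _ _ ai bi) ut.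
have E2 := diff_equation i1 ai ci Ux Vt uA (ue' _ _ ai ci) ut.
have E3 := diff_equation ga ai bi Ux Vt uA (ue' _ _ ai bi) ut.
have E4 := diff_equation be ai ci Ux Vt uA (ue' _ _ ai ci) ut.
have F1 := ux _ _ ai bi; have F2 := ux _ _ ai ci.
rewrite uq (s4 i1 al) (s1 al) rb ra pa pb in E1.
rewrite uq (s4 i1 al) (s1 al) rc ra pa pc in E2.
rewrite (s2 ga) s6 (s3 ga be) (s1 al) (s4 ga al) (s5 ga al) rc pa pb in E3.
rewrite (s2 be) (s3 be ga) (s5 be ga) (s1 al) (s4 be al) (s5 be al) rb pa pc in E4.
rewrite (s1 al) pa pb in F1; rewrite (s1 al) pa pc in F2.
move: E1 E2 E3 E4 F1 F2.
move: (Dw [:: al; be] u x0) (Dw [:: al; ga] u x0) (Dw [:: i1; al; be] u x0)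
  (Dw [:: i1; al; ga] u x0) (Dw [:: be; al; ga] u x0) (Dw [:: i1; ga; be] u x0).
move: (fx al be x0 t i1) (fx al ga x0 t i1) (fx al be x0 t ga) (fx al ga x0 t be)
  (ft al be x0 t) (ft al ga x0 t) (f al be x0 t) (f al ga x0 t).
move: (p al) (p be) (p ga) (r al) (r be) (r ga).
move=> pA pB pC rA rB rC x1 x2 x3 x4 t1 t2 f1 f2 D1 D2 M1 M2 T1 M3 E1 E2 E3 E4 F1 F2.
split.
- by rewrite -F1; ring.
- by rewrite -F2; ring.
- by have := E1; rewrite !mul0r !add0r addr0 => <-; ring.
- by have := E2; rewrite !mul0r !add0r addr0 => <-; ring.
- have -> : x3 - x4 + rC * t1 - rB * t2 = (x3 + rC * t1) - (x4 + rB * t2) by ring.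
  by rewrite -E3 -E4; ring.
Qed.

Lemma f_sym x0 t al be : al != i1 -> be != i1 -> U x0 -> V t -> f al be x0 t = f be al x0 t.
Proof.
move=> ai bi Ux Vt; have [u [uA ue ut _ _]] := quad_solution (fun=> 0) (fun=> 0) Ux Vt.
have sym w w' : perm_eq w w' -> Dw w u x0 = Dw w' u x0 by exact: AN_sym.
have p2 (a b : 'I_n) : perm_eq [:: a; b] [:: b; a] by rewrite (perm_catC [:: a] [:: b]).
have F1 := Delta_center ut (nbhs_singleton ue al be ai bi).
have F2 := Delta_center ut (nbhs_singleton ue be al bi ai).
rewrite (sym _ _ (p2 be al)) (sym _ _ (p2 be i1)) in F2.
rewrite (sym _ _ (p2 al i1)) in F1; rewrite -F1 -F2.
move: (Dw [:: al; be] u x0) (Dw [:: i1; be] u x0) (Dw [:: i1; al] u x0) => p q r.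
by ring.
Qed.

Hypothesis other : forall be, be != i1 -> exists2 ga, ga != i1 & ga != be.

(** The constant term of the identity, obtained with [p = r = 0]. *)
Lemma compat_fx x0 t al be ga : al != i1 -> be != i1 -> ga != i1 -> U x0 -> V t ->
  fx al be x0 t ga = fx al ga x0 t be.
Proof.
move=> ai bi ci Ux Vt.
have [d1 [d2 [m1 [m2 [_ _ _ _ E]]]]] := third_order (fun=> 0) (fun=> 0) ai bi ci Ux Vt.
move: E; rewrite !mul0r !subr0 addr0 => /esym/eqP.
by rewrite subr_eq0 => /eqP.
Qed.

(** Take [p = 0] and [r] the indicator of [ga]: the identity gives [u_{al be} = ft], while the
    equation gives [t u_{al be} = f]. This is Euler's relation for degree one in [t], and [ga] must
    differ from [be]. *)
Lemma ftE x0 t al be : al != i1 -> be != i1 -> U x0 -> V t ->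
  t * ft al be x0 t = f al be x0 t.
Proof.
move=> ai bi Ux Vt; have [ga ci cb] := other bi.
have [d1 [d2 [m1 [m2 [E1 _ _ _ E]]]]] :=
  third_order (fun=> 0) (fun i => (i == ga)%:R) ai bi ci Ux Vt.
move: E E1; rewrite eqxx eq_sym (negPf cb) (compat_fx ai bi ci Ux Vt).
by rewrite !mul0r !mul1r !subr0 subrr add0r => -> ->; rewrite add0r.
Qed.

(** Take [r = 0] and [p] the indicator of [ga]: the identity leaves [u_{1 al be} = 0], and the
    [x^1]-derivative of the equation says [t u_{1 al be} = fx]. *)
Lemma fx1 x0 t al be : al != i1 -> be != i1 -> U x0 -> V t -> fx al be x0 t i1 = 0.
Proof.
move=> ai bi Ux Vt; have [ga ci cb] := other bi.
have [d1 [d2 [m1 [m2 [_ _ E3 _ E]]]]] :=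
  third_order (fun i => (i == ga)%:R) (fun=> 0) ai bi ci Ux Vt.
have e1 : (ga == ga)%:R = 1 :> R by rewrite eqxx.
have e0 : (be == ga)%:R = 0 :> R by rewrite eq_sym (negPf cb).
move: E E3; rewrite e1 e0 (compat_fx ai bi ci Ux Vt) => E E3.
have m0 : m1 = 0 by lra.
by move: E3; rewrite m0; lra.
Qed.

Lemma is_derive_slice x t al be : al != i1 -> be != i1 -> U x -> V t ->
  is_derive t 1 (f al be x) (ft al be x t).
Proof.
move=> ai bi Ux Vt; set j := rshift n ord0 : 'I_(n + 1).
have ptE s : pt j (row_mx x (const_mx t)) s = row_mx x (const_mx s) :> 'rV[R]_(n + 1).
  apply/rowP => b; rewrite mxE; case: (split_ordP b) => k ->.
    by rewrite eq_lrshift !row_mxEl.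
  by rewrite (ord1 k) eqxx row_mxEr mxE.
have := grad_slice ai bi Ux Vt; rewrite -(ptE t) => /grad_pt_is_derive.
rewrite /ft ptE.
have -> // : (fun s => slice al be (pt j (row_mx x (const_mx t)) s)) = f al be x.
by apply/funext => s; rewrite ptE /slice row_mxKl row_mxKr mxE.
Qed.

Lemma is_derive_quot x t al be : al != i1 -> be != i1 -> U x -> V t ->
  is_derive t 1 (fun s => f al be x s * s^-1) 0.
Proof.
move=> ai bi Ux Vt; have t0 : t != 0 := V0 Vt.
have d1 := is_derive_slice ai bi Ux Vt.
have d2 : is_derive t 1 (fun s : R => s^-1) (- (t^-1 * t^-1)).
  have di : is_derive t 1 (fun s : R => s) 1 by exact: is_derive_id.
  have dv : is_derive t 1 (fun s : R => s^-1) (- t ^- 2 *: 1).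
    exact: (@is_deriveV _ (fun s : R => s) t 1 1 t0 di).
  apply: is_derive_eq dv _.
  by rewrite /GRing.scale /=; field.
apply: is_derive_eq (is_derive_mul d1 d2) _.
by rewrite -(ftE ai bi Ux Vt); field.
Qed.

Lemma zero_derive_eq (h : R -> R) (a b : R) :
  (forall c, a <= c <= b \/ b <= c <= a -> is_derive c 1 h 0) -> h a = h b.
Proof.
wlog ab : a b / a <= b.
  move=> H hd; have [ab|/ltW ba] := leP a b; first exact: H.
  by apply/esym/H => // c [] cc; apply: hd; [right | left].
move=> hd.
have mv1 (c : R) : c \in `]a, b[%R -> is_derive c 1 h ((fun=> 0) c).
  by rewrite in_itv /= => /andP[/ltW ac /ltW cb]; apply: hd; left; rewrite ac cb.
have mv2 : {within [set` `[a, b]%R], continuous h}.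
  apply: derivable_within_continuous => c; rewrite in_itv /= => cab.
  by have [] := hd c (or_introl cab).
have [c _] := MVT_segment ab mv1 mv2.
by rewrite mul0r => /eqP; rewrite subr_eq0 => /eqP.
Qed.

Lemma wellposed_compat : connected (U `*` V) ->
  exists g : 'I_n -> 'I_n -> 'rV[R]_n -> R,
    (forall al be, al != i1 -> be != i1 -> forall x t, U x -> V t -> f al be x t = g al be x * t) /\
    (forall al be ga, al != i1 -> be != i1 -> ga != i1 -> forall x, U x ->
       [/\ g al be x = g be al x, pd i1 (g al be) x = 0 &
           pd ga (g al be) x = pd be (g al ga) x]).
Proof.
move=> cUV; have [[t0 Vt0]|Vn] := pselect (exists t, V t); last first.
  (* With [V] empty the normal form holds vacuously for any [g]; zero meets the compatibility
     conditions. *)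
  exists (fun _ _ _ => 0); split=> [al be _ _ x t _ Vt|al be ga _ _ _ x _].
    by case: Vn; exists t.
  by split=> //; rewrite ?pd_cst.
exists (fun al be x => f al be x t0 * t0^-1); split=> [al be ai bi x t Ux Vt|].
  (* [V] is the projection of the connected product, onto because [U] contains [x]. Hence [t] and
     [t0] are joined inside [V], where [f / t] has zero derivative. *)
  have iV : is_interval V.
    apply/connected_intervalP.
    have -> : V = snd @` (U `*` V).
      by apply/seteqP; split=> [s Vs|_ [[y s] [_ Vs] <-]//]; exists (x, s).
    apply: connected_continuous_connected cUV _.
    by apply: continuous_subspaceT => y; exact: cvg_snd.
  have -> : f al be x t0 * t0^-1 = f al be x t * t^-1.
    apply: (zero_derive_eq (h := fun s => f al be x s * s^-1)) => c cc.
    apply: is_derive_quot => //.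
    by case: cc => cc; [apply: (iV t0 t) | apply: (iV t t0)].
  by rewrite mulfVK//; exact: V0.
move=> al be ga ai bi ci x Ux.
have pg a b j : a != i1 -> b != i1 ->
    pd j (fun x => f a b x t0 * t0^-1) x = fx a b x t0 j * t0^-1.
  move=> ai' bi'.
  have g1 := @grad_subst a b x (fun=> t0) (fun=> 0) ai' bi' Ux Vt0 (grad_cst t0 x).
  rewrite (grad_pd j (gradM g1 (grad_cst (t0^-1) x))).
  by rewrite mul0r addr0 mulr0 addr0.
split; first by rewrite f_sym.
  by rewrite pg// fx1// mul0r.
by rewrite !pg// compat_fx.
Qed.

End Necessity.

Unset Implicit Arguments. Set Strict Implicit. Set Printing Implicit Defensive.

Theorem theorem1p3 (R : realType) (n : nat) (hn : (2 < n)%N)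
    (U : set 'rV[R]_n) (V : set R)
    (f : 'I_n -> 'I_n -> 'rV[R]_n -> R -> R) :
  open U -> open V -> V `<=` [set t | t != 0] -> connected (U `*` V) ->
  (forall al be : 'I_n, al != ord_first (ltnW (ltnW hn)) ->
     be != ord_first (ltnW (ltnW hn)) -> analytic_on2 (f al be) U V) ->
  let i1 := ord_first (ltnW (ltnW hn)) in
  (* (i) *)
  ((forall (x0 : 'rV[R]_n), U x0 ->
     forall (a : R -> R) (aa : 'I_n -> R -> R) (I : set R),
       open I -> I (x0 ord0 i1) -> analytic_on1 a I ->
       (forall al : 'I_n, al != i1 -> analytic_on1 (aa al) I) ->
       V (derive1 (derive1 a) (x0 ord0 i1)) ->
       (exists W u, solves i1 U V f x0 a aa I W u) /\
       (forall W1 u1 W2 u2, solves i1 U V f x0 a aa I W1 u1 ->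
          solves i1 U V f x0 a aa I W2 u2 ->
          \forall x \near x0, u1 x = u2 x))
   <->
   (* (ii) *)
   (exists g : 'I_n -> 'I_n -> 'rV[R]_n -> R,
      (forall al be : 'I_n, al != i1 -> be != i1 ->
         forall x t, U x -> V t -> f al be x t = g al be x * t) /\
      (forall al be ga : 'I_n, al != i1 -> be != i1 -> ga != i1 ->
         forall x, U x ->
           [/\ g al be x = g be al x,
               pd i1 (g al be) x = 0
             & pd ga (g al be) x = pd be (g al ga) x]))).
Proof.
move=> oU oV V0 cUV fA i1; split=> [wp|[g [fg gc]]]; last first.
  exact: (compat_wellposed oU oV V0 fA fg gc).
(* Of the indices [1] and [2], available since [2 < n], at least one differs from [be]. *)
have other (be : 'I_n) : be != i1 -> exists2 ga, ga != i1 & ga != be.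
  move=> bi; have h1 : (1 < n)%N := ltnW hn.
  have [b1|b1] := eqVneq (Ordinal h1) be; last by exists (Ordinal h1).
  by exists (Ordinal hn) => //; rewrite -b1.
apply: (wellposed_compat V0 fA _ other cUV).
by move=> x0 Ux a aa I oI Ix aA aaA Va; have [] := wp x0 Ux a aa I oI Ix aA aaA Va.
Qed.
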